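(* Let $\varepsilon \in\{0, 1,-1\}$. Then there is a homeomorphism $$\mathcal{M}_{umb}\left(\mathbb{M}^{m}_{s}(\varepsilon),\mathbb{M}^{n}_{p}(\varepsilon)\right) \cong \begin{cases} \{\ast\} & (n = m+1,\ p = s,\, s+1,\ \text{or}\ n = m+2,\ p=s), \\ (X, \mathcal{O}_{X}) & (n \geq m+2,\ p \geq s + 1), \end{cases}$$ where $\{\ast\}$ is the one-point space and the topological space $(X, \mathcal{O}_{X})$ is defined by $$X := \{g, u\}, \qquad \mathcal{O}_{X} := \{ \emptyset, \{u\}, X \}.$$ Here the elements $g$ and $u$ of $X$ express the congruence classes of totally geodesic isometric immersions and of non-totally geodesic, totally umbilical isometric immersions, respectively. Moreover, the space $(X, \mathcal{O}_{X})$ is connected and non-Hausdorff.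
   Context: $m,n$ are positive integers. $\mathbb{E}^{n}_{p}$ is $\mathbb{R}^n$ with the metric $\langle\cdot,\cdot\rangle_p=-\sum_{i=1}^{p}dx_i^2+\sum_{j=p+1}^{n}dx_j^2$. The space forms are $\mathbb{M}^n_p(0)=\mathbb{E}^n_p$, $\mathbb{M}^n_p(1)=\mathbb{S}^n_p(1)=\{x\in\mathbb{E}^{n+1}_p\mid\langle x,x\rangle_p=1\}$, and $\mathbb{M}^n_p(-1)=\mathbb{H}^n_p(-1)=\{x\in\mathbb{E}^{n+1}_{p+1}\mid\langle x,x\rangle_{p+1}=-1\}$, with the induced metrics; the lower index is the index of the metric. For pseudo-Riemannian manifolds $(M,g)$, $(\bar M,\bar g)$, consider the space $\{\phi\in C^\infty(M,\bar M)\mid\phi^*\bar g=g\}$ of isometric immersions, with the compact-open $C^\infty$-topology. The isometry group of $\bar M$ acts on it by composition; the quotient space is the moduli space $\mathcal{M}(M,\bar M)$ of isometric immersions. $\mathcal{M}_{umb}(M,\bar M)\subset\mathcal{M}(M,\bar M)$ is the subspace of classes of totally umbilical isometric immersions. An isometric immersion with second fundamental form $h$ and mean curvature vector field $H$ is totally umbilical if $h(X,Y)=g(X,Y)H$ for all $X,Y\in\Gamma(TM)$, and totally geodesic if $h=0$.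
   Formalization: The formal theorem assumes m ≥ 2, adds p − s < n − m in the second case, and takes one connected component of the two-sheeted space forms H^n_0(−1) and S^n_n(1); the claim fails without these (e.g. curves E^1→E^2, E^2_0→E^4_2, sheets immersed independently). *)

(* Defs.v *)
From HB Require Import structures.
From mathcomp Require Import all_boot all_order all_algebra.
From mathcomp Require Import all_classical all_reals all_analysis.
Import Order.TTheory GRing.Theory Num.Theory.
Import numFieldNormedType.Exports.

Set Implicit Arguments.
Unset Strict Implicit.
Unset Printing Implicit Defensive.

Local Open Scope classical_set_scope.
Local Open Scope ring_scope.

Section PseudoEuclidean.
Context {R : realType}.

Definition pform (q : nat) {N : nat} (u v : 'rV[R]_N) : R :=
  \sum_(i < N) (if (i < q)%N then - (u 0 i * v 0 i) else u 0 i * v 0 i).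

(* The space form of dimension n, index p and curvature eps lives in a
   pseudo-Euclidean space of dimension amb_dim eps n and index amb_idx eps p. *)
Definition amb_dim (eps : int) (n : nat) : nat := (n + (eps != 0))%N.
Definition amb_idx (eps : int) (p : nat) : nat := (p + (eps == -1)%R)%N.

Definition quadric (eps : int) (n p : nat) : set 'rV[R]_(amb_dim eps n) :=
  [set x | eps != 0 -> pform (amb_idx eps p) x x = eps%:~R].
Arguments quadric : clear implicits.

(* The quadric is connected, and equal to this component, except that
   H^n_0 (eps = -1, p = 0) and S^n_n (eps = 1, p = n) have two sheets; as
   manifolds are taken to be connected, the space form is then the sheet of
   x0. *)
Definition space_form (eps : int) (n p : nat) (x0 : 'rV[R]_(amb_dim eps n)) :
    set 'rV[R]_(amb_dim eps n) :=
  connected_component (quadric eps n p) x0.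

End PseudoEuclidean.

Arguments quadric {R} eps n p x.
Arguments space_form {R} eps n p x0 x.

Section Submanifolds.
Context {R : realType}.

Definition iter_derive {m N : nat} (a : seq 'rV[R]_m)
    (f : 'rV[R]_m -> 'rV[R]_N) : 'rV[R]_m -> 'rV[R]_N :=
  foldr (fun v g => 'D_v g) f a.

Definition smooth_on {m N : nat} (V : set 'rV[R]_m)
    (f : 'rV[R]_m -> 'rV[R]_N) : Prop :=
  forall (a : seq 'rV[R]_m) (x : 'rV[R]_m),
    V x -> differentiable (iter_derive a f) x.

(* psi restricted to V is a smooth local parametrization (the inverse of a
   chart) of the m-dimensional embedded submanifold S; the last condition says
   that psi is a homeomorphism from V onto an open subset of S. *)
Definition local_param {m N : nat} (S : set 'rV[R]_N) (V : set 'rV[R]_m)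
    (psi : 'rV[R]_m -> 'rV[R]_N) : Prop :=
  [/\ open V, smooth_on V psi,
      (forall x v, V x -> 'D_v psi x = 0 -> v = 0),
      (forall x y, V x -> V y -> psi x = psi y -> x = y)
    & forall U, open U -> U `<=` V ->
        exists2 W : set 'rV[R]_N, open W & psi @` U = S `&` W].

Definition smooth_map (m : nat) {N N' : nat} (S : set 'rV[R]_N)
    (S' : set 'rV[R]_N') (f : 'rV[R]_N -> 'rV[R]_N') : Prop :=
  (forall x, S x -> S' (f x)) /\
  (forall (V : set 'rV[R]_m) psi, local_param S V psi -> smooth_on V (f \o psi)).

(* S and S' carry the metrics induced by pform q and pform q'. *)
Definition isometric_immersion (m q q' : nat) {N N' : nat}
    (S : set 'rV[R]_N) (S' : set 'rV[R]_N')
    (f : 'rV[R]_N -> 'rV[R]_N') : Prop :=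
  smooth_map m S S' f /\
  (forall (V : set 'rV[R]_m) psi, local_param S V psi ->
     forall x v w, V x ->
       pform q' ('D_v (f \o psi) x) ('D_w (f \o psi) x) =
       pform q ('D_v psi x) ('D_w psi x)).

Definition isometry (n q : nat) {N : nat} (S : set 'rV[R]_N)
    (F : 'rV[R]_N -> 'rV[R]_N) : Prop :=
  isometric_immersion n q q S S F /\
  exists2 G, smooth_map n S S G &
    forall y, S y -> G (F y) = y /\ F (G y) = y.

End Submanifolds.

Section SecondFundamentalForm.
Context {R : realType}.
Variables (eps : int) (m q q' N N' : nat).
Variables (f : 'rV[R]_N -> 'rV[R]_N') (psi : 'rV[R]_m -> 'rV[R]_N).
Implicit Types (x v w : 'rV[R]_m) (y xi : 'rV[R]_N').

Definition gram x : 'M[R]_m :=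
  \matrix_(i, j) pform q ('D_(delta_mx 0 i) psi x) ('D_(delta_mx 0 j) psi x).

(* Orthogonal projection onto the tangent space at y of the space form: that
   space is everything if eps = 0, and y^perp with <y,y> = eps otherwise. *)
Definition tangent_proj y xi : 'rV[R]_N' :=
  xi - (eps%:~R * pform q' xi y) *: y.

(* The Levi-Civita derivative, in the target, of the field f_* d_w along d_v. *)
Definition cov_derive x v w : 'rV[R]_N' :=
  tangent_proj (f (psi x)) ('D_v ('D_w (f \o psi)) x).

(* Component of xi orthogonal to the image of df, for f isometric. *)
Definition normal_part x xi : 'rV[R]_N' :=
  xi - \sum_(i < m) \sum_(j < m)
         (invmx (gram x) i j * pform q' xi ('D_(delta_mx 0 i) (f \o psi) x))
           *: 'D_(delta_mx 0 j) (f \o psi) x.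

(* h(X, Y) at psi x for X = d_v psi, Y = d_w psi. *)
Definition second_form x v w : 'rV[R]_N' := normal_part x (cov_derive x v w).

Definition mean_curvature x : 'rV[R]_N' :=
  (m%:R)^-1 *: \sum_(i < m) \sum_(j < m)
    invmx (gram x) i j *: second_form x (delta_mx 0 i) (delta_mx 0 j).

End SecondFundamentalForm.

Definition totally_umbilical {R : realType} (eps : int) (m q q' : nat)
    {N N' : nat} (S : set 'rV[R]_N) (f : 'rV[R]_N -> 'rV[R]_N') : Prop :=
  forall (V : set 'rV[R]_m) psi, local_param S V psi ->
    forall x v w, V x ->
      second_form eps q q' f psi x v w =
      pform q ('D_v psi x) ('D_w psi x) *: mean_curvature eps q q' f psi x.

Definition totally_geodesic {R : realType} (eps : int) (m q q' : nat)
    {N N' : nat} (S : set 'rV[R]_N) (f : 'rV[R]_N -> 'rV[R]_N') : Prop :=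
  forall (V : set 'rV[R]_m) psi, local_param S V psi ->
    forall x v w, V x -> second_form eps q q' f psi x v w = 0.

(* Isometric immersions from S (dimension m) to S' (dimension n); a map on S
   is encoded by its extension by zero to the ambient space. *)
Record iso_imm (R : realType) (m n q q' N N' : nat)
    (S : set 'rV[R]_N) (S' : set 'rV[R]_N') := IsoImm {
  imm_fun :> 'rV[R]_N -> 'rV[R]_N' ;
  imm_isometric : isometric_immersion m q q' S S' imm_fun ;
  imm_off : forall x, ~ S x -> imm_fun x = 0
}.

Section Moduli.
Context {R : realType} {m n q q' N N' : nat}.
Context {S : set 'rV[R]_N} {S' : set 'rV[R]_N'}.
Local Notation imm := (iso_imm m n q q' S S').

HB.instance Definition _ := gen_eqMixin imm.
HB.instance Definition _ := gen_choiceMixin imm.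

(* Subbasis of the compact-open C^infinity topology: uniform closeness on
   compact sets of an iterated derivative read in a local parametrization of S.
   Derivatives of maps to S' are compared in the ambient vector space. *)
Definition cinfty_subbase : set (set imm) :=
  [set A | exists (f : imm) (V K : set 'rV[R]_m) (psi : 'rV[R]_m -> 'rV[R]_N)
             (a : seq 'rV[R]_m) (e : R),
     [/\ local_param S V psi, compact K, K `<=` V, 0 < e &
         A = [set f' : imm | forall x, K x ->
                `|iter_derive a (f' \o psi) x - iter_derive a (f \o psi) x| < e]]].

HB.instance Definition _ :=
  isSubBaseTopological.Build imm cinfty_subbase (fun A : set imm => A).

Definition congruence_class (f : imm) : set imm :=
  [set f' | exists2 F, isometry n q' S' F & forall x, S x -> f' x = F (f x)].

Record orbits_of := Orbit {
  orbit_set :> set imm ;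
  orbit_setP : exists f, orbit_set = congruence_class f
}.

End Moduli.

Arguments orbits_of {R} m n q q' {N N'} S S'.

Section ModuliSpace.
Context {R : realType} {m n q q' N N' : nat}.
Context {S : set 'rV[R]_N} {S' : set 'rV[R]_N'}.
Local Notation imm := (iso_imm m n q q' S S').
Local Notation orbits := (orbits_of m n q q' S S').

Definition orbit_pi (f : imm) : orbits :=
  Orbit (ex_intro _ f erefl).

Definition orbit_repr (C : orbits) : imm := projT1 (cid (orbit_setP C)).

Lemma orbit_reprK : cancel orbit_repr orbit_pi.
Proof.
move=> C; rewrite /orbit_repr; case: cid => f /=; case: C => D DP /= fD.
by subst D; rewrite /orbit_pi; congr Orbit; exact: Prop_irrelevance.
Qed.

HB.instance Definition _ := gen_eqMixin orbits.
HB.instance Definition _ := gen_choiceMixin orbits.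
HB.instance Definition _ := isQuotient.Build imm orbits orbit_reprK.

End ModuliSpace.

Definition moduli {R : realType} (m n q q' : nat) {N N' : nat}
    (S : set 'rV[R]_N) (S' : set 'rV[R]_N') : topologicalType :=
  quotient_topology (orbits_of m n q q' S S').

Definition moduli_class {R : realType} {m n q q' N N' : nat}
    {S : set 'rV[R]_N} {S' : set 'rV[R]_N'} (f : iso_imm m n q q' S S') :
  moduli m n q q' S S' := orbit_pi f.

Lemma moduli_openE (R : realType) (m n q q' N N' : nat) (S : set 'rV[R]_N)
    (S' : set 'rV[R]_N') (A : set (moduli m n q q' S S')) :
  open A = open (moduli_class @^-1` A).
Proof.
rewrite (_ : moduli_class = \pi_(moduli m n q q' S S')%qT) //.
by rewrite unlock.
Qed.

Definition umbilical_classes {R : realType} (eps : int) (m n q q' : nat)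
    {N N' : nat} (S : set 'rV[R]_N) (S' : set 'rV[R]_N') :
    set (moduli m n q q' S S') :=
  [set C | exists2 f : iso_imm m n q q' S S',
     totally_umbilical eps m q q' S f & C = moduli_class f].

Arguments umbilical_classes {R} eps m n q q' {N N'} S S'.

Section SpaceForms.
Context {R : realType} (eps : int) (m s n p : nat).
Variables (x0 : 'rV[R]_(amb_dim eps m)) (y0 : 'rV[R]_(amb_dim eps n)).
Local Notation M := (space_form eps m s x0).
Local Notation M' := (space_form eps n p y0).

Definition sf_imm : Type :=
  iso_imm m n (amb_idx eps s) (amb_idx eps p) M M'.

Definition sf_umbilical (f : sf_imm) : Prop :=
  totally_umbilical eps m (amb_idx eps s) (amb_idx eps p) M f.

Definition sf_geodesic (f : sf_imm) : Prop :=
  totally_geodesic eps m (amb_idx eps s) (amb_idx eps p) M f.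

(* A subset used as a type carries the subspace topology. *)
Definition moduli_umb : topologicalType :=
  set_type (umbilical_classes eps m n (amb_idx eps s) (amb_idx eps p) M M').

End SpaceForms.

Arguments sf_imm {R} eps m s n p x0 y0.
Arguments moduli_umb {R} eps m s n p x0 y0.

Inductive gu_space : Type := gu_g | gu_u.

HB.instance Definition _ := gen_eqMixin gu_space.
HB.instance Definition _ := gen_choiceMixin gu_space.

Definition gu_open : set (set gu_space) :=
  [set A | [\/ A = set0, A = [set gu_u] | A = setT]].

Lemma gu_openT : gu_open setT.
Proof. exact: Or33. Qed.

Lemma gu_openP (A : set gu_space) : gu_open A <-> (A gu_g -> A = setT).
Proof.
split=> [[->|->|->]//|h].
have [Ag|nAg] := pselect (A gu_g); first by apply: Or33; exact: h.
have [Au|nAu] := pselect (A gu_u).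
  apply: Or32; apply/seteqP; split=> [[]//|x ->//].
by apply: Or31; apply/seteqP; split=> // -[].
Qed.

Lemma gu_openI : setI_closed gu_open.
Proof.
move=> A B /gu_openP hA /gu_openP hB; apply/gu_openP => -[/hA -> /hB ->].
by rewrite setTI.
Qed.

Lemma gu_open_bigU (I : Type) (f : I -> set gu_space) :
  (forall i, gu_open (f i)) -> gu_open (\bigcup_i f i).
Proof.
move=> h; apply/gu_openP => -[i _ fi]; apply/seteqP; split=> // x _.
by exists i => //; have /gu_openP -> := h i.
Qed.

HB.instance Definition _ :=
  isOpenTopological.Build gu_space gu_openT gu_openI gu_open_bigU.

Definition homeomorphism {X Y : topologicalType} (f : X -> Y) : Prop :=
  continuous f /\
  exists h : Y -> X, [/\ continuous h, cancel f h & cancel h f].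

(* Main.v *)
(* On a stereographic chart psi of the source the metric is eta / tau^2, with
   eta a constant diagonal form. For an umbilical f, the Hessian of tau (f o psi)
   is eta K for some vector function K; comparing third derivatives in two
   different directions (m >= 2) shows that K is constant, so tau (f o psi) is a
   quadratic polynomial. In the ambient space this reads f (y) = b + y B + k (y) c,
   locally and then globally by connectedness, where k (y) is <y, y> / 2 in the
   flat case and the constant eps otherwise, B is a linear isometry, and c, the
   mean curvature vector, is null and orthogonal to the image of B. In codimension
   0 this says that isometries of space forms are linear (affine in the flat
   case). By Witt's theorem there are then at most two congruence classes, c = 0
   and c <> 0, and the second one is nonempty exactly when the orthogonal of the
   image of B is indefinite. Letting c tend to 0 shows that every neighborhood of
   the first class contains the second one, while the maps that preserve linear
   (affine in the flat case) relations between points are closed for pointwise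
   convergence. *)
Require Import Defs.
From HB Require Import structures.
From mathcomp Require Import finmap.
From mathcomp Require Import all_boot all_order all_algebra.
From mathcomp Require Import all_classical all_reals all_analysis.
From mathcomp Require Import ring lra zify.
Import Order.TTheory GRing.Theory Num.Theory.
Import numFieldNormedType.Exports.

Set Implicit Arguments.
Unset Strict Implicit.
Unset Printing Implicit Defensive.

Local Open Scope classical_set_scope.
Local Open Scope ring_scope.

(** * Pseudo-Euclidean linear algebra *)

Section PseudoEuclideanForm.
Context {R : realType}.

(** The three curvatures are handled by one computation: [eps%:~R] vanishes exactly in the flat
    case, so [eps * eps] and [1 - eps * eps] serve as indicators of the curved and the flat case,
    and orthogonality to the position vector is always stated with a factor [eps]. Passing from
    [f o psi] to [tau (f o psi)] is dictated by the Christoffel symbols of a conformally flat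
    metric: through the Koszul formula they put first derivatives of the immersion into its Hessian,
    and the product rule with [tau] produces exactly the opposite terms. A quadric may have two
    sheets, and a linear isometry of the ambient space may exchange them. By connectedness it
    preserves a sheet as soon as it maps one of its points into it; this is why a base point is
    carried through the constructions of isometries and immersions. Isometries of the target are
    defined intrinsically. That they compose, and that their inverses are isometries, is deduced
    from their linearity, so the structure theorem is used both for the immersions and for the group
    acting on them. *)

Definition psign (q i : nat) : R := if (i < q)%N then -1 else 1.

Lemma psign2 q i : psign q i * psign q i = 1 :> R.
Proof. by rewrite /psign; case: ifP => _; ring. Qed.

Lemma psign_neq0 q i : psign q i != 0 :> R.
Proof. by rewrite /psign; case: ifP => _; rewrite ?oppr_eq0 oner_eq0. Qed.

Lemma pformE q N (u v : 'rV[R]_N) :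
  pform q u v = \sum_(i < N) psign q i * (u 0 i * v 0 i).
Proof.
by apply: eq_bigr => i _; rewrite /psign; case: ifP; rewrite ?mulN1r ?mul1r.
Qed.

Lemma pformC q N (u v : 'rV[R]_N) : pform q u v = pform q v u.
Proof. by rewrite !pformE; apply: eq_bigr => i _; rewrite (mulrC (u _ _)). Qed.

Lemma pformDl q N (u v w : 'rV[R]_N) :
  pform q (u + v) w = pform q u w + pform q v w.
Proof.
rewrite !pformE -big_split; apply: eq_bigr => i _ /=; rewrite mxE; ring.
Qed.

Lemma pformDr q N (u v w : 'rV[R]_N) :
  pform q w (u + v) = pform q w u + pform q w v.
Proof. by rewrite pformC pformDl !(pformC _ w). Qed.

Lemma pformZl q N a (u v : 'rV[R]_N) : pform q (a *: u) v = a * pform q u v.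
Proof.
by rewrite !pformE mulr_sumr; apply: eq_bigr => i _ /=; rewrite mxE; ring.
Qed.

Lemma pformZr q N a (u v : 'rV[R]_N) : pform q u (a *: v) = a * pform q u v.
Proof. by rewrite pformC pformZl pformC. Qed.

Lemma pformNl q N (u v : 'rV[R]_N) : pform q (- u) v = - pform q u v.
Proof. by rewrite -scaleN1r pformZl mulN1r. Qed.

Lemma pformNr q N (u v : 'rV[R]_N) : pform q u (- v) = - pform q u v.
Proof. by rewrite pformC pformNl pformC. Qed.

Lemma pform0l q N (u : 'rV[R]_N) : pform q 0 u = 0.
Proof. by rewrite -(scale0r u) pformZl mul0r. Qed.

Lemma pform0r q N (u : 'rV[R]_N) : pform q u 0 = 0.
Proof. by rewrite pformC pform0l. Qed.

Definition pformX :=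
  (pformDl, pformDr, pformNl, pformNr, pformZl, pformZr, pform0l, pform0r).

Lemma pform_suml q N I (s : seq I) P (F : I -> 'rV[R]_N) v :
  pform q (\sum_(i <- s | P i) F i) v = \sum_(i <- s | P i) pform q (F i) v.
Proof.
apply: (big_morph (fun u => pform q u v)) => [u w|]; first exact: pformDl.
exact: pform0l.
Qed.

Lemma pform_sumr q N I (s : seq I) P (F : I -> 'rV[R]_N) v :
  pform q v (\sum_(i <- s | P i) F i) = \sum_(i <- s | P i) pform q v (F i).
Proof. by rewrite pformC pform_suml; apply: eq_bigr => i _; exact: pformC. Qed.

Lemma pform_delta q N (u : 'rV[R]_N) i :
  pform q u (delta_mx 0 i) = psign q i * u 0 i.
Proof.
rewrite pformE (bigD1 i) //= mxE !eqxx mulr1 big1 ?addr0 // => j ji.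
by rewrite mxE eqxx (negbTE ji) !mulr0.
Qed.

Lemma pform_nondeg q N (u : 'rV[R]_N) : (forall v, pform q u v = 0) -> u = 0.
Proof.
move=> h; apply/rowP => i; rewrite mxE; have := h (delta_mx 0 i).
by rewrite pform_delta => /eqP; rewrite mulf_eq0 (negbTE (psign_neq0 _ _)) => /eqP.
Qed.

Lemma pform_sqrB q N (u v : 'rV[R]_N) :
  pform q (u - v) (u - v) = pform q u u - 2 * pform q u v + pform q v v.
Proof. by rewrite !pformX (pformC q v u); ring. Qed.

Lemma pform_sqrD q N (u v : 'rV[R]_N) :
  pform q (u + v) (u + v) = pform q u u + 2 * pform q u v + pform q v v.
Proof. by rewrite !pformX (pformC q v u); ring. Qed.

(** The covector [<., a>] as a column, so that [pdual q a *m b] is the rank-one map sending [x] to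
    [<x, a> b]. *)
Definition pdual (q N : nat) (a : 'rV[R]_N) : 'cV[R]_N :=
  \col_i (psign q i * a 0 i).

Lemma mulmx_pdual q N (x a : 'rV[R]_N) : x *m pdual q a = (pform q x a)%:M.
Proof.
apply/rowP => i; rewrite ord1 pformE !mxE eqxx mulr1n; apply: eq_bigr => j _.
by rewrite mxE; ring.
Qed.

Definition pisom (q q' N N' : nat) (B : 'M[R]_(N, N')) : Prop :=
  forall u v, pform q' (u *m B) (v *m B) = pform q u v.

Lemma pisom1 q N : pisom q q (1%:M : 'M[R]_N).
Proof. by move=> u v; rewrite !mulmx1. Qed.

Lemma pisomM q q' q'' N N' N'' (A : 'M[R]_(N, N')) (B : 'M[R]_(N', N'')) :
  pisom q q' A -> pisom q' q'' B -> pisom q q'' (A *m B).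
Proof. by move=> hA hB u v; rewrite !mulmxA hB hA. Qed.

Lemma pisom_inj q q' N N' (B : 'M[R]_(N, N')) (u : 'rV[R]_N) :
  pisom q q' B -> u *m B = 0 -> u = 0.
Proof.
by move=> hB uB; apply: (@pform_nondeg q) => v; rewrite -hB uB pform0l.
Qed.

Lemma pisom_unit q N (T : 'M[R]_N) : pisom q q T -> T \in unitmx.
Proof.
move=> hT; rewrite -row_free_unit -kermx_eq0; apply/eqP/row_matrixP => i.
rewrite row0; apply: (pisom_inj hT).
by apply/eqP; rewrite -sub_kermx row_sub.
Qed.

Lemma pisomV q N (T : 'M[R]_N) : pisom q q T -> pisom q q (invmx T).
Proof.
move=> hT u v; have uT := pisom_unit hT.
by rewrite -(hT (u *m _)) !mulmxKV.
Qed.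

Definition reflection q N (a : 'rV[R]_N) : 'M[R]_N :=
  1%:M - (2 / pform q a a) *: (pdual q a *m a).

Lemma mulmx_reflection q N (a x : 'rV[R]_N) :
  x *m reflection q a = x - (2 / pform q a a * pform q x a) *: a.
Proof.
rewrite mulmxBr mulmx1 -scalemxAr mulmxA mulmx_pdual mul_scalar_mx.
by rewrite scalerA.
Qed.

Lemma reflection_pisom q N (a : 'rV[R]_N) :
  pform q a a != 0 -> pisom q q (reflection q a).
Proof.
move=> a0 u v; rewrite !mulmx_reflection !pformX (pformC _ a v).
by field.
Qed.

Lemma reflection_fix q N (a x : 'rV[R]_N) :
  pform q x a = 0 -> x *m reflection q a = x.
Proof. by move=> xa; rewrite mulmx_reflection xa mulr0 scale0r subr0. Qed.

Lemma reflection_sub q N (u v : 'rV[R]_N) :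
  pform q u u = pform q v v -> pform q (u - v) (u - v) != 0 ->
  u *m reflection q (u - v) = v.
Proof.
move=> uv h; have puv : pform q u (u - v) = pform q (u - v) (u - v) / 2.
  by rewrite pform_sqrB !pformX uv; field.
rewrite mulmx_reflection puv (_ : _ * _ = 1) ?scale1r ?subKr //.
by field.
Qed.

(* One of u - v and u + v is not null since their norms add up to
   4 <v, v>; in the second case, compose with the reflection in v. *)
Lemma pisom_swap q N (u v : 'rV[R]_N) :
  pform q u u = pform q v v -> pform q v v != 0 ->
  exists T, [/\ pisom q q T, u *m T = v &
    forall x, pform q x u = 0 -> pform q x v = 0 -> x *m T = x].
Proof.
move=> uv v0.
have [uBv|uBv] := eqVneq (pform q (u - v) (u - v)) 0; last first.
  exists (reflection q (u - v)); split; first exact: reflection_pisom.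
    exact: reflection_sub.
  by move=> x xu xv; apply: reflection_fix; rewrite !pformX xu xv subr0.
have uDv : pform q (u + v) (u + v) != 0.
  move: uBv; rewrite !pformX uv (pformC _ v u) => h; apply: contra_neq v0.
  by move=> h'; lra.
(* The first reflection sends [u] to [- v], the second one [- v] to [v]. *)
exists (reflection q (u + v) *m reflection q v); split.
- by apply: pisomM; exact: reflection_pisom.
- have := @reflection_sub q _ u (- v); rewrite opprK => /(_ _ uDv) uE.
  rewrite mulmxA uE; last by rewrite !pformX opprK uv.
  rewrite mulmx_reflection !pformX.
  have -> : 2 / pform q v v * - pform q v v = - 2 by field.
  by rewrite scaleNr opprK scaler_nat mulr2n addKr.
- move=> x xu xv; rewrite mulmxA !reflection_fix // ?pformX ?xu ?xv ?addr0 //.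
Qed.

(** Induction on the frame: once [T] has placed the tail, [pisom_swap] places the head without
    moving the tail, which is orthogonal both to the current image of the head and to its target. *)
Lemma witt_orthogonal (I : eqType) q N (s : seq I) (v w : I -> 'rV[R]_N) :
  uniq s ->
  {in s &, forall i j, pform q (v i) (v j) = pform q (w i) (w j)} ->
  {in s &, forall i j, i != j -> pform q (w i) (w j) = 0} ->
  {in s, forall i, pform q (w i) (w i) != 0} ->
  exists2 T, pisom q q T & {in s, forall i, v i *m T = w i}.
Proof.
elim: s => [|k s IH] /=; first by move=> *; exists 1%:M => //; exact: pisom1.
case/andP => ks us vw wo wn.
have sub i : i \in s -> i \in k :: s by rewrite inE orbC => ->.
have [|||T hT vT] := IH us.
- by move=> i j /sub hi /sub hj; exact: vw.
- by move=> i j /sub hi /sub hj; exact: wo.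
- by move=> i /sub hi; exact: wn.
have kk : k \in k :: s by rewrite mem_head.
have [||U [hU kU fixU]] := @pisom_swap q N (v k *m T) (w k).
- by rewrite hT vw.
- exact: wn.
exists (T *m U); first exact: pisomM hT hU.
move=> i; rewrite inE => /predU1P[->|si]; first by rewrite mulmxA.
have ik : i != k by apply: contraNneq ks => <-.
rewrite mulmxA vT // fixU //; first by rewrite -vT // hT vw // ?wo // sub.
by rewrite wo // sub.
Qed.

Lemma exists_pairing q N (c : 'rV[R]_N) : c != 0 -> exists d, pform q c d != 0.
Proof.
move=> c0; apply/not_existsP => h; case/eqP: c0; apply: (@pform_nondeg q) => v.
by apply/eqP; apply: contra_notT (h v).
Qed.

(* Two null vectors c, c' of the orthogonal of the frame w are both moved by
   a reflection to a third null vector, paired nontrivially with each. *)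
Lemma witt_null (I : finType) q N (w : I -> 'rV[R]_N) (c c' : 'rV[R]_N) :
  (forall i j, i != j -> pform q (w i) (w j) = 0) ->
  (forall i, pform q (w i) (w i) != 0) ->
  (forall i, pform q c (w i) = 0) -> (forall i, pform q c' (w i) = 0) ->
  pform q c c = 0 -> pform q c' c' = 0 -> c != 0 -> c' != 0 ->
  exists T, [/\ pisom q q T, c *m T = c' & forall i, w i *m T = w i].
Proof.
move=> wo wn cw c'w cc c'c' c0 c'0.
(* Some [d] pairs nontrivially with both null vectors. Removing its projection on the frame keeps
   these pairings, since [c] and [c'] are orthogonal to the frame. *)
have [d [dc dc' dw]] : exists d, [/\ pform q d c != 0, pform q d c' != 0 &
    forall i, pform q d (w i) = 0].
  have [d1 cd1] := exists_pairing q c0; have [d2 c'd2] := exists_pairing q c'0.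
  have [d [cd c'd]] : exists d, pform q c d != 0 /\ pform q c' d != 0.
    have [c'd1|] := eqVneq (pform q c' d1) 0; last by exists d1.
    have [cd2|] := eqVneq (pform q c d2) 0; last by exists d2.
    by exists (d1 + d2); rewrite !pformX c'd1 cd2 addr0 add0r.
  exists (d - \sum_i (pform q d (w i) / pform q (w i) (w i)) *: w i).
  have orth u : (forall i, pform q u (w i) = 0) -> pform q u
      (\sum_i (pform q d (w i) / pform q (w i) (w i)) *: w i) = 0.
    by move=> uw; rewrite pform_sumr big1 // => i _; rewrite pformZr uw mulr0.
  split; first by rewrite pformC pformDr pformNr orth // subr0.
    by rewrite pformC pformDr pformNr orth // subr0.
  move=> i; rewrite pformDl pformNl pform_suml (bigD1 i) //= big1 => [|j ji].
    by rewrite pformZl addr0 mulfVK // subrr.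
  by rewrite pformZl (wo j i) // mulr0.
(* A multiple of the null vector [c] makes [d] null without changing its pairing with [c]. *)
pose e := d - (pform q d d / (2 * pform q d c)) *: c.
have ee : pform q e e = 0.
  by rewrite /e !pformX cc (pformC _ c d); field.
have ew i : pform q e (w i) = 0 by rewrite /e !pformX dw cw mulr0 subrr.
have ec : pform q e c = pform q d c by rewrite /e !pformX cc mulr0 subr0.
have ec2 : pform q c c' = 0 -> pform q e c' = pform q d c'.
  by move=> cc'0; rewrite /e !pformX cc'0 mulr0 subr0.
(* If [<c, c'>] is nonzero, [c - c'] is not null and a single reflection is enough; the detour
   through [e] is for the other case. *)
clearbody e; have [ec'|ec'] := eqVneq (pform q c c') 0; last first.
  exists (reflection q (c - c')); split.
  - by apply: reflection_pisom; rewrite !pformX cc c'c' (pformC _ c' c);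
      apply: contra_neq ec' => h; lra.
  - by apply: reflection_sub; rewrite ?cc // !pformX cc c'c' (pformC _ c' c);
      apply: contra_neq ec' => h; lra.
  - by move=> i; apply: reflection_fix; rewrite pformC !pformX cw c'w subrr.
have {}ec2 := ec2 ec'.
have ce0 : pform q (c - e) (c - e) != 0.
  by rewrite !pformX cc ee (pformC _ c e) ec; apply: contra_neq dc => h; lra.
have ec0 : pform q (e - c') (e - c') != 0.
  by rewrite !pformX c'c' ee (pformC _ c' e) ec2; apply: contra_neq dc' => h; lra.
exists (reflection q (c - e) *m reflection q (e - c')); split.
- by apply: pisomM; exact: reflection_pisom.
- by rewrite mulmxA !reflection_sub // ?cc ?ee.
- by move=> i; rewrite mulmxA !reflection_fix // pformC !pformX ?ew ?cw ?c'w subrr.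
Qed.


Lemma pform_delta2 q N (i j : 'I_N) :
  pform q (delta_mx 0 i) (delta_mx 0 j : 'rV[R]_N) = psign q j * (i == j)%:R.
Proof. by rewrite pform_delta mxE eqxx eq_sym. Qed.

Lemma mx_delta_eq N N' (A B : 'M[R]_(N, N')) :
  (forall i, delta_mx 0 i *m A = delta_mx 0 i *m B :> 'rV_N') -> A = B.
Proof. by move=> h; apply/row_matrixP => i; rewrite !rowE h. Qed.

(** The images of the standard basis are orthogonal frames of non-null vectors, matched by
    [witt_orthogonal]. Then [c *m T] and [c'] are null vectors orthogonal to the same frame, and
    [witt_null] moves one to the other while fixing that frame. *)
Lemma witt_pisom q q' N N' (B B' : 'M[R]_(N, N')) (c c' : 'rV[R]_N') :
  pisom q q' B -> pisom q q' B' ->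
  (forall u, pform q' c (u *m B) = 0) -> (forall u, pform q' c' (u *m B') = 0) ->
  pform q' c c = 0 -> pform q' c' c' = 0 -> (c == 0) = (c' == 0) ->
  exists T, [/\ pisom q' q' T, B *m T = B' & c *m T = c'].
Proof.
move=> hB hB' cB c'B' cc c'c' c0.
pose v (i : 'I_N) : 'rV_N' := delta_mx 0 i *m B.
pose w (i : 'I_N) : 'rV_N' := delta_mx 0 i *m B'.
have wo i j : i != j -> pform q' (w i) (w j) = 0.
  by move=> ij; rewrite hB' pform_delta2 (negbTE ij) mulr0.
have wn i : pform q' (w i) (w i) != 0.
  by rewrite hB' pform_delta2 eqxx mulr1 psign_neq0.
have [||||T hT vT] := @witt_orthogonal _ q' _ (enum 'I_N) v w.
- exact: enum_uniq.
- by move=> i j _ _; rewrite hB hB'.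
- by move=> i j _ _; exact: wo.
- by move=> i _; exact: wn.
have BT : B *m T = B'.
  by apply: mx_delta_eq => i; rewrite mulmxA vT // mem_enum.
have [c'0|c'0] := eqVneq c' 0.
  exists T; split => //; move: c0; rewrite c'0 eqxx => /eqP ->.
  by rewrite mul0mx.
have [||||||U [hU cU wU]] := @witt_null _ q' _ w (c *m T) c' wo wn.
- by move=> i; rewrite /w -BT mulmxA hT cB.
- by move=> i; exact: c'B'.
- by rewrite hT.
- by [].
- apply: contraFN (_ : (c == 0) = false) => [/eqP cT|].
    by apply/eqP; exact: pisom_inj hT cT.
  by rewrite c0 (negbTE c'0).
- by [].
exists (T *m U); split; [exact: pisomM hT hU| |by rewrite mulmxA].
by apply: mx_delta_eq => i; rewrite (mulmxA B) BT mulmxA wU.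
Qed.

(** * The standard isometric inclusion and its orthogonal complement *)

Section StandardInclusion.
Variables (N N' q q' : nat).
Hypotheses (qq' : (q <= q')%N) (qN : (q <= N)%N) (NN' : (N + q' <= N' + q)%N).

(** Signs are kept by skipping the negative coordinates from [q] to [q' - 1]. The complement of the
    image is spanned by these and by the positive coordinates from [N + (q' - q)] on. *)
Definition incl_idx (i : nat) : nat := if (i < q)%N then i else (i + (q' - q))%N.

Fact incl_idx_lt (i : 'I_N) : (incl_idx i < N')%N.
Proof. by rewrite /incl_idx; have := ltn_ord i; case: ifP => ? ?; lia. Qed.

Definition incl_ord (i : 'I_N) : 'I_N' := Ordinal (incl_idx_lt i).

Definition std_incl : 'M[R]_(N, N') := \matrix_(i, j) (incl_ord i == j)%:R.

Lemma delta_std_incl i :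
  delta_mx 0 i *m std_incl = delta_mx 0 (incl_ord i) :> 'rV[R]_N'.
Proof. by rewrite -rowE; apply/rowP => j; rewrite !mxE eqxx eq_sym. Qed.

Lemma incl_ord_inj : injective incl_ord.
Proof.
move=> i j /(congr1 val) /=; rewrite /incl_idx => ij; apply: val_inj => /=.
by move: ij; case: ifP; case: ifP; lia.
Qed.

Lemma psign_incl (i : 'I_N) : psign q' (incl_ord i) = psign q i :> R.
Proof. by rewrite /psign /= /incl_idx; do 2?case: ifP => //; lia. Qed.

Lemma std_incl_pisom : pisom q q' std_incl.
Proof.
move=> u v; rewrite {1}(row_sum_delta u) {1}(row_sum_delta v) !mulmx_suml.
rewrite pform_suml pformE; apply: eq_bigr => i _.
rewrite pform_sumr (bigD1 i) //= big1 => [|j ji].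
  rewrite addr0 -!scalemxAl !delta_std_incl !pformX pform_delta2 eqxx psign_incl mulr1.
  ring.
rewrite -!scalemxAl !delta_std_incl !pformX pform_delta2.
by rewrite (inj_eq incl_ord_inj) eq_sym (negbTE ji) !mulr0.
Qed.

Lemma std_incl_orthP (c : 'rV[R]_N') :
  (forall u, pform q' c (u *m std_incl) = 0) <-> forall i, c 0 (incl_ord i) = 0.
Proof.
split=> h.
  move=> i; have := h (delta_mx 0 i); rewrite delta_std_incl pform_delta.
  by move/eqP; rewrite mulf_eq0 (negbTE (psign_neq0 _ _)) => /eqP.
move=> u; rewrite (row_sum_delta u) mulmx_suml pform_sumr big1 // => i _.
by rewrite -scalemxAl delta_std_incl pformX pform_delta h !mulr0.
Qed.

Lemma std_incl_null : (q < q')%N -> (N + q' < N' + q)%N ->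
  exists c : 'rV[R]_N', [/\ forall u, pform q' c (u *m std_incl) = 0,
    pform q' c c = 0 & c != 0].
Proof.
move=> ltq ltN.
have jP : (q < N')%N by lia.
have kP : (N'.-1 < N')%N by lia.
(* [j] is a skipped negative coordinate and [k] the last, positive one; both lie outside the image,
   and opposite signs make their sum null. *)
pose j := Ordinal jP; pose k := Ordinal kP.
have jk : j != k by rewrite -val_eqE /=; lia.
exists (delta_mx 0 j + delta_mx 0 k); split.
- apply/std_incl_orthP => i; rewrite !mxE eqxx /= -!val_eqE /= /incl_idx.
  have ij : ((if (i < q)%N then i : nat else (i + (q' - q))%N) == q) = false.
    by apply/negbTE; have := ltn_ord i; case: ifP; lia.
  have ik : ((if (i < q)%N then i : nat else (i + (q' - q))%N) == N'.-1) = false.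
    by apply/negbTE; have := ltn_ord i; case: ifP; lia.
  by rewrite ij ik addr0.
- rewrite !pformX !pform_delta2 (negbTE jk) eq_sym (negbTE jk) !eqxx.
  rewrite /psign /= ltq ifF; first by ring.
  by apply/negbTE; rewrite -leqNgt; lia.
- apply/eqP => /rowP /(_ j) /eqP; rewrite !mxE !eqxx (negbTE jk) addr0.
  by rewrite oner_eq0.
Qed.

(** In both cases all coordinates outside the image have the same sign [sg], so on the complement
    the form is [sg] times a sum of squares. *)
Lemma std_incl_definite (c : 'rV[R]_N') : q' = q \/ (N + q' = N' + q)%N ->
  (forall u, pform q' c (u *m std_incl) = 0) -> pform q' c c = 0 -> c = 0.
Proof.
move=> def /std_incl_orthP ci cc.
have c0 (j : 'I_N') i : (i < N)%N -> incl_idx i = j -> c 0 j = 0.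
  by move=> iN ij; rewrite -(ci (Ordinal iN)); congr (c 0 _); exact: val_inj.
have [sg [sg2 sgE]] : exists sg : R, sg * sg = 1 /\
    forall j : 'I_N', psign q' j * (c 0 j * c 0 j) = sg * c 0 j ^+ 2.
  case: def => def; [exists 1 | exists (-1)]; split; try ring.
    move=> j; rewrite /psign; case: ifP => [jq|_]; last by rewrite expr2.
    by rewrite (c0 j j) ?expr2 ?mulr0 ?/incl_idx -?def ?jq //; lia.
  move=> j; rewrite /psign; case: ifP => [jq|jq]; first by rewrite expr2.
  rewrite (c0 j (j - (q' - q))%N) ?expr2 ?mulr0 //.
    by have := ltn_ord j; lia.
  by rewrite /incl_idx ifF; lia.
have sq0 : \sum_j c 0 j ^+ 2 = 0.
  move: cc; rewrite pformE; under eq_bigr do rewrite sgE.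
  rewrite -mulr_sumr => h.
  by rewrite -[LHS]mul1r -sg2 -mulrA h mulr0.
apply/rowP => j; rewrite mxE; apply/eqP; rewrite -sqrf_eq0.
have /psumr_eq0P -> // := sq0.
by move=> i _; exact: sqr_ge0.
Qed.

End StandardInclusion.

End PseudoEuclideanForm.

(** * Symmetry of second derivatives *)

Section LineDerivatives.
Context {R : realType} {V : normedModType R}.
Implicit Types (f : V -> R) (v w x y : V).

Lemma line_quotient f v y (t : R) :
  (fun h : R => h^-1 *: (f ((h *: (1 : R) + t) *: v + y) - f (t *: v + y))) =
  (fun h : R => h^-1 *: (f (h *: v + (t *: v + y)) - f (t *: v + y))).
Proof.
by apply/funext => h; rewrite [h *: 1]mulr1 scalerDl addrA.
Qed.

Lemma is_derive_line f v y (t : R) : derivable f (t *: v + y) v ->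
  is_derive t (1 : R) (fun t : R => f (t *: v + y)) ('D_v f (t *: v + y)).
Proof.
move=> df; split; first by rewrite /derivable line_quotient.
by rewrite /derive line_quotient.
Qed.

Lemma line_MVT f v y (s : R) : 0 < s ->
  (forall t, 0 <= t <= s -> differentiable f (t *: v + y)) ->
  exists2 c, 0 < c < s & f (s *: v + y) - f y = s * 'D_v f (c *: v + y).
Proof.
move=> s0 df.
have dfl t : 0 <= t <= s ->
    is_derive t (1 : R) (fun t : R => f (t *: v + y)) ('D_v f (t *: v + y)).
  by move=> /df dft; apply: is_derive_line; exact: diff_derivable.
have [|| c] := @MVT R (fun t => f (t *: v + y))
  (fun t => 'D_v f (t *: v + y)) 0 s s0.
- by move=> t; rewrite in_itv /= => /andP[t0 ts]; apply: dfl; rewrite !ltW.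
- apply: derivable_within_continuous => t; rewrite in_itv /= => tI.
  by have [] := dfl t tI.
rewrite in_itv /= => cI; rewrite scale0r add0r subr0 => fE.
by exists c => //; rewrite fE mulrC.
Qed.

Lemma derive0_segment f x y :
  (forall t : R, 0 <= t <= 1 -> differentiable f (t *: (y - x) + x)) ->
  (forall t : R, 0 <= t <= 1 -> 'D_(y - x) f (t *: (y - x) + x) = 0) ->
  f y = f x.
Proof.
move=> df df0; have [c /andP[c0 c1]] := line_MVT (ltr01 : 0 < 1 :> R) df.
rewrite scale1r subrK df0 ?ltW // mulr0 => /eqP.
by rewrite subr_eq0 => /eqP.
Qed.

Let box f v w x (s : R) :=
  f (s *: v + (s *: w + x)) - f (s *: v + x) - (f (s *: w + x) - f x).

(** The mean value theorem along [v], applied to [f (y + s *: w) - f y], turns the second difference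
    into [s] times a difference of two values of ['D_v f] at distance of order [s] from [x].
    Differentiability of ['D_v f] at [x] alone evaluates that difference. *)
Let box_estimate f v w x (e : R) : 0 < e ->
  (\forall y \near x, differentiable f y) -> differentiable ('D_v f) x ->
  \forall s \near 0^'+, `|box f v w x s - s ^+ 2 * 'D_w ('D_v f) x| <=
    e * (s ^+ 2 * (2 * `|v| + `|w|)).
Proof.
move=> e0 df ddf.
have [_ /eqaddoP /(_ e e0) rem] := (diff_locallyP _ _).1 ddf.
have near_box (P : V -> Prop) : (\forall y \near x, P y) -> \forall s \near 0^'+,
    forall a b : R, 0 <= a <= s -> 0 <= b <= s -> P (a *: v + (b *: w + x)).
  move=> /nbhs_ballP[r /= r0 rP].
  have C0 : 0 < `|v| + `|w| + 1 by rewrite ltr_wpDl // addr_ge0.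
  near=> s => a b /andP[a0 as_] /andP[b0 bs].
  apply: rP; rewrite -ball_normE /= distrC addrA addrK.
  rewrite (le_lt_trans (ler_normD _ _)) // !normrZ !ger0_norm //.
  have : s * (`|v| + `|w| + 1) < r.
    rewrite -ltr_pdivlMr //; near: s; apply: nbhs_right_lt.
    by rewrite divr_gt0.
  apply: le_lt_trans; rewrite -addrA mulrDr lerD ?ler_wpM2r //.
  have sb : s * `|w| <= s * (`|w| + 1).
    by rewrite ler_wpM2l ?lerDl // (le_trans b0).
  by apply: le_trans sb; rewrite ler_wpM2r.
have rem' : \forall y \near x,
    `|'D_v f y - 'D_v f x - 'd ('D_v f) x (y - x)| <= e * `|y - x|.
  rewrite (near_shift 0 x) /=; apply: filterS rem => h.
  by rewrite /= subr0 addrK !fctE /= opprD addrA.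
near=> s.
have s0 : 0 < s by near: s; exact: nbhs_right_gt.
have dfs : forall a b : R, 0 <= a <= s -> 0 <= b <= s ->
    differentiable f (a *: v + (b *: w + x)).
  by near: s; exact: (near_box (fun y => differentiable f y)).
have rems : forall a b : R, 0 <= a <= s -> 0 <= b <= s ->
    `|'D_v f (a *: v + (b *: w + x)) - 'D_v f x
      - 'd ('D_v f) x (a *: v + (b *: w + x) - x)| <=
      e * `|a *: v + (b *: w + x) - x|.
  by near: s; apply: (near_box (fun y =>
    `|'D_v f y - 'D_v f x - 'd ('D_v f) x (y - x)| <= e * `|y - x|)).
pose g y : R := f (y + s *: w) - f y.
have ss : 0 <= s <= s by rewrite ltW /=.
have s00 : 0 <= (0 : R) <= s by rewrite lexx ltW.
have dg1 a : 0 <= a <= s -> differentiable f (a *: v + x).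
  by move=> h; have := dfs a 0 h s00; rewrite scale0r add0r.
have dg2 a : 0 <= a <= s -> differentiable (fun y => f (y + s *: w)) (a *: v + x).
  move=> h; apply: (@differentiable_comp _ _ _ _ (fun y => y + s *: w)).
    by apply: differentiableD.
  by rewrite -addrA [x + _]addrC; exact: dfs.
have Dsh y : 'D_v (fun y => f (y + s *: w)) y = 'D_v f (y + s *: w).
  by rewrite /derive /=; under eq_fun do rewrite -addrA.
have [|c /andP[c0 cs]] := @line_MVT g v x s s0.
  by move=> a h; apply: differentiableB; [exact: dg2 | exact: dg1].
have cI : 0 <= c <= s by rewrite !ltW.
rewrite /g deriveB; last 2 first.
- by apply: diff_derivable; exact: dg2.
- by apply: diff_derivable; exact: dg1.
rewrite Dsh => gE.
have -> : box f v w x s = f (s *: v + x + s *: w) - f (s *: v + x) -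
    (f (x + s *: w) - f x).
  by rewrite /box -[s *: v + x + _]addrA [x + _]addrC.
rewrite gE.
have r1 := rems c s cI ss.
have := rems c 0 cI s00; rewrite scale0r add0r => r2.
have -> : c *: v + x + s *: w = c *: v + (s *: w + x).
  by rewrite -addrA [x + _]addrC.
have linE : 'd ('D_v f) x (c *: v + (s *: w + x) - x) -
    'd ('D_v f) x (c *: v + x - x) = s * 'D_w ('D_v f) x.
  rewrite deriveE // -linearB -[s * _]/(s *: _) -linearZ; congr ('d _ _ _).
  by rewrite addrA !addrK addrAC subrr add0r.
have n1 : `|c *: v + (s *: w + x) - x| <= s * `|v| + s * `|w|.
  rewrite addrA addrK (le_trans (ler_normD _ _)) // !normrZ !gtr0_norm //.
  by rewrite lerD2r ler_wpM2r // ltW.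
have n2 : `|c *: v + x - x| <= s * `|v|.
  by rewrite addrK normrZ gtr0_norm // ler_wpM2r // ltW.
(* Both values of ['D_v f] are compared with their first-order expansions at [x], whose linear parts
   differ by [s * 'D_w ('D_v f) x]. *)
have -> : s * ('D_v f (c *: v + (s *: w + x)) - 'D_v f (c *: v + x)) -
    s ^+ 2 * 'D_w ('D_v f) x = s * ((('D_v f (c *: v + (s *: w + x))) - 'D_v f x
      - 'd ('D_v f) x (c *: v + (s *: w + x) - x)) -
      ('D_v f (c *: v + x) - 'D_v f x - 'd ('D_v f) x (c *: v + x - x))).
  by rewrite expr2 -mulrA -linE; ring.
rewrite normrM gtr0_norm //.
have -> : e * (s ^+ 2 * (2 * `|v| + `|w|)) =
    s * (e * (s * `|v| + s * `|w|) + e * (s * `|v|)) by ring.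
rewrite ler_pM2l // (le_trans (ler_normB _ _)) // lerD //.
- by rewrite (le_trans r1) // ler_wpM2l // ltW.
- by rewrite (le_trans r2) // ler_wpM2l // ltW.
Unshelve. all: by end_near. Qed.

(* Compare the second difference quotient of f along v and w, which is
   symmetric, with both mixed derivatives. *)
Theorem derive_comm f v w x : (\forall y \near x, differentiable f y) ->
  differentiable ('D_v f) x -> differentiable ('D_w f) x ->
  'D_w ('D_v f) x = 'D_v ('D_w f) x.
Proof.
move=> df dv dw.
(* The two error constants of [box_estimate], plus 1 to keep [C] positive when [v] and [w]
   vanish. *)
pose C := (2 * `|v| + `|w|) + (2 * `|w| + `|v|) + 1.
have C0 : 0 < C by rewrite ltr_wpDl // !addr_ge0 // mulr_ge0.
apply/eqP; rewrite -subr_eq0 -normr_le0; apply/ler_addgt0Pl => e e0.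
rewrite addr0; have eC : 0 < e / C by rewrite divr_gt0.
near (0 : R)^'+ => s.
have s0 : 0 < s by near: s; exact: nbhs_right_gt.
have h1 : `|box f v w x s - s ^+ 2 * 'D_w ('D_v f) x| <=
    e / C * (s ^+ 2 * (2 * `|v| + `|w|)) by near: s; exact: box_estimate.
have h2 : `|box f w v x s - s ^+ 2 * 'D_v ('D_w f) x| <=
    e / C * (s ^+ 2 * (2 * `|w| + `|v|)) by near: s; exact: box_estimate.
have boxC : box f v w x s = box f w v x s.
  rewrite /box [s *: v + _]addrCA; ring.
have s20 : 0 < s ^+ 2 by rewrite exprn_gt0.
rewrite -(ler_pM2l s20) -[X in X * `|_|](gtr0_norm s20) -normrM.
have sub3 (a b c t : R) : t * (b - c) = (a - t * c) - (a - t * b) by ring.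
rewrite (sub3 (box f w v x s)) -{2}boxC.
rewrite (le_trans (ler_normB _ _)) // (le_trans (lerD h2 h1)) //.
have -> : e / C * (s ^+ 2 * (2 * `|w| + `|v|)) +
    e / C * (s ^+ 2 * (2 * `|v| + `|w|)) = s ^+ 2 * (e * ((C - 1) / C)).
  by rewrite /C; ring.
rewrite ler_pM2l //; apply: ler_piMr; first exact: ltW.
by rewrite ler_pdivrMr // mul1r lerBlDr lerDl.
Unshelve. all: by end_near. Qed.

End LineDerivatives.

(** * Smooth functions on an open set *)

Section SmoothFunctions.
Context {R : realType} {m : nat}.
Variable V : set 'rV[R]_m.
Hypothesis oV : open V.

Lemma near_open x : V x -> \forall y \near x, V y.
Proof. by move=> Vx; exact: open_nbhs_nbhs. Qed.

Lemma near_ext (W : Type) (f g : 'rV[R]_m -> W) x :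
  {in V, f =1 g} -> V x -> \forall y \near x, f y = g y.
Proof.
move=> fg /near_open; apply: filterS => y Vy.
by apply: fg; rewrite inE.
Qed.

(** Differentiability depends only on the germ of the map: this is the case of the zero germ, from
    which additivity gives [differentiable_ext]. *)
Lemma differentiable_near0 (W : normedModType R) (h : 'rV[R]_m -> W) x :
  (\forall y \near x, h y = 0) -> differentiable h x.
Proof.
move=> h0; apply/diffP => /=.
(* The differential is obtained by choice, so its specification holds once some candidate is
   exhibited, here the zero map. *)
apply: (@getPex _ (fun (df : {linear 'rV[R]_m -> W}) => continuous df /\
  forall y, h y = h (lim (nbhs x)) + df (y - lim (nbhs x))
                  +o_(y \near x) (y - lim (nbhs x)))).
exists (\0 : {linear 'rV[R]_m -> W}); split; first exact: cst_continuous.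
have E : h = (fun=> h (lim (nbhs x)) + 0)
    +o_ (nbhs x) (fun y => y - lim (nbhs x)).
  have hx := nbhs_singleton h0.
  apply/eqaddoP => e e0; apply: filterS h0 => z hz /=.
  rewrite !fctE lim_id // hz hx addr0 subr0 normr0.
  by rewrite mulr_ge0 // ltW.
by move=> y; exact: (congr1 (fun g => g y) E).
Qed.

Lemma differentiable_ext (W : normedModType R) (f g : 'rV[R]_m -> W) x :
  (\forall y \near x, f y = g y) -> differentiable f x -> differentiable g x.
Proof.
move=> fg df; have -> : g = f + (g - f) by rewrite addrC subrK.
apply: differentiableD => //; apply: differentiable_near0.
by apply: filterS fg => y; rewrite !fctE => ->; rewrite subrr.
Qed.

(** A filtration of smoothness by order, which lets the product and quotient rules be proved by
    induction. Level 0 already asks for differentiability. *)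
Fixpoint ck (W : normedModType R) (k : nat) (f : 'rV[R]_m -> W) : Prop :=
  (forall x, V x -> differentiable f x) /\
  if k is k'.+1 then forall v, ck k' ('D_v f) else True.

Lemma ck_diff (W : normedModType R) k (f : 'rV[R]_m -> W) x :
  ck k f -> V x -> differentiable f x.
Proof. by case: k => [|k] [h _]; exact: h. Qed.

Lemma ck_ext (W : normedModType R) k (f g : 'rV[R]_m -> W) :
  {in V, f =1 g} -> ck k f -> ck k g.
Proof.
elim: k f g => [|k IH] f g fg [df Df]; split.
- move=> x Vx; exact: differentiable_ext (near_ext fg Vx) (df x Vx).
- by [].
- move=> x Vx; exact: differentiable_ext (near_ext fg Vx) (df x Vx).
- move=> v; apply: IH (Df v) => x; rewrite inE => Vx.
  by apply: near_eq_derive; exact: near_ext Vx.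
Qed.

Lemma ckW (W : normedModType R) k (f : 'rV[R]_m -> W) : ck k.+1 f -> ck k f.
Proof.
elim: k f => [|k IH] f [df Df]; split => // v.
by apply: IH; exact: Df.
Qed.

Lemma ck_cst (W : normedModType R) k (c : W) : ck k (fun=> c).
Proof.
elim: k c => [|k IH] c; split => // v.
by apply: ck_ext (IH 0) => x _; rewrite derive_cst.
Qed.

Lemma ckD (W : normedModType R) k (f g : 'rV[R]_m -> W) :
  ck k f -> ck k g -> ck k (fun x => f x + g x).
Proof.
elim: k f g => [|k IH] f g [df Df] [dg Dg]; split => //.
- by move=> x Vx; apply: differentiableD; [exact: df|exact: dg].
- by move=> x Vx; apply: differentiableD; [exact: df|exact: dg].
- move=> v; apply: ck_ext (IH _ _ (Df v) (Dg v)) => x; rewrite inE => Vx.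
  by rewrite deriveD //; apply: diff_derivable; [exact: df|exact: dg].
Qed.

Lemma ck_sum (W : normedModType R) k I (s : seq I) (P : pred I)
    (F : I -> 'rV[R]_m -> W) :
  (forall i, ck k (F i)) -> ck k (fun x => \sum_(i <- s | P i) F i x).
Proof.
move=> FC; elim: s => [|i s IH].
  by under eq_fun do rewrite big_nil; exact: ck_cst.
under eq_fun do rewrite big_cons; case: (P i) => //.
exact: ckD.
Qed.

Lemma ckM k (f g : 'rV[R]_m -> R) : ck k f -> ck k g -> ck k (fun x => f x * g x).
Proof.
elim: k f g => [|k IH] f g fC gC; have [df Df] := fC; have [dg Dg] := gC; split => //.
- by move=> x Vx; apply: differentiableM; [exact: df|exact: dg].
- by move=> x Vx; apply: differentiableM; [exact: df|exact: dg].
- move=> v; have := ckD (IH _ _ (ckW fC) (Dg v)) (IH _ _ (ckW gC) (Df v)).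
  apply: ck_ext => x; rewrite inE => Vx.
  by rewrite deriveM //; apply: diff_derivable; [exact: df|exact: dg].
Qed.

Lemma ckV k (f : 'rV[R]_m -> R) : (forall x, V x -> f x != 0) ->
  ck k f -> ck k (fun x => (f x)^-1).
Proof.
move=> f0; elim: k => [|k IH] fC; have [df Df] := fC; split => //.
- by move=> x Vx; apply: differentiableV; [exact: df|exact: f0].
- by move=> x Vx; apply: differentiableV; [exact: df|exact: f0].
move=> v; have IC := IH (ckW fC).
have C1 : ck k (fun=> -1 : R) by exact: ck_cst.
have := ckM (ckM C1 (ckM IC IC)) (Df v); apply: ck_ext => x; rewrite inE => Vx.
rewrite deriveV; [|exact: f0|by apply: diff_derivable; exact: df].
by rewrite mulN1r -invfM -expr2.
Qed.

Lemma ck_coord N k (f : 'rV[R]_m -> 'rV[R]_N) :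
  ck k f <-> forall j, ck k (fun x => f x 0 j).
Proof.
have coord (g : 'rV[R]_m -> 'rV[R]_N) x j :
    differentiable g x -> differentiable (fun x => g x 0 j) x.
  move=> dg; apply: (@differentiable_comp _ _ _ _ g (fun M : 'rV[R]_N => M 0 j)) => //.
  exact: differentiable_coord.
have coordV (g : 'rV[R]_m -> 'rV[R]_N) x :
    (forall j, differentiable (fun x => g x 0 j) x) -> differentiable g x.
  move=> dg; have -> : g = \sum_j (fun x => g x 0 j *: delta_mx 0 j).
    apply/funext => y; rewrite fct_sumE; exact: row_sum_delta.
  by apply: differentiable_sum => j; apply: differentiableZl.
have DE (g : 'rV[R]_m -> 'rV[R]_N) x v j : differentiable g x ->
    'D_v g x 0 j = 'D_v (fun x => g x 0 j) x.
  by move=> dg; rewrite derive_mx ?mxE //; exact: diff_derivable.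
split=> [|fC].
  elim: k f => [|k IH] f [df Df] j; split => //.
  - by move=> x Vx; apply: coord; exact: df.
  - by move=> x Vx; apply: coord; exact: df.
  move=> v; apply: ck_ext (IH _ (Df v) j) => x; rewrite inE => Vx.
  by apply: DE; exact: df.
have df x : V x -> differentiable f x.
  by move=> Vx; apply: coordV => j; exact: ck_diff (fC j) Vx.
elim: k f fC df => [|k IH] f fC df; split => // v.
have CC j : ck k (fun x => 'D_v f x 0 j).
  have [_ /(_ v)] := fC j; apply: ck_ext => x; rewrite inE => Vx.
  by rewrite DE //; exact: df.
by apply: IH => // x Vx; apply: coordV => j; exact: ck_diff (CC j) Vx.
Qed.

Lemma derive_coord N (f : 'rV[R]_m -> 'rV[R]_N) x v j : differentiable f x ->
  'D_v f x 0 j = 'D_v (fun x => f x 0 j) x.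
Proof. by move=> dg; rewrite derive_mx ?mxE //; exact: diff_derivable. Qed.

Definition smooth (W : normedModType R) (f : 'rV[R]_m -> W) := forall k, ck k f.

(** [iter_derive] differentiates first along the last direction of its list, and [ck] also peels off
    the innermost derivative; hence the inductions at the right end of the list. *)
Lemma smooth_onP N (f : 'rV[R]_m -> 'rV[R]_N) : smooth_on V f <-> smooth f.
Proof.
split=> [h k|h a x Vx].
  elim: k f h => [|k IH] f h; split => //.
  - by move=> x; exact: (h [::]).
  - by move=> x; exact: (h [::]).
  - by move=> v; apply: IH => a; have := h (rcons a v); rewrite /iter_derive foldr_rcons.
elim/last_ind: a f h => [|a v IH] f h; first exact: ck_diff (h 0%N) Vx.
rewrite /iter_derive foldr_rcons; apply: IH => k.
by have [_] := h k.+1; apply.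
Qed.

Lemma smooth_diff (W : normedModType R) (f : 'rV[R]_m -> W) x :
  smooth f -> V x -> differentiable f x.
Proof. by move=> /(_ 0%N); exact: ck_diff. Qed.

Lemma smooth_derivable (W : normedModType R) (f : 'rV[R]_m -> W) x v :
  smooth f -> V x -> derivable f x v.
Proof. by move=> fC Vx; apply: diff_derivable; exact: smooth_diff. Qed.

Lemma smooth_derive (W : normedModType R) (f : 'rV[R]_m -> W) v :
  smooth f -> smooth ('D_v f).
Proof. by move=> fC k; have [_] := fC k.+1; apply. Qed.

Lemma smooth_ext (W : normedModType R) (f g : 'rV[R]_m -> W) :
  {in V, f =1 g} -> smooth f -> smooth g.
Proof. by move=> fg fC k; exact: ck_ext (fC k). Qed.

Lemma smooth_coord N (f : 'rV[R]_m -> 'rV[R]_N) :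
  smooth f <-> forall j, smooth (fun x => f x 0 j).
Proof.
split=> h; first by move=> j k; exact: (ck_coord k f).1 (h k) j.
by move=> k; apply/(ck_coord k f) => j; exact: h.
Qed.

Lemma smooth_cst (W : normedModType R) (c : W) : smooth (fun=> c).
Proof. by move=> k; exact: ck_cst. Qed.

Lemma smoothD (W : normedModType R) (f g : 'rV[R]_m -> W) :
  smooth f -> smooth g -> smooth (fun x => f x + g x).
Proof. by move=> fC gC k; exact: ckD. Qed.

Lemma smooth_sum (W : normedModType R) I (s : seq I) (P : pred I)
    (F : I -> 'rV[R]_m -> W) :
  (forall i, smooth (F i)) -> smooth (fun x => \sum_(i <- s | P i) F i x).
Proof. by move=> FC k; apply: ck_sum => i; exact: FC. Qed.

Lemma smoothM (f g : 'rV[R]_m -> R) :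
  smooth f -> smooth g -> smooth (fun x => f x * g x).
Proof. by move=> fC gC k; exact: ckM. Qed.

Lemma smoothV (f : 'rV[R]_m -> R) : (forall x, V x -> f x != 0) ->
  smooth f -> smooth (fun x => (f x)^-1).
Proof. by move=> f0 fC k; exact: ckV. Qed.

Lemma smooth_id : smooth (id : 'rV[R]_m -> 'rV[R]_m).
Proof.
case=> [|k]; split => // v; apply: ck_ext (ck_cst _ v) => x _.
by rewrite derive_id.
Qed.

Lemma smooth_pform q N (f g : 'rV[R]_m -> 'rV[R]_N) :
  smooth f -> smooth g -> smooth (fun x => pform q (f x) (g x)).
Proof.
move=> /smooth_coord fC /smooth_coord gC; under eq_fun do rewrite pformE.
apply: smooth_sum => i; apply: smoothM; first exact: smooth_cst.
exact: smoothM.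
Qed.

Lemma smooth_mulmx N N' (f : 'rV[R]_m -> 'rV[R]_N) (B : 'M[R]_(N, N')) :
  smooth f -> smooth (fun x => f x *m B).
Proof.
move=> /smooth_coord fC; apply/smooth_coord => j; under eq_fun do rewrite mxE.
by apply: smooth_sum => i; apply: smoothM => //; exact: smooth_cst.
Qed.

Lemma smooth_scale N (h : 'rV[R]_m -> R) (f : 'rV[R]_m -> 'rV[R]_N) :
  smooth h -> smooth f -> smooth (fun x => h x *: f x).
Proof.
move=> hC /smooth_coord fC; apply/smooth_coord => j; under eq_fun do rewrite mxE.
exact: smoothM.
Qed.

Lemma derive_pform q N (f g : 'rV[R]_m -> 'rV[R]_N) x v :
  smooth f -> smooth g -> V x ->
  'D_v (fun x => pform q (f x) (g x)) x =
  pform q ('D_v f x) (g x) + pform q (f x) ('D_v g x).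
Proof.
move=> fC gC Vx.
have fD i := smooth_derivable (v := v) ((smooth_coord f).1 fC i) Vx.
have gD i := smooth_derivable (v := v) ((smooth_coord g).1 gC i) Vx.
have -> : (fun x => pform q (f x) (g x)) =
    \sum_(i < N) (fun x => psign q i * (f x 0 i * g x 0 i)).
  by apply/funext => y; rewrite pformE fct_sumE.
rewrite derive_sum => [|i]; last first.
  by apply: derivableM; [exact: derivable_cst|exact: derivableM].
rewrite !pformE -big_split; apply: eq_bigr => i _ /=.
rewrite deriveM; [|exact: derivable_cst|exact: derivableM].
rewrite derive_cst scaler0 addr0 deriveM // !derive_coord; last 2 first.
- exact: smooth_diff gC Vx.
- exact: smooth_diff fC Vx.
by rewrite -![_ *: _]/(_ * _); ring.
Qed.

Lemma derive_mulmx N N' (f : 'rV[R]_m -> 'rV[R]_N) (B : 'M[R]_(N, N')) x v :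
  smooth f -> V x -> 'D_v (fun x => f x *m B) x = 'D_v f x *m B.
Proof.
move=> fC Vx; have fD i := smooth_derivable (v := v) ((smooth_coord f).1 fC i) Vx.
apply/rowP => j; rewrite derive_coord; last exact: smooth_diff (smooth_mulmx B fC) Vx.
have -> : (fun x => (f x *m B) 0 j) = \sum_(i < N) (fun x => f x 0 i * B i j).
  by apply/funext => y; rewrite mxE fct_sumE.
rewrite derive_sum => [|i]; last first.
  by apply: derivableM; [exact: fD|exact: derivable_cst].
rewrite mxE; apply: eq_bigr => i _.
rewrite deriveM; [|exact: fD|exact: derivable_cst].
rewrite derive_cst scaler0 add0r derive_coord; last exact: smooth_diff fC Vx.
exact: mulrC.
Qed.

Lemma derive_scale N (h : 'rV[R]_m -> R) (f : 'rV[R]_m -> 'rV[R]_N) x v :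
  smooth h -> smooth f -> V x ->
  'D_v (fun x => h x *: f x) x = h x *: 'D_v f x + 'D_v h x *: f x.
Proof.
move=> hC fC Vx; have fD i := smooth_derivable (v := v) ((smooth_coord f).1 fC i) Vx.
apply/rowP => j; rewrite derive_coord; last exact: smooth_diff (smooth_scale hC fC) Vx.
rewrite (_ : (fun x => _) = (fun x => h x * f x 0 j)); last first.
  by apply/funext => y; rewrite mxE.
rewrite deriveM //; last exact: smooth_derivable.
rewrite !mxE derive_coord; last exact: smooth_diff fC Vx.
by rewrite -![_ *: _]/(_ * _) (mulrC (f x 0 j)).
Qed.

Lemma derive_add (W : normedModType R) (f g : 'rV[R]_m -> W) x v :
  smooth f -> smooth g -> V x ->
  'D_v (fun x => f x + g x) x = 'D_v f x + 'D_v g x.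
Proof. by move=> fC gC Vx; rewrite deriveD //; exact: smooth_derivable. Qed.

Lemma derive_mul (f g : 'rV[R]_m -> R) x v :
  smooth f -> smooth g -> V x ->
  'D_v (fun x => f x * g x) x = f x * 'D_v g x + g x * 'D_v f x.
Proof. by move=> fC gC Vx; rewrite deriveM //; exact: smooth_derivable. Qed.

Lemma derive_cmul (f : 'rV[R]_m -> R) x v c : smooth f -> V x ->
  'D_v (fun x => c * f x) x = c * 'D_v f x.
Proof.
move=> fC Vx; rewrite (derive_mul v (smooth_cst c) fC Vx) derive_cst.
by rewrite mulr0 addr0.
Qed.

Lemma derive_ext (W : normedModType R) (f g : 'rV[R]_m -> W) x v :
  {in V, f =1 g} -> V x -> 'D_v f x = 'D_v g x.
Proof. by move=> fg Vx; apply: near_eq_derive; exact: near_ext. Qed.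

Lemma derive_swap N (f : 'rV[R]_m -> 'rV[R]_N) x v w : smooth f -> V x ->
  'D_w ('D_v f) x = 'D_v ('D_w f) x.
Proof.
move=> fC Vx; apply/rowP => j.
have [fvC fwC] := (@smooth_derive _ f v fC, @smooth_derive _ f w fC).
have dE u u' : 'D_u' ('D_u f) x 0 j = 'D_u' (fun y => 'D_u f y 0 j) x.
  by apply: derive_coord; apply: smooth_diff Vx; exact: smooth_derive.
apply: etrans (dE v w) _; apply: etrans _ (esym (dE w v)).
have fjC := (smooth_coord f).1 fC j.
have DE u : {in V, (fun x => 'D_u f x 0 j) =1 'D_u (fun x => f x 0 j)}.
  by move=> y; rewrite inE => Vy; rewrite derive_coord //; exact: smooth_diff fC Vy.
apply: etrans (derive_ext w (DE v) Vx) _.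
apply: etrans _ (esym (derive_ext v (DE w) Vx)).
apply: derive_comm; last 2 first.
- exact: smooth_diff (smooth_derive v fjC) Vx.
- exact: smooth_diff (smooth_derive w fjC) Vx.
by apply: filterS (near_open Vx) => y Vy; exact: smooth_diff fjC Vy.
Qed.

Lemma derive_linear N (f : 'rV[R]_m -> 'rV[R]_N) x v : smooth f -> V x ->
  'D_v f x = \sum_i v 0 i *: 'D_(delta_mx 0 i) f x.
Proof.
move=> fC Vx; have df := smooth_diff fC Vx; rewrite deriveE //.
rewrite {1}(row_sum_delta v) linear_sum; apply: eq_bigr => i _.
by rewrite linearZ deriveE.
Qed.

End SmoothFunctions.

(** * Orthonormal frames and stereographic charts *)

Definition curvature (eps : int) : Prop := eps \in [:: 0; 1; -1].

Section Frames.
Context {R : realType}.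
Implicit Types eps : int.

Lemma curvature_cases eps : curvature eps -> [\/ eps = 0, eps = 1 | eps = -1].
Proof.
rewrite /curvature !inE => /or3P[] /eqP ->; first exact: Or31.
  exact: Or32.
exact: Or33.
Qed.

Lemma curvature3 eps : curvature eps -> (eps%:~R : R) * eps%:~R * eps%:~R = eps%:~R.
Proof. by move=> /curvature_cases[] ->; rewrite ?mulr0 ?rmorphN ?mulrNN ?rmorph1; ring. Qed.

Lemma curvature2 eps : curvature eps -> eps != 0 -> (eps%:~R : R) * eps%:~R = 1.
Proof. by move=> /curvature_cases[] ->; rewrite ?eqxx // ?rmorphN ?rmorph1 => _; ring. Qed.

(* An orthonormal basis of the tangent space at x, as the rows of E; the last
   condition expresses that they span it, together with x when eps != 0. *)
Record frame_at (eps : int) (q m N : nat) (x : 'rV[R]_N) (eta : 'I_m -> R)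
    (E : 'M[R]_(m, N)) : Prop := FrameAt {
  frame_sign : forall i, eta i * eta i = 1 ;
  frame_orth : forall i j, pform q (row i E) (row j E) = eta i * (i == j)%:R ;
  frame_perp : forall i, eps%:~R * pform q (row i E) x = 0 ;
  frame_norm : eps != 0 -> pform q x x = eps%:~R ;
  frame_span : forall y, y = (eps%:~R * pform q y x) *: x +
    \sum_i (eta i * pform q y (row i E)) *: row i E
}.

Lemma row_expand q N (z : 'rV[R]_N) :
  z = \sum_(i < N) (psign q i * pform q z (delta_mx 0 i)) *: delta_mx 0 i.
Proof.
rewrite {1}(row_sum_delta z); apply: eq_bigr => i _.
by rewrite pform_delta mulrA psign2 mul1r.
Qed.

(** If all signs were opposite to [eps], then [eps * <x, x>], which is 1, would be minus a sum of
    squares. *)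
Lemma exists_sign q N (x : 'rV[R]_N) eps : curvature eps -> eps != 0 ->
  pform q x x = eps%:~R -> exists k : 'I_N, psign q k = eps%:~R :> R.
Proof.
move=> ce e0 xx; apply: contrapT => /forallNP nk.
have sgE (k : 'I_N) : psign q k = - eps%:~R :> R.
  have := nk k; move: e0; case/curvature_cases: ce => -> //;
  by rewrite /psign ?rmorphN ?rmorph1 ?opprK; case: ifP.
have : eps%:~R * pform q x x = - \sum_(k < N) x 0 k ^+ 2.
  rewrite pformE; under eq_bigr do rewrite sgE.
  rewrite -mulr_sumr mulrA mulrN curvature2 // mulN1r; congr (- _).
rewrite xx curvature2 // => h.
have : 0 <= \sum_(k < N) x 0 k ^+ 2 by apply: sumr_ge0 => k _; exact: sqr_ge0.
lra.
Qed.

(** In the curved case, an isometry [T] sends a basis vector of sign [eps] to [x]; the images of the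
    other basis vectors form the frame. *)
Lemma exists_frame eps q m N (x : 'rV[R]_N) :
  curvature eps -> N = (m + (eps != 0))%N ->
  (eps != 0 -> pform q x x = eps%:~R) ->
  exists eta E, @frame_at eps q m N x eta E.
Proof.
move=> ce; have [e0|e0] := eqVneq eps 0.
  rewrite addn0 => NE; move: x; rewrite {}NE => x _.
  exists (fun i => psign q i), 1%:M; split => //.
  - by move=> i; rewrite psign2.
  - by move=> i j; rewrite !row1 pform_delta2; case: eqVneq => [->|]; rewrite ?mulr0.
  - by move=> i; rewrite e0 mul0r.
  - by rewrite e0 eqxx.
  - move=> y; rewrite e0 mul0r scale0r add0r {1}(row_expand q y).
    by apply: eq_bigr => i _; rewrite row1.
rewrite addn1 => NE; move: x; rewrite {}NE => x /(_ isT) xx.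
have [k kE] := exists_sign ce e0 xx.
have kk : pform q (delta_mx 0 k : 'rV[R]_m.+1) (delta_mx 0 k) = eps%:~R.
  by rewrite pform_delta2 eqxx mulr1.
have [||T [hT kT _]] := pisom_swap (q := q) (u := delta_mx 0 k) (v := x).
- by rewrite kk.
- by rewrite xx intr_eq0.
exists (fun i => psign q (lift k i)), (\matrix_i (delta_mx 0 (lift k i) *m T)).
split => //.
- by move=> i; rewrite psign2.
- move=> i j; rewrite !rowK hT pform_delta2 (inj_eq lift_inj).
  by case: eqVneq => [->|]; rewrite ?mulr0.
- by move=> i; rewrite rowK -kT hT pform_delta2 eq_sym (negbTE (neq_lift k i)) !mulr0.
- move=> y; have uT := pisom_unit hT.
  rewrite -{1}(mulmxKV uT y) {1}(row_expand q (y *m invmx T)) mulmx_suml.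
  have co i : pform q (y *m invmx T) (delta_mx 0 i) = pform q y (delta_mx 0 i *m T).
    by rewrite -(hT (y *m _)) mulmxKV.
  rewrite (bigD1_ord k) //= -scalemxAl co kT kE; congr (_ + _).
  by apply: eq_bigr => i _; rewrite rowK -scalemxAl co.
Qed.

End Frames.

(** * The stereographic parametrization and its metric *)

Section Chart.
Context {R : realType}.
Variables (eps : int) (q m N : nat) (x : 'rV[R]_N) (eta : 'I_m -> R) (E : 'M[R]_(m, N)).
Hypotheses (ce : curvature eps) (fE : frame_at eps q x eta E).

Notation e := (eps%:~R : R).
Implicit Types (u v w : 'rV[R]_m) (y z : 'rV[R]_N).

Lemma row_mulE u : u *m E = \sum_i u 0 i *: row i E.
Proof. by rewrite mulmx_sum_row. Qed.

Lemma frame_mul_perp u : e * pform q (u *m E) x = 0.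
Proof.
rewrite row_mulE pform_suml mulr_sumr big1 // => i _.
by rewrite pformZl mulrCA (frame_perp fE) mulr0.
Qed.

Lemma frame_mul_row u i : pform q (u *m E) (row i E) = eta i * u 0 i.
Proof.
rewrite row_mulE pform_suml (bigD1 i) //= big1 => [|j ji].
  by rewrite addr0 pformZl (frame_orth fE) eqxx mulr1 mulrC.
by rewrite pformZl (frame_orth fE) (negbTE ji) !mulr0.
Qed.

Lemma frame_norm3 : e * pform q x x = e * e.
Proof.
have [e0|e0] := eqVneq eps 0; first by rewrite e0 !mul0r.
by rewrite (frame_norm fE).
Qed.

Definition tau u : R := (1 + e * pform q (u *m E) (u *m E)) / 2.

(** Stereographic projection from [- x]: the line from [- x] through [u *m E] meets the quadric
    again at parameter [1 / tau u]. In the flat case [tau] is the constant 1/2 and the chart is the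
    affine map [x + 2 *: (u *m E)]. *)
Definition stereo u : 'rV[R]_N := (tau u)^-1 *: (x + u *m E) - x.

Lemma tau0 : tau 0 = 2^-1.
Proof. by rewrite /tau mul0mx pform0l mulr0 addr0 mul1r. Qed.

Lemma stereo0 : stereo 0 = x.
Proof.
by rewrite /stereo tau0 mul0mx addr0 invrK scaler_nat mulr2n addrK.
Qed.

Lemma stereo_norm u : tau u != 0 -> e * pform q (stereo u) (stereo u) = e * e.
Proof.
move=> tu; rewrite /stereo !pformX (pformC q x (u *m E)).
have h1 := frame_mul_perp u; have h2 := frame_norm3.
have h3 : e * pform q (u *m E) (u *m E) = 2 * tau u - 1.
  by rewrite /tau; field.
set t := tau u in tu h3 *; set a := pform q x x in h2 *.
set b := pform q (u *m E) x in h1 *; set c := pform q _ _ in h3 *.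
(* The pairings are known only after multiplication by [e], so the expression is regrouped to show
   each of them with that factor. *)
rewrite (_ : _ * _ = (t^-1) ^+ 2 * (e * a + 2 * (e * b) + e * c)
  - 2 * t^-1 * (e * a + e * b) + e * a); last by rewrite expr2; ring.
rewrite h1 h2 h3.
have [e0|e0] := eqVneq eps 0.
  move: h3; rewrite e0 !mul0r => h3.
  by rewrite (_ : t = 1 / 2); [field|lra].
by rewrite curvature2 //; field.
Qed.

Lemma stereo_quadric u : tau u != 0 -> eps != 0 ->
  pform q (stereo u) (stereo u) = e.
Proof.
move=> tu e0; have := stereo_norm tu; apply: mulfI.
by rewrite intr_eq0.
Qed.

(** The quantity [1 / tau] as a function of the point: [1 + eps <y, x>] in the curved case and the
    constant 2 in the flat case. *)
Definition stereo_factor y : R := 2 - e * e + e * pform q y x.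

Definition stereo_inv y : 'rV[R]_m :=
  \row_i (eta i * pform q ((stereo_factor y)^-1 *: (y + x) - x) (row i E)).

Lemma stereo_factorK u : tau u != 0 -> stereo_factor (stereo u) = (tau u)^-1.
Proof.
move=> tu; rewrite /stereo_factor /stereo !pformX.
have h1 := frame_mul_perp u; have h2 := frame_norm3.
have -> : e * ((tau u)^-1 * (pform q x x + pform q (u *m E) x) - pform q x x) =
  (tau u)^-1 * (e * pform q x x + e * pform q (u *m E) x) - e * pform q x x by ring.
rewrite h1 h2 addr0; have [e0|e0] := eqVneq eps 0.
  by rewrite /tau e0 !mul0r; field.
rewrite curvature2 //; ring.
Qed.

Lemma stereoK u : tau u != 0 -> stereo_inv (stereo u) = u.
Proof.
move=> tu; apply/rowP => i; rewrite mxE stereo_factorK // invrK.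
rewrite /stereo subrK scalerA mulfV // scale1r addrC addKr.
by rewrite frame_mul_row mulrA (frame_sign fE) mul1r.
Qed.

Lemma stereo_invE y : (eps != 0 -> pform q y y = e) -> stereo_factor y != 0 ->
  stereo_inv y *m E = (stereo_factor y)^-1 *: (y + x) - x.
Proof.
move=> yQ Ty; rewrite row_mulE [RHS](frame_span fE) (_ : e * _ = 0) ?scale0r ?add0r.
  by apply: eq_bigr => i _; rewrite mxE.
rewrite !pformX.
have -> : e * ((stereo_factor y)^-1 * (pform q y x + pform q x x) - pform q x x) =
  (stereo_factor y)^-1 * (e * pform q y x + e * pform q x x) - e * pform q x x by ring.
rewrite frame_norm3; have [e0|e0] := eqVneq eps 0.
  by rewrite e0 !mul0r addr0 mulr0 subr0.
move: Ty; rewrite /stereo_factor curvature2 // => Ty.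
by apply/eqP; rewrite subr_eq0; apply/eqP; field; apply: contra_neq Ty => h; lra.
Qed.

Lemma tau_inv y : (eps != 0 -> pform q y y = e) -> stereo_factor y != 0 ->
  tau (stereo_inv y) = (stereo_factor y)^-1.
Proof.
move=> yQ Ty; rewrite /tau stereo_invE //.
have [e0|e0] := eqVneq eps 0.
  by rewrite /stereo_factor e0 !mul0r subr0 addr0 addr0 mul1r.
rewrite !pformX (pformC q x y) yQ // (frame_norm fE) //.
move: Ty; rewrite /stereo_factor curvature2 //; set b := pform q y x => Ty.
have e2 : e * e = 1 := curvature2 (R := R) ce e0.
have Ty' : 1 + e * b != 0 by apply: contra_neq Ty => h; lra.
rewrite (_ : 2 - 1 + e * b = 1 + e * b); last by ring.
set T := 1 + e * b in Ty' *.
rewrite (_ : e * _ = (e * e + e * b + (e * b + e * e)) * (T^-1) ^+ 2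
  - 2 * T^-1 * (e * b + e * e) + e * e); last by ring.
have ebE : e * b = T - 1 by rewrite /T; ring.
rewrite e2 ebE; field.
by rewrite Ty'.
Qed.

Lemma stereo_invK y : (eps != 0 -> pform q y y = e) -> stereo_factor y != 0 ->
  stereo (stereo_inv y) = y.
Proof.
move=> yQ Ty; rewrite /stereo tau_inv // invrK stereo_invE //.
by rewrite [x + _]addrC subrK scalerA mulfV // scale1r addrK.
Qed.

Section Derivatives.
Variable V : set 'rV[R]_m.
Hypotheses (oV : open V) (tV : forall u, V u -> tau u != 0).

Lemma smooth_lift : smooth V (fun u => u *m E).
Proof. by apply: (smooth_mulmx oV); exact: (smooth_id oV). Qed.

Lemma derive_lift u v : V u -> 'D_v (fun u => u *m E) u = v *m E.
Proof. by move=> Vu; rewrite (derive_mulmx oV E v (smooth_id oV) Vu) derive_id. Qed.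

Lemma smooth_tau : smooth V tau.
Proof.
apply: (smoothM oV); last exact: (smooth_cst oV _).
apply: (smoothD oV); first exact: (smooth_cst oV _).
apply: (smoothM oV); first exact: (smooth_cst oV _).
by apply: (smooth_pform oV); exact: smooth_lift.
Qed.

Lemma derive_tau u v : V u -> 'D_v tau u = e * pform q (v *m E) (u *m E).
Proof.
move=> Vu; have sp := smooth_pform oV q smooth_lift smooth_lift.
have -> : tau = fun u => 2^-1 * (1 + e * pform q (u *m E) (u *m E)).
  by apply/funext => y; rewrite /tau mulrC.
have se : smooth V (fun u => e * pform q (u *m E) (u *m E)).
  by apply: (smoothM oV) => //; exact: (smooth_cst oV _).
have s1 := smooth_cst oV (1 : R).
rewrite (derive_cmul oV v _ (smoothD oV s1 se) Vu) (derive_add v s1 se Vu).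
rewrite derive_cst add0r (derive_cmul oV v _ sp Vu).
rewrite (derive_pform oV q v smooth_lift smooth_lift Vu).
rewrite !derive_lift // (pformC q (u *m E)).
by field.
Qed.

Lemma smooth_stereo : smooth V stereo.
Proof.
apply: (smoothD oV); last exact: (smooth_cst oV _).
apply: (smooth_scale oV); first exact: (smoothV oV tV smooth_tau).
by apply: (smoothD oV); [exact: (smooth_cst oV _)|exact: smooth_lift].
Qed.

Lemma derive_stereo u v : V u -> 'D_v stereo u = (tau u)^-1 *: (v *m E)
  - ((tau u)^-1 ^+ 2 * (e * pform q (v *m E) (u *m E))) *: (x + u *m E).
Proof.
move=> Vu; have st := smoothV oV tV smooth_tau.
have sl : smooth V (fun u => x + u *m E).
  by apply: (smoothD oV); [exact: (smooth_cst oV _)|exact: smooth_lift].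
rewrite /stereo (derive_add v (smooth_scale oV st sl) (smooth_cst oV (- x)) Vu).
rewrite derive_cst addr0 (derive_scale oV v st sl Vu).
rewrite (derive_add v (smooth_cst oV x) smooth_lift Vu) derive_cst add0r derive_lift //.
congr (_ + _); rewrite -scaleNr; congr (_ *: _).
rewrite deriveV ?derive_tau //; [|exact: tV|exact: (smooth_derivable smooth_tau Vu)].
by rewrite -mulNr exprVn.
Qed.

Lemma stereo_metric u v w : V u ->
  pform q ('D_v stereo u) ('D_w stereo u) =
  (tau u)^-1 ^+ 2 * pform q (v *m E) (w *m E).
Proof.
move=> Vu; rewrite !derive_stereo // !pformX.
have h1 v' := frame_mul_perp v'; have h2 := frame_norm3.
have tu := tV Vu.
have h3 : e * pform q (u *m E) (u *m E) = 2 * tau u - 1 by rewrite /tau; field.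
have h4 := curvature3 (R := R) ce.
rewrite !(pformC q x) !(pformC q (u *m E) (_ *m E)).
set t := tau u in tu h3 *; set a := pform q x x in h2 *.
set c := pform q (u *m E) (u *m E) in h3 *.
set b := pform q (u *m E) x; have hb : e * b = 0 := h1 u.
set bv := pform q (v *m E) x; have hbv : e * bv = 0 := h1 v.
set bw := pform q (w *m E) x; have hbw : e * bw = 0 := h1 w.
set cv := pform q (v *m E) (u *m E); set cw := pform q (w *m E) (u *m E).
set d := pform q (v *m E) (w *m E).
rewrite [LHS](_ : _ = t^-1 ^+ 2 * d
  - t^-1 ^+ 3 * cw * (e * bv + e * cv) - t^-1 ^+ 3 * cv * (e * bw + e * cw)
  + t^-1 ^+ 4 * cv * cw * e * (e * a + 2 * (e * b) + e * c)); last by ring.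
rewrite hbv hbw hb h2 h3 !add0r mulr0 addr0.
rewrite (_ : _ * e * _ = t^-1 ^+ 4 * cv * cw * (e * e * e + 2 * e * t - e)); last by ring.
rewrite h4; field.
by rewrite tu.
Qed.

End Derivatives.

End Chart.

(** * Stereographic charts as local parametrizations of a sheet *)

Section SpaceFormChart.
Context {R : realType}.

Lemma path_component (T : topologicalType) (A : set T) (g : R -> T) :
  {in `[0, 1]%classic, continuous g} -> (forall t, 0 <= t <= 1 -> A (g t)) ->
  connected_component A (g 0) (g 1).
Proof.
move=> gc gA; exists (g @` `[0, 1]%classic); last first.
  by exists 1 => //=; rewrite in_itv /= ler01 lexx.
split.
- by exists 0 => //=; rewrite in_itv /= ler01 lexx.
- by move=> _ [t /= tI <-]; apply: gA; move: tI; rewrite in_itv.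
- apply: connected_continuous_connected; first exact: segment_connected.
  exact: continuous_in_subspaceT.
Qed.

Lemma smooth_continuous m (V : set 'rV[R]_m) (W : normedModType R)
    (f : 'rV[R]_m -> W) x : smooth V f -> V x -> {for x, continuous f}.
Proof.
by move=> fC Vx; apply: differentiable_continuous; exact: (smooth_diff fC Vx).
Qed.

Lemma open_neq0 (m : nat) (f : 'rV[R]_m -> R) :
  smooth setT f -> open [set x | f x != 0].
Proof.
move=> fC; rewrite (_ : mkset _ = f @^-1` [set x | x != 0]) //.
apply: open_comp; last exact: open_neq.
by move=> x _; exact: (smooth_continuous fC).
Qed.

Variables (eps : int) (m s : nat) (x0 x : 'rV[R]_(amb_dim eps m)).
Variables (eta : 'I_m -> R) (E : 'M[R]_(m, amb_dim eps m)).
Notation q := (amb_idx eps s).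
Notation M := (space_form eps m s x0).
Notation N := (amb_dim eps m).
Hypotheses (ce : curvature eps) (Mx : M x) (fE : frame_at eps q x eta E).

Lemma quadric_norm y : quadric eps m s y -> eps != 0 -> pform q y y = eps%:~R :> R.
Proof. by move=> yQ e0; exact: yQ. Qed.

Lemma space_form_norm y : M y -> eps != 0 -> pform q y y = eps%:~R :> R.
Proof. by move=> /connected_component_sub; exact: quadric_norm. Qed.

Lemma exists_chart_radius : exists2 r : R, 0 < r &
  forall u : 'rV[R]_m, ball 0 r u -> 0 < tau eps q E u.
Proof.
have tC : {for (0 : 'rV[R]_m), continuous (tau eps q E)}.
  exact: (smooth_continuous (smooth_tau eps q E openT)).
have : nbhs (0 : 'rV[R]_m) (tau eps q E @^-1` [set t | 0 < t]).
  apply: tC; rewrite tau0; apply: open_nbhs_nbhs; split; first exact: open_gt.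
  by rewrite /= invr_gt0 ltr0n.
by move=> /nbhs_ballP[r /= r0 rP]; exists r.
Qed.

Variable r : R.
Hypotheses (r0 : 0 < r)
  (tr : forall u : 'rV[R]_m, ball 0 r u -> 0 < tau eps q E u).
Notation V := (ball (0 : 'rV[R]_m) r).

Let tV (u : 'rV[R]_m) : V u -> tau eps q E u != 0.
Proof. by move=> /tr; exact: lt0r_neq0. Qed.

Lemma ball_rV_scale (u : 'rV[R]_m) (t : R) : V u -> 0 <= t <= 1 -> V (t *: u).
Proof.
rewrite -!ball_normE /= !sub0r !normrN normrZ => ur /andP[t0 t1].
by rewrite ger0_norm // (le_lt_trans _ ur) // ler_piMl.
Qed.

(** The ball is star-shaped, so the ray from 0 to [u] gives a path in the quadric that starts at
    [x]; the end point is thus on the sheet of [x]. *)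
Lemma stereo_form (u : 'rV[R]_m) : V u -> M (stereo eps q x E u).
Proof.
move=> Vu; have sC := smooth_stereo x (ball_open (0 : 'rV[R]_m) r) tV.
rewrite /space_form (same_connected_component Mx).
have := @path_component _ (quadric eps m s)
  (fun t => stereo eps q x E (t *: u)).
rewrite scale0r scale1r (stereo0 eps q x E); apply.
  move=> t; rewrite inE /= in_itv /= => tI.
  have c1 : {for t, continuous (fun t : R => t *: u)}.
    exact: scalel_continuous.
  exact: (continuous_comp c1 (smooth_continuous sC (ball_rV_scale Vu tI))).
move=> t tI e0; apply: (stereo_quadric ce fE) => //.
by apply: tV; exact: ball_rV_scale.
Qed.

Lemma smooth_stereo_factor : smooth setT (stereo_factor eps q x).
Proof.
apply: (smoothD openT); first exact: (smooth_cst openT _).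
apply: (smoothM openT); first exact: (smooth_cst openT _).
apply: (smooth_pform openT); first exact: (smooth_id openT).
exact: (smooth_cst openT _).
Qed.

Lemma smoothS (k : nat) (W : normedModType R) (A B : set 'rV[R]_k)
  (f : 'rV[R]_k -> W) : A `<=` B -> smooth B f -> smooth A f.
Proof.
move=> AB fC j; elim: j f fC => [|j IH] f fC; have [df Df] := fC 1%N; split => //.
- by move=> y /AB; exact: df.
- by move=> y /AB; exact: df.
- by move=> v; apply: IH; exact: (smooth_derive v fC).
Qed.

Lemma smooth_stereo_inv :
  smooth [set y | stereo_factor eps q x y != 0] (stereo_inv eps q x eta E).
Proof.
have oW := open_neq0 smooth_stereo_factor; set W := mkset _ in oW *.
apply/(smooth_coord oW) => i; under eq_fun do rewrite mxE.
apply: (smoothM oW); first exact: (smooth_cst oW _).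
apply: (smooth_pform oW); last exact: (smooth_cst oW _).
apply: (smoothD oW); last exact: (smooth_cst oW _).
apply: (smooth_scale oW).
  by apply: (smoothV oW) => //; exact: smoothS smooth_stereo_factor.
by apply: (smoothD oW); [exact: (smooth_id oW)|exact: (smooth_cst oW _)].
Qed.

Lemma stereo_local_param : local_param M V (stereo eps q x E).
Proof.
have oV := ball_open (0 : 'rV[R]_m) r.
split=> //.
- by apply/smooth_onP; exact: (smooth_stereo x oV tV).
- move=> u v Vu Dv; apply/rowP => i; rewrite mxE.
  have := stereo_metric ce fE oV tV v (delta_mx 0 i) Vu.
  rewrite Dv pform0l -rowE (frame_mul_row fE) => /esym/eqP.
  rewrite !mulf_eq0 invr_eq0 (negbTE (tV Vu)) /= => /orP[|/eqP //].
  move=> /eqP e0; have := frame_sign fE i; rewrite e0 mulr0 => /eqP.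
  by rewrite eq_sym oner_eq0.
- move=> u v Vu Vv uv.
  by rewrite -(stereoK ce fE (tV Vu)) uv (stereoK ce fE (tV Vv)).
(* The inverse chart extends smoothly to an open subset of the ambient space, and the preimage of
   [U] under this extension is the required ambient open set. *)
move=> U oU UV; exists [set y | stereo_factor eps q x y != 0 /\
    U (stereo_inv eps q x eta E y)].
  rewrite openE => y [Ty Uy]; rewrite /interior.
  have := smooth_continuous smooth_stereo_inv Ty.
  move=> /(_ U) /(_ (open_nbhs_nbhs (conj oU Uy))) nU.
  have nT := open_nbhs_nbhs (conj (open_neq0 smooth_stereo_factor) Ty).
  exact: filterI nT nU.
apply/seteqP; split=> [_ [u Uu <-]|y [My [Ty Uy]]].
  have Vu := UV _ Uu; split; first exact: stereo_form.
  rewrite /= (stereo_factorK ce fE (tV Vu)) (stereoK ce fE (tV Vu)).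
  by split => //; rewrite invr_eq0 tV.
exists (stereo_inv eps q x eta E y) => //.
by apply: (stereo_invK ce fE) => //; exact: space_form_norm.
Qed.

End SpaceFormChart.

(** * Maps with pure trace Hessian *)

Section QuadraticMaps.
Context {R : realType} {m : nat}.
Variables (r : R).
Hypothesis r0 : 0 < r.
Notation V := (ball (0 : 'rV[R]_m) r : set 'rV[R]_m).
Let oV : open V := ball_open (0 : 'rV[R]_m) r.

Lemma ball_constant N (h : 'rV[R]_m -> 'rV[R]_N) : smooth V h ->
  (forall u v, V u -> 'D_v h u = 0) -> forall u, V u -> h u = h 0.
Proof.
move=> hC h0 u Vu; apply/rowP => j.
have hj := (smooth_coord oV h).1 hC j.
apply: (derive0_segment (f := fun x => h x 0 j) (x := 0)) => t tI.
  rewrite subr0 addr0; apply: (smooth_diff hj).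
  exact: ball_rV_scale.
rewrite subr0 addr0; have Vt := ball_rV_scale Vu tI.
have := h0 (t *: u) u Vt => /rowP /(_ j); rewrite mxE => <-.
by apply: esym; apply: derive_coord; exact: (smooth_diff hC Vt).
Qed.

Variables (q N : nat) (eta : 'I_m -> R) (E : 'M[R]_(m, N)).
Hypotheses (eta2 : forall i, eta i * eta i = 1)
  (EE : forall i j, pform q (row i E) (row j E) = eta i * (i == j)%:R).
Hypothesis m2 : (2 <= m)%N.
Notation ef v w := (pform q (v *m E) (w *m E)).

Lemma derive_basis0 N' (h : 'rV[R]_m -> 'rV[R]_N') u : smooth V h -> V u ->
  (forall i, 'D_(delta_mx 0 i) h u = 0) -> forall v, 'D_v h u = 0.
Proof.
move=> hC Vu h0 v; rewrite (derive_linear v hC Vu) big1 // => i _.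
by rewrite h0 scaler0.
Qed.

(* For i != k, D_k K = eta_i D_k D_i D_i chi = eta_i D_i (D_k D_i chi) = 0. *)
Lemma trace_hessian_constant N' (chi K : 'rV[R]_m -> 'rV[R]_N') :
  smooth V chi ->
  (forall u v w, V u -> 'D_v ('D_w chi) u = ef v w *: K u) ->
  forall u, V u -> K u = K 0.
Proof.
move=> cC hess.
(* Smoothness of [K] is not given; it is read off from a pure second derivative of [chi]. The same
   expression of [K] is available for each direction [i]. *)
have KE i : {in V, (fun u => eta i *: 'D_(delta_mx 0 i) ('D_(delta_mx 0 i) chi) u) =1 K}.
  move=> u; rewrite inE => Vu; rewrite hess // -rowE EE eqxx mulr1 scalerA.
  by rewrite eta2 scale1r.
have K2 i : smooth V ('D_(delta_mx 0 i) ('D_(delta_mx 0 i) chi)).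
  by apply: smooth_derive; exact: smooth_derive.
have i0 : 'I_m by case: (m) m2 => // k _; exact: ord0.
have KC : smooth V K.
  have := smooth_scale oV (smooth_cst oV (eta i0)) (K2 i0).
  exact: (smooth_ext oV (KE i0)).
apply: ball_constant => // u v Vu; apply: (derive_basis0 KC Vu) => k {v}.
have [i ik] : exists i : 'I_m, i != k.
  have /card_gt0P[i] : (0 < #|predC1 k|)%N.
    by rewrite cardC1 card_ord; case: (m) m2 => [|[|]].
  by rewrite inE => ik; exists i.
apply: etrans (esym (derive_ext oV (delta_mx 0 k) (KE i) Vu)) _.
have c1 := smooth_cst oV (eta i).
apply: etrans (derive_scale oV (delta_mx 0 k) c1 (K2 i) Vu) _.
rewrite derive_cst scale0r addr0.
have Di := smooth_derive (delta_mx 0 i) cC.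
rewrite (_ : 'D_(delta_mx 0 k) _ u = 0) ?scaler0 //.
apply: etrans (derive_swap oV (delta_mx 0 i) (delta_mx 0 k) Di Vu) _.
have z : {in V, 'D_(delta_mx 0 k) ('D_(delta_mx 0 i) chi) =1 cst 0}.
  move=> y; rewrite inE => Vy; rewrite hess // -!rowE EE eq_sym (negbTE ik).
  by rewrite mulr0 scale0r.
by apply: etrans (derive_ext oV (delta_mx 0 i) z Vu) _; rewrite derive_cst.
Qed.

Lemma quadratic_of_trace_hessian N' (chi K : 'rV[R]_m -> 'rV[R]_N') :
  smooth V chi ->
  (forall u v w, V u -> 'D_v ('D_w chi) u = ef v w *: K u) ->
  exists A : 'M[R]_(m, N'), forall u, V u ->
    chi u = chi 0 + u *m A + (2^-1 * ef u u) *: K 0.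
Proof.
move=> cC hess; have KE := trace_hessian_constant cC hess.
have V0 : V (0 : 'rV[R]_m) by exact: ballxx.
pose A : 'M[R]_(m, N') := \matrix_i 'D_(delta_mx 0 i) chi 0.
have AE v : v *m A = 'D_v chi 0.
  rewrite (derive_linear v cC V0) mulmx_sum_row.
  by apply: eq_bigr => i _; rewrite rowK.
have lC : smooth V (fun u : 'rV_m => u *m E).
  by apply: (smooth_mulmx oV); exact: (smooth_id oV).
have lD u v : V u -> 'D_v (fun u : 'rV_m => u *m E) u = v *m E.
  move=> Vu; apply: etrans (derive_mulmx oV E v (smooth_id oV) Vu) _.
  by rewrite derive_id.
have pC := smooth_pform oV q lC lC.
pose k u : R := - 2^-1 * ef u u.
have kC : smooth V k by exact: (smoothM oV (smooth_cst oV _) pC).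
have kD u v : V u -> 'D_v k u = - ef v u.
  move=> Vu; apply: etrans (derive_cmul oV v (- 2^-1) pC Vu) _.
  by rewrite (derive_pform oV q v lC lC Vu) !lD // (pformC q (u *m E)); field.
have kDC v : smooth V (fun u => - ef v u).
  have := smooth_derive v kC; apply: (smooth_ext oV) => u; rewrite inE.
  exact: kD.
have kDD u v w : V u -> 'D_v (fun u => - ef w u) u = - ef v w.
  move=> Vu; have := smooth_pform oV q (smooth_cst oV (w *m E)) lC => wC.
  have -> : (fun u => - ef w u) = (fun u => (-1) * ef w u).
    by apply/funext => y; rewrite mulN1r.
  apply: etrans (derive_cmul oV v (-1) wC Vu) _.
  rewrite (derive_pform oV q v (smooth_cst oV (w *m E)) lC Vu).
  by rewrite derive_cst pform0l add0r lD // mulN1r pformC.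
have cK := smooth_cst oV (K 0).
(* Since [K] is constant, removing the quadratic part leaves a map with zero Hessian: its first
   derivatives are constant, so it is affine. *)
pose om u := chi u + k u *: K 0.
have kKC := smooth_scale oV kC cK.
have omC : smooth V om by exact: (smoothD oV cC kKC).
have omD v : {in V, 'D_v om =1 (fun u => 'D_v chi u + (- ef v u) *: K 0)}.
  move=> u; rewrite inE => Vu; apply: etrans (derive_add v cC kKC Vu) _.
  congr (_ + _); apply: etrans (derive_scale oV v kC cK Vu) _.
  by rewrite derive_cst scaler0 add0r kD.
have omDD u v w : V u -> 'D_v ('D_w om) u = 0.
  move=> Vu; apply: etrans (derive_ext oV v (omD w) Vu) _.
  have s2 := smooth_scale oV (kDC w) cK.
  apply: etrans (derive_add v (smooth_derive w cC) s2 Vu) _.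
  rewrite hess // KE //.
  rewrite (derive_scale oV v (kDC w) cK Vu) derive_cst scaler0 add0r kDD //.
  by rewrite -scalerDl subrr scale0r.
have omDc u v : V u -> 'D_v om u = v *m A.
  move=> Vu; rewrite (ball_constant (smooth_derive v omC) _ Vu) //; last first.
    by move=> y w Vy; exact: omDD.
  by rewrite omD ?inE // mul0mx pform0r oppr0 scale0r addr0 AE.
have mC : smooth V (fun u : 'rV_m => u *m - A).
  by apply: (smooth_mulmx oV); exact: (smooth_id oV).
exists A => u Vu.
have rC := smoothD oV omC mC.
have rE : om u + u *m - A = om 0 + 0 *m - A.
  apply: (ball_constant rC _ Vu) => y v Vy.
  apply: etrans (derive_add v omC mC Vy) _.
  rewrite omDc // (derive_mulmx oV (- A) v (smooth_id oV) Vy) derive_id.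
  by rewrite mulmxN subrr.
have <- : om 0 = chi 0.
  by rewrite /om /k mul0mx pform0l mulr0 scale0r addr0.
have -> : om 0 = om u - u *m A.
  by rewrite -mulmxN rE mul0mx addr0.
by rewrite subrK /om /k mulNr scaleNr subrK.
Qed.

End QuadraticMaps.

(** * The local form of umbilical immersions *)

(** The algebra behind the Koszul formula: [X a b c] stands for [<D_a D_b phi, D_c phi>], symmetric
    in [a] and [b], and [g a b c] for the derivative along [a] of [<D_b phi, D_c phi>]. *)
Lemma koszul_formula (R : realType) (T : Type) (X g : T -> T -> T -> R) a b c :
  (forall a b c, g a b c = X a b c + X a c b) ->
  (forall a b c, X a b c = X b a c) ->
  X a b c = 2^-1 * (g a b c + g b a c - g c a b).
Proof.
move=> gE XC; rewrite !gE (XC b a c) (XC c a b) (XC c b a).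
by move: (X a b c) (X a c b) (X b c a) => x y z; field.
Qed.

Lemma sum_combination (R : realType) (I : finType) (W : lmodType R)
    (P : I -> W) (c ta tb d : R) (A B D : I -> R) :
  \sum_i (- c * (ta * B i + tb * A i - d * D i)) *: P i =
  - (c *: (ta *: (\sum_i B i *: P i) + tb *: (\sum_i A i *: P i)
     - d *: (\sum_i D i *: P i))).
Proof.
rewrite !scaler_sumr -big_split -sumrB scaler_sumr -sumrN.
apply: eq_bigr => i _ /=; rewrite !scalerA -!scalerDl -scalerBl scalerA -scaleNr.
by rewrite -scaleNr -mulNr.
Qed.

Section UmbilicalChart.
Context {R : realType}.
Variables (eps : int) (q m N : nat) (x : 'rV[R]_N) (eta : 'I_m -> R) (E : 'M[R]_(m, N)).
Hypotheses (ce : curvature eps) (fE : frame_at eps q x eta E).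
Variables (V : set 'rV[R]_m) (q' N' : nat) (f : 'rV[R]_N -> 'rV[R]_N').
Hypotheses (oV : open V) (tV : forall u, V u -> tau eps q E u != 0).
Notation e := (eps%:~R : R).
Notation ef v w := (pform q (v *m E) (w *m E)).
Notation psi := (stereo eps q x E).
Notation phi := (f \o psi).
Notation t := (tau eps q E).
Hypothesis phiC : smooth V phi.
Hypothesis phi_iso : forall u v w, V u ->
  pform q' ('D_v phi u) ('D_w phi u) = pform q ('D_v psi u) ('D_w psi u).
Hypothesis phi_norm : forall u, V u -> eps != 0 -> pform q' (phi u) (phi u) = e.

Let metric u v w : V u ->
  pform q' ('D_v phi u) ('D_w phi u) = (t u)^-1 ^+ 2 * ef v w.
Proof. by move=> Vu; rewrite phi_iso // (stereo_metric ce fE oV tV). Qed.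

Let phi_perp u v : V u -> e * pform q' ('D_v phi u) (phi u) = 0.
Proof.
move=> Vu; have [e0|e0] := eqVneq eps 0; first by rewrite e0 mul0r.
have nE : {in V, (fun u => pform q' (phi u) (phi u)) =1 cst e}.
  by move=> y; rewrite inE => Vy; rewrite phi_norm.
have := derive_ext oV v nE Vu.
rewrite derive_cst (derive_pform oV q' v phiC phiC Vu) (pformC _ (phi u)) => h.
have -> : pform q' ('D_v phi u) (phi u) = 0 by lra.
by rewrite mulr0.
Qed.

Let phi_perp2 u v w : V u -> e * pform q' ('D_v ('D_w phi) u) (phi u) =
  - (e * ((t u)^-1 ^+ 2 * ef v w)).
Proof.
move=> Vu; have wC := smooth_derive w phiC.
have nE : {in V, (fun u => e * pform q' ('D_w phi u) (phi u)) =1 cst 0}.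
  by move=> y; rewrite inE => Vy; rewrite phi_perp.
have := derive_ext oV v nE Vu.
rewrite derive_cst (derive_cmul oV v e (smooth_pform oV q' wC phiC) Vu).
rewrite (derive_pform oV q' v wC phiC Vu) (pformC q' ('D_w phi u)) metric // => h.
by apply/eqP; rewrite -subr_eq0 opprK -mulrDr h.
Qed.

Let Dmetric u a b c : V u ->
  'D_a (fun u => pform q' ('D_b phi u) ('D_c phi u)) u =
  - 2 * (t u)^-1 ^+ 3 * 'D_a t u * ef b c.
Proof.
move=> Vu; have tC := smooth_tau eps q E oV.
have iC := smoothV oV tV tC.
have nE : {in V, (fun u => pform q' ('D_b phi u) ('D_c phi u)) =1
    (fun u => ef b c * ((t u)^-1 * (t u)^-1))}.
  by move=> y; rewrite inE => Vy; rewrite metric // expr2 mulrC.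
apply: etrans (derive_ext oV a nE Vu) _.
apply: etrans (derive_cmul oV a (ef b c) (smoothM oV iC iC) Vu) _.
have iD : 'D_a (fun u => (t u)^-1) u = - (t u)^-2 * 'D_a t u.
  by apply: deriveV; [exact: tV | exact: (smooth_derivable tC Vu)].
rewrite (derive_mul a iC iC Vu) iD -exprVn.
ring.
Qed.

(** These are the Christoffel symbols of the conformally flat metric of the chart, read on the
    second derivatives of [phi]. *)
Let koszul u a b c : V u -> pform q' ('D_a ('D_b phi) u) ('D_c phi u) =
  - (t u)^-1 ^+ 3 * ('D_a t u * ef b c + 'D_b t u * ef a c - 'D_c t u * ef a b).
Proof.
move=> Vu.
have D3 a' b' c' : 'D_a' (fun u => pform q' ('D_b' phi u) ('D_c' phi u)) u =
    pform q' ('D_a' ('D_b' phi) u) ('D_c' phi u) +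
    pform q' ('D_a' ('D_c' phi) u) ('D_b' phi u).
  have := derive_pform oV q' a' (smooth_derive b' phiC) (smooth_derive c' phiC) Vu.
  by move=> ->; rewrite (pformC q' ('D_b' phi u)).
have sw a' b' c' : pform q' ('D_a' ('D_b' phi) u) ('D_c' phi u) =
    pform q' ('D_b' ('D_a' phi) u) ('D_c' phi u).
  exact: (congr1 (fun z => pform q' z ('D_c' phi u))
    (derive_swap oV b' a' phiC Vu)).
pose X a b c := pform q' ('D_a ('D_b phi) u) ('D_c phi u).
pose g a b c := 'D_a (fun u => pform q' ('D_b phi u) ('D_c phi u)) u.
have gE a' b' c' : g a' b' c' = - 2 * (t u)^-1 ^+ 3 * 'D_a' t u * ef b' c'.
  exact: Dmetric.
apply: etrans (@koszul_formula R _ X g a b c D3 sw) _; rewrite !gE {X g gE D3 sw}.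
move: ((t u)^-1) ('D_a t u) ('D_b t u) ('D_c t u) (ef b c) (ef a c) (ef a b).
by move=> T ta tb tc bc ac ab; field.
Qed.

Lemma gram_stereo u : V u ->
  gram q psi u = diag_mx (\row_i ((t u)^-1 ^+ 2 * eta i)).
Proof.
move=> Vu; apply/matrixP => i j; rewrite !mxE (stereo_metric ce fE oV tV) //.
rewrite -!rowE (frame_orth fE) mulrA.
by case: eqVneq; rewrite ?mulr1 ?mulr0 ?mulr1n ?mulr0n.
Qed.

Lemma invmx_gram_stereo u : V u ->
  invmx (gram q psi u) = diag_mx (\row_i (t u ^+ 2 * eta i)).
Proof.
move=> Vu; rewrite gram_stereo //; set D := diag_mx _.
suff DK : diag_mx (\row_i (t u ^+ 2 * eta i)) *m D = 1%:M.
  have uD : D \in unitmx by have [] := mulmx1_unit DK.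
  by rewrite -[LHS]mul1mx -DK mulmxK.
rewrite /D mulmx_diag; apply/matrixP => i j; rewrite !mxE.
rewrite mulrACA -exprMn mulfV ?tV // expr1n mul1r (frame_sign fE).
by [].
Qed.

(** The Gauss formula in the chart: besides the second fundamental form, there is a component along
    the position vector, forced by the constant norm on the target, and the Christoffel terms of the
    metric. *)
Let second_formE u a b : V u -> 'D_a ('D_b phi) u =
  second_form eps q q' f psi u a b
  - (e * (t u)^-1 ^+ 2 * ef a b) *: phi u
  - (t u)^-1 *: ('D_a t u *: 'D_b phi u + 'D_b t u *: 'D_a phi u
     - ef a b *: \sum_i (eta i * 'D_(delta_mx 0 i) t u) *: 'D_(delta_mx 0 i) phi u).
Proof.
move=> Vu; rewrite /second_form /normal_part /cov_derive /tangent_proj.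
rewrite invmx_gram_stereo //; set d2 := 'D_a _ u.
rewrite -[X in d2 - X *: phi u]/(e * pform q' d2 (phi u)) phi_perp2 //.
set T := \sum_(i < m) \sum_(j < m) _.
suff -> : T = - ((t u)^-1 *: ('D_a t u *: 'D_b phi u + 'D_b t u *: 'D_a phi u
     - ef a b *: \sum_i (eta i * 'D_(delta_mx 0 i) t u) *: 'D_(delta_mx 0 i) phi u)).
  by rewrite scaleNr !opprK !mulrA [_ + _ + _ - _]addrAC !addrK.
have ex v : 'D_v phi u = \sum_i (eta i * ef v (delta_mx 0 i)) *: 'D_(delta_mx 0 i) phi u.
  rewrite (derive_linear v phiC Vu); apply: eq_bigr => i _; congr (_ *: _).
  by rewrite -rowE (frame_mul_row fE) mulrA (frame_sign fE) mul1r.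
rewrite (ex a) (ex b) -sum_combination; apply: eq_bigr => i _.
rewrite (bigD1 i) //= big1 => [|j ji]; last first.
  by rewrite mxE eq_sym (negbTE ji) mulr0n mul0r scale0r.
rewrite addr0 2!mxE eqxx mulr1n; congr (_ *: _); rewrite pformDl pformNl pformZl.
have -> : - (e * ((t u)^-1 ^+ 2 * ef a b)) *
    pform q' (phi u) ('D_(delta_mx 0 i) phi u) = 0.
  rewrite mulNr (mulrC e) -mulrA (pformC q' (phi u)) phi_perp // mulr0.
  exact: oppr0.
rewrite subr0 koszul //; have := tV Vu.
move: (ef a b) (ef a _) (ef b _) (t u) ('D_a t u) ('D_b t u).
move: ('D_(delta_mx 0 i) t u) (eta i) => ti ei ab ai bi tu ta tb tu0; field.
by rewrite tu0.
Qed.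

(** In the product rule for [t *: phi], the mixed terms ['D_v t *: 'D_w phi + 'D_w t *: 'D_v phi]
    cancel the Christoffel terms of [second_formE]. Everything left is a multiple of [ef v w],
    including the Hessian of [t], which is [e * ef v w]. *)
Lemma hessian_umbilical H :
  (forall u v w, V u -> second_form eps q q' f psi u v w =
     pform q ('D_v psi u) ('D_w psi u) *: H u) ->
  exists K, forall u v w, V u ->
    'D_v ('D_w (fun u => t u *: phi u)) u = ef v w *: K u.
Proof.
move=> umb; have tC := smooth_tau eps q E oV.
(* The coefficient of [ef v w], with contributions from [H], from the position vector and from the
   gradient of [t]. *)
exists (fun u => (t u)^-1 *: H u + (e - e * (t u)^-1) *: phi u
  + \sum_i (eta i * 'D_(delta_mx 0 i) t u) *: 'D_(delta_mx 0 i) phi u).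
move=> u v w Vu.
have wC := smooth_derive w phiC; have wtC := smooth_derive w tC.
have nE : {in V, 'D_w (fun u => t u *: phi u) =1
    (fun u => t u *: 'D_w phi u + 'D_w t u *: phi u)}.
  by move=> y; rewrite inE => Vy; exact: (derive_scale oV w tC phiC Vy).
apply: etrans (derive_ext oV v nE Vu) _.
apply: etrans (derive_add v (smooth_scale oV tC wC) (smooth_scale oV wtC phiC) Vu) _.
rewrite (derive_scale oV v tC wC Vu) (derive_scale oV v wtC phiC Vu).
have -> : 'D_v ('D_w t) u = e * ef v w.
  have tE : {in V, 'D_w t =1 (fun u => e * ef w u)}.
    by move=> y; rewrite inE => Vy; rewrite (derive_tau eps q E oV).
  have lC := smooth_lift E oV; have cC := smooth_cst oV (w *m E).
  apply: etrans (derive_ext oV v tE Vu) _.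
  apply: etrans (derive_cmul oV v e (smooth_pform oV q cC lC) Vu) _.
  rewrite (derive_pform oV q v cC lC Vu) derive_cst pform0l add0r (derive_lift E oV v Vu).
  by rewrite pformC.
rewrite second_formE // umb // (stereo_metric ce fE oV tV) //.
have tu := tV Vu.
set G := \sum_i _; set a := 'D_v t u; set b := 'D_w t u.
set A := 'D_v phi u; set B := 'D_w phi u; set d := ef v w.
set p := (f \o psi) u; set h := H u; set k := t u in tu *.
clearbody G A B p h k a b d; apply/rowP => j; rewrite !mxE.
move: (G 0 j) (A 0 j) (B 0 j) (p 0 j) (h 0 j) => g1 a1 b1 p1 h1; field.
by rewrite tu.
Qed.

End UmbilicalChart.

(** * From chart coordinates back to the ambient space *)

Section LocalForm.
Context {R : realType}.
Variables (eps : int) (q m N N' : nat) (x : 'rV[R]_N) (eta : 'I_m -> R) (E : 'M[R]_(m, N)).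
Hypotheses (ce : curvature eps) (fE : frame_at eps q x eta E).
Notation e := (eps%:~R : R).
Notation ef v w := (pform q (v *m E) (w *m E)).
Notation psi := (stereo eps q x E).
Notation t := (tau eps q E).

(** With [y = psi u], both [1 / t] and [(u *m E) / t] are affine in [y], while [<u E, u E> / t] is
    affine in [y] up to a multiple of [<y, y>] that is present only in the flat case; [k0] and [k1]
    are its coefficients. *)
Lemma quadratic_stereo (chi0 K : 'rV[R]_N') (A : 'M[R]_(m, N')) :
  exists b B c, forall u, t u != 0 ->
    (t u)^-1 *: (chi0 + u *m A + (2^-1 * ef u u) *: K) =
    b + psi u *m B + pform q (psi u) (psi u) *: c.
Proof.
(* A matrix on the ambient space that acts as [A] along the frame. *)
pose A' : 'M[R]_(N, N') := \sum_i eta i *: (pdual q (row i E) *m row i A).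
have A'E z : z *m A' = \sum_i (eta i * pform q z (row i E)) *: row i A.
  rewrite mulmx_sumr; apply: eq_bigr => i _.
  by rewrite -scalemxAr mulmxA mulmx_pdual mul_scalar_mx scalerA.
have uA (u : 'rV[R]_m) : u *m A = (u *m E) *m A'.
  rewrite A'E mulmx_sum_row; apply: eq_bigr => i _.
  by rewrite (frame_mul_row fE) mulrA (frame_sign fE) mul1r.
pose D := chi0 - x *m A'.
pose k0 := e / 2 + (1 - e * e) / 4 * pform q x x.
pose k1 := - (e * e) / 2 - (1 - e * e) / 2.
exists ((2 - e * e) *: D + x *m A' + k0 *: K).
exists (A' + pdual q x *m (e *: D + k1 *: K)), (((1 - e * e) / 4) *: K).
move=> u tu; set y := psi u.
have TE : (t u)^-1 = 2 - e * e + e * pform q y x by rewrite -(stereo_factorK ce fE tu).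
have uE : u *m E = t u *: (y + x) - x.
  by rewrite /y /stereo subrK scalerA mulfV // scale1r addrC addKr.
have kE : (t u)^-1 * (2^-1 * ef u u) = k0 + k1 * pform q y x
    + (1 - e * e) / 4 * pform q y y.
  rewrite /k0 /k1; have [e0|e0] := eqVneq eps 0.
    have t2 : t u = 2^-1 by rewrite /tau e0 mul0r addr0 mul1r.
    have -> : u *m E = 2^-1 *: (y - x).
      by rewrite uE t2; apply/rowP => j; rewrite !mxE; field.
    by rewrite t2 e0 pformZl pformZr pform_sqrB; field.
  have e2 := curvature2 (R := R) ce e0.
  have h3 : e * ef u u = 2 * t u - 1 by rewrite /tau; field.
  have -> : ef u u = e * (2 * t u - 1) by rewrite -h3 mulrA e2 mul1r.
  have eyx : e * pform q y x = (t u)^-1 - 1.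
    by rewrite TE e2; ring.
  have -> : pform q y x = e * ((t u)^-1 - 1) by rewrite -eyx mulrA e2 mul1r.
  rewrite e2 subrr !mul0r !addr0.
  by field; rewrite tu.
rewrite !scalerDr scalerA kE uA uE mulmxBl -scalemxAl mulmxDl scalerBr scalerA.
rewrite mulVf // scale1r mulmxDr mulmxA mulmx_pdual mul_scalar_mx TE /D.
move: (x *m A') (y *m A') (pform q y x) (pform q y y) => X Y yx yy.
by apply/rowP => j; rewrite !mxE; ring.
Qed.

Variables (r : R) (q' : nat) (f : 'rV[R]_N -> 'rV[R]_N').
Hypothesis r0 : 0 < r.
Notation V := (ball (0 : 'rV[R]_m) r : set 'rV[R]_m).
Hypothesis m2 : (2 <= m)%N.
Hypothesis tr : forall u : 'rV[R]_m, V u -> 0 < t u.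

Lemma umbilical_local_form H : smooth V (f \o psi) ->
  (forall u v w, V u -> pform q' ('D_v (f \o psi) u) ('D_w (f \o psi) u) =
     pform q ('D_v psi u) ('D_w psi u)) ->
  (forall u, V u -> eps != 0 -> pform q' (f (psi u)) (f (psi u)) = e) ->
  (forall u v w, V u -> second_form eps q q' f psi u v w =
     pform q ('D_v psi u) ('D_w psi u) *: H u) ->
  exists b B c, forall u, V u ->
    f (psi u) = b + psi u *m B + pform q (psi u) (psi u) *: c.
Proof.
move=> phiC phi_iso phi_norm umb.
have oV := ball_open (0 : 'rV[R]_m) r.
have tV (u : 'rV[R]_m) : V u -> t u != 0 by move=> /tr; exact: lt0r_neq0.
have [K hess] := hessian_umbilical ce fE oV tV phiC phi_iso phi_norm umb.
have chiC := smooth_scale oV (smooth_tau eps q E oV) phiC.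
have [A chiE] := quadratic_of_trace_hessian r0 (frame_sign fE) (frame_orth fE)
  m2 chiC hess.
have [b [B [c bBc]]] := quadratic_stereo (t 0 *: (f \o psi) 0) (K 0) A.
exists b, B, c => u Vu; rewrite -bBc ?tV // -chiE //.
by rewrite scalerA mulVf ?tV // scale1r.
Qed.

End LocalForm.

(** * Gluing and the structure theorem *)

Section Gluing.
Context {R : realType}.
Variables (eps : int) (m s : nat) (x0 : 'rV[R]_(amb_dim eps m)).
Notation q := (amb_idx eps s).
Notation M := (space_form eps m s x0).
Notation N := (amb_dim eps m).
Notation e := (eps%:~R : R).
Hypotheses (ce : curvature eps) (m2 : (2 <= m)%N) (x0Q : quadric eps m s x0).

(** On a curved quadric [<y, y>] is constant and [c] can be absorbed into [b]. Uniqueness of the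
    coefficients therefore requires the normalization [eps != 0 -> c = 0] used below. *)
Definition qmap N' (b : 'rV[R]_N') (B : 'M[R]_(N, N')) (c : 'rV[R]_N') (y : 'rV[R]_N) :=
  b + y *m B + pform q y y *: c.

Lemma exists_chart x : M x -> exists eta E (r : R),
  [/\ frame_at eps q x eta E, 0 < r &
      forall u : 'rV[R]_m, ball 0 r u -> 0 < tau eps q E u].
Proof.
move=> Mx; have [|eta [E fE]] := @exists_frame R eps q m N x ce erefl.
  exact: (space_form_norm Mx).
by have [r r0 tr] := exists_chart_radius s E; exists eta, E, r.
Qed.

Lemma small_scale (W : set 'rV[R]_m) (v : 'rV[R]_m) : nbhs (0 : 'rV[R]_m) W ->
  exists2 d : R, 0 < d & forall k : R, `|k| <= d -> W (k *: v).
Proof.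
move=> /nbhs_ballP[r /= r0 rW].
have v0 : 0 < `|v| + 1 by rewrite ltr_wpDl.
exists (r / (2 * (`|v| + 1))); first by rewrite divr_gt0 // mulr_gt0.
move=> k kd; apply: rW; rewrite -ball_normE /= sub0r normrN normrZ.
rewrite (@le_lt_trans _ _ (r / 2)) //; last by lra.
have : `|k| * (`|v| + 1) <= r / 2.
  rewrite -ler_pdivlMr // (le_trans kd) // invfM mulrA //.
apply: le_trans; rewrite ler_wpM2l // lerDl //.
Qed.

(** Along the image of a coordinate axis of the chart at [x], the vanishing becomes, after clearing
    [tau], an identity between polynomials of degree at most 2 in the parameter [k]. Its values at
    [0], [d] and [- d] determine the coefficients, and the frame together with [x] spans the ambient
    space. *)
Lemma qmap_unique N' (b : 'rV[R]_N') B c (W : set 'rV[R]_N) x :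
  open W -> W x -> M x -> (eps != 0 -> c = 0) ->
  (forall y, M y -> W y -> qmap b B c y = 0) -> [/\ b = 0, B = 0 & c = 0].
Proof.
move=> oW Wx Mx c0 qm0; have [eta [E [r [fE r0 tr]]]] := exists_chart Mx.
have oV := ball_open (0 : 'rV[R]_m) r.
have tV (u : 'rV[R]_m) : ball 0 r u -> tau eps q E u != 0.
  by move=> /tr; exact: lt0r_neq0.
have V0 : ball (0 : 'rV[R]_m) r 0 by exact: ballxx.
have nW : nbhs (0 : 'rV[R]_m) [set u | ball 0 r u /\ W (stereo eps q x E u)].
  have sC := smooth_continuous (smooth_stereo x oV tV) V0.
  have := sC W; rewrite /= stereo0 => /(_ (open_nbhs_nbhs (conj oW Wx))) nW.
  exact: filterI (open_nbhs_nbhs (conj oV V0)) nW.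
have van (u : 'rV[R]_m) : ball 0 r u -> W (stereo eps q x E u) ->
    qmap b B c (stereo eps q x E u) = 0.
  by move=> Vu Wu; apply: qm0 => //; exact: (stereo_form ce Mx fE tr Vu).
have x_van : b + x *m B + pform q x x *: c = 0 by have := qm0 x Mx Wx.
have i0 : 'I_m by case: (m) m2 => // k _; exact: ord0.
pose w i := row i E *m B.
have tauE i (k : R) : tau eps q E (k *: delta_mx 0 i) = (1 + e * k ^+ 2 * eta i) / 2.
  rewrite /tau -scalemxAl -rowE !pformX (frame_orth fE) eqxx mulr1; ring.
have spanB : e *: (x *m B) = 0 -> (forall i, w i = 0) -> B = 0.
  move=> xB0 w0; apply: mx_delta_eq => j; rewrite mulmx0.
  rewrite {1}(frame_span fE (delta_mx 0 j)) mulmxDl -scalemxAl mulrC -scalerA xB0.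
  rewrite scaler0 add0r mulmx_suml big1 // => i _.
  by rewrite -scalemxAl -/(w i) w0 scaler0.
have near_i i : exists2 d : R, 0 < d & forall k : R, `|k| <= d ->
    let T := (1 + e * k ^+ 2 * eta i) / 2 in
    T != 0 /\ qmap b B c (T^-1 *: (x + k *: row i E) - x) = 0.
  have [d d0 dW] := small_scale (delta_mx 0 i) nW.
  exists d => // k kd /=.
  have [Vk Wk] := dW k kd; rewrite -tauE; split; first exact: tV.
  by have := van _ Vk Wk; rewrite /stereo -scalemxAl -rowE.
have eta0 i : eta i != 0.
  by apply: contra_eq_neq (frame_sign fE i) => ->; rewrite mulr0 eq_sym oner_neq0.
have [e0|e0] := eqVneq eps 0.
  have eR : e = 0 by rewrite e0.
  have cw i : c = 0 /\ w i = 0.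
    have [d d0 dP] := near_i i; have [wi wE] : exists wi, wi = w i by exists (w i).
    have qE (k : R) : `|k| <= d ->
        b + x *m B + (2 * k) *: wi + (pform q x x + 4 * k * pform q x (row i E)
          + 4 * k ^+ 2 * eta i) *: c = 0.
      move=> /dP /= []; rewrite eR !mul0r addr0 mul1r invrK => _ <-.
      have -> : 2 *: (x + k *: row i E) - x = x + (2 * k) *: row i E.
        by apply/rowP => j; rewrite !mxE; ring.
      rewrite /qmap mulmxDl -scalemxAl pform_sqrD !pformX (frame_orth fE) eqxx mulr1 addrA wE.
      by congr (_ + _ *: _); ring.
    have h0 := qE 0; have h1 := qE d; have h2 := qE (- d).
    rewrite normr0 ltW // in h0; rewrite ger0_norm ?lexx ?ltW // in h1.
    rewrite normrN ger0_norm ?lexx ?ltW // in h2.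
    move: h0 h1 h2 => /(_ isT) /rowP h0 /(_ isT) /rowP h1 /(_ isT) /rowP h2.
    have c00 : c = 0.
      apply/rowP => j; have := h0 j; have := h1 j; have := h2 j; rewrite !mxE => a1 a2 a3.
      have : (8 * d ^+ 2 * eta i) * c 0 j = 0 by lra.
      move/eqP; rewrite mulf_eq0 => /orP[|/eqP //].
      by rewrite !mulf_eq0 pnatr_eq0 (negbTE (eta0 i)) ?expf_eq0 (gt_eqF d0).
    rewrite -wE; split => //; apply/rowP => j.
    have := h1 j; have := h2 j; rewrite c00 !mxE => a1 a2.
    have : (4 * d) * wi 0 j = 0 by lra.
    by move/eqP; rewrite !mulf_eq0 pnatr_eq0 (gt_eqF d0) /= => /eqP.
  have [c00 _] := cw i0.
  have B0 : B = 0 by apply: spanB => [|i]; [rewrite eR scale0r|have [] := cw i].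
  by split => //; move: x_van; rewrite c00 B0 mulmx0 scaler0 !addr0.
have {}c0 := c0 e0; move: x_van; rewrite c0 scaler0 addr0 => x_van.
have cw i : x *m B = 0 /\ w i = 0.
  have [d d0 dP] := near_i i.
  have qE (k : R) : `|k| <= d -> ((1 + e * k ^+ 2 * eta i) / 2) *: (b - x *m B)
      + x *m B + k *: w i = 0.
    move=> /dP /= [T0]; rewrite /qmap c0 scaler0 addr0 => h.
    set T := _ / 2 in T0 h *.
    rewrite -[RHS](scaler0 _ T) -h mulmxBl -scalemxAl mulmxDl -scalemxAl -/(w i).
    by rewrite addrCA [RHS]scalerDr scalerA mulfV // scale1r -addrA addrC.
  have h0 := qE 0; have h1 := qE d; have h2 := qE (- d).
  rewrite normr0 ltW // in h0; rewrite ger0_norm ?lexx ?ltW // in h1.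
  rewrite normrN ger0_norm ?lexx ?ltW // in h2.
  move: h0 h1 h2 => /(_ isT) /rowP h0 /(_ isT) /rowP h1 /(_ isT) /rowP h2.
  have xB0 : b - x *m B = 0.
    apply/rowP => j; have := h0 j; have := h1 j; have := h2 j.
    rewrite !mxE; move: (\sum_j _) => X a1 a2 a3.
    have : (e * d ^+ 2 * eta i) * (b 0 j - X) = 0 by lra.
    move/eqP; rewrite mulf_eq0 => /orP[|/eqP //].
    by rewrite !mulf_eq0 intr_eq0 (negbTE e0) (negbTE (eta0 i)) ?expf_eq0 (gt_eqF d0).
  have xB : x *m B = 0.
    by apply/rowP => j; have := h0 j; rewrite xB0 scaler0 add0r scale0r addr0.
  split => //; apply/rowP => j; have := h1 j.
  rewrite xB0 xB scaler0 !add0r !mxE => /eqP.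
  by rewrite mulf_eq0 (gt_eqF d0) /= => /eqP.
have [xB _] := cw i0.
split => //; first by move: x_van; rewrite xB addr0.
by apply: spanB => [|i]; [rewrite xB scaler0|have [] := cw i].
Qed.

Lemma connected_form : connected M.
Proof. exact: component_connected. Qed.

Lemma form_base : M x0.
Proof. exact: connected_component_refl. Qed.

(** A continuation argument: the set [A] of points near which [f] has the coefficients found at [x0]
    is open by construction, and closed because [qmap_unique] identifies the coefficients of two
    local forms on an overlap. Connectedness gives [A = M]. *)
Lemma global_qmap N' (f : 'rV[R]_N -> 'rV[R]_N') :
  (forall x, M x -> exists W : set 'rV[R]_N, [/\ open W, W x &
     exists b B c, forall y, M y -> W y -> f y = qmap b B c y]) ->
  exists b B c, (eps != 0 -> c = 0) /\ forall y, M y -> f y = qmap b B c y.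
Proof.
move=> loc.
have {}loc x : M x -> exists W : set 'rV[R]_N, [/\ open W, W x &
    exists b B c, (eps != 0 -> c = 0) /\
      forall y, M y -> W y -> f y = qmap b B c y].
  move=> /loc [W [oW Wx [b [B [c bBc]]]]]; exists W; split => //.
  have [e0|e0] := eqVneq eps 0.
    by exists b, B, c; split => //; rewrite e0 eqxx.
  exists (b + e *: c), B, 0; split => // y My Wy; rewrite bBc // /qmap scaler0.
  by rewrite addr0 (space_form_norm My e0) addrAC.
have [W0 [oW0 W0x [b [B [c [c0 bBc]]]]]] := loc x0 form_base.
exists b, B, c; split => //.
pose A := [set y | M y /\ exists W : set 'rV[R]_N,
  [/\ open W, W y & forall z, M z -> W z -> f z = qmap b B c z]].
have agree y : A y -> f y = qmap b B c y by case=> My [W [_ Wy]]; apply.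
suff AM : A = M by move=> y My; apply: agree; rewrite AM.
apply: connected_form.
- by exists x0; split; [exact: form_base|exists W0].
- exists (\bigcup_(W in [set W : set 'rV[R]_N | open W /\
    forall z, M z -> W z -> f z = qmap b B c z]) W).
    by apply: bigcup_open => W [].
  apply/seteqP; split=> [y [My [W [oW Wy WP]]]|y [My [W [oW WP] Wy]]].
    by split => //; exists W.
  by split => //; exists W.
- exists (closure A); first exact: closed_closure.
  apply/seteqP; split=> [y Ay|y [My clA]].
    by split; [case: Ay|exact: subset_closure].
  have [W [oW Wy [b' [B' [c' [c'0 W']]]]]] := loc y My.
  have [z [[Mz [U [oU Uz UP]]] Wz]] := clA W (open_nbhs_nbhs (conj oW Wy)).
  have [|||||bb BB cc] := @qmap_unique _ (b - b') (B - B') (c - c') (W `&` U) z.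
  + exact: openI.
  + by [].
  + by [].
  + by move=> e0; rewrite c0 // c'0 // subrr.
  + move=> v Mv [Wv Uv]; have := W' v Mv Wv; rewrite (UP v Mv Uv) /qmap => h.
    rewrite mulmxBr scalerBr -[RHS](subrr (b + v *m B + pform q v v *: c)) {2}h.
    by rewrite !opprD [RHS]addrACA; congr (_ + _); rewrite addrACA.
  split => //; exists W; split => // v Mv Wv; rewrite W' //.
  by congr (qmap _ _ _ _); apply/esym/eqP; rewrite -subr_eq0; apply/eqP.
Qed.

End Gluing.

(** * The structure of umbilical immersions *)

Section Structure.
Context {R : realType}.
Variables (eps : int) (m s : nat) (x0 : 'rV[R]_(amb_dim eps m)).
Notation q := (amb_idx eps s).
Notation M := (space_form eps m s x0).
Notation N := (amb_dim eps m).
Notation e := (eps%:~R : R).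
Hypotheses (ce : curvature eps) (m2 : (2 <= m)%N) (x0Q : quadric eps m s x0).

(* <y, y> / 2 when eps = 0, and the constant eps otherwise; in both cases the
   Hessian of k on the space form is (1 - eps k) g. *)
Definition umb_factor (y : 'rV[R]_N) : R := e + (1 - e * e) / 2 * pform q y y.

Definition umb_map N' (b : 'rV[R]_N') (B : 'M[R]_(N, N')) (c : 'rV[R]_N') y :=
  b + y *m B + umb_factor y *: c.

(** When [eps != 0] the factor of [c] is the constant [eps], so [eps *: c] is the whole translation
    part and [b] must vanish. *)
Record umb_data (q' N' : nat) (b : 'rV[R]_N') (B : 'M[R]_(N, N')) (c : 'rV[R]_N') :
    Prop := UmbData {
  umb_pisom : pisom q q' B ;
  umb_orth : forall u, pform q' c (u *m B) = 0 ;
  umb_null : pform q' c c = 0 ;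
  umb_linear : eps != 0 -> b = 0
}.

Variables (q' N' : nat) (S' : set 'rV[R]_N') (f : 'rV[R]_N -> 'rV[R]_N').
Hypothesis S'norm : forall y, S' y -> eps != 0 -> pform q' y y = e.
Hypothesis fI : isometric_immersion m q q' M S' f.

Lemma umbilical_qmap : totally_umbilical eps m q q' M f ->
  exists b B c, (eps != 0 -> c = 0) /\ forall y, M y -> f y = qmap s b B c y.
Proof.
have [[fS fC] fiso] := fI; move=> umb.
apply: global_qmap => // x Mx.
have [eta [E [r [fE r0 tr]]]] := exists_chart ce Mx.
have lp := stereo_local_param ce Mx fE tr.
have V0 : ball (0 : 'rV[R]_m) r 0 by exact: ballxx.
have [oV _ _ _ /(_ _ oV (@subset_refl _ _)) [W oW imW]] := lp.
have stM (u : 'rV[R]_m) : ball 0 r u -> M (stereo eps q x E u).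
  by move=> Vu; have : (M `&` W) (stereo eps q x E u); [rewrite -imW; exists u|case].
exists W; split=> //.
  have : (M `&` W) x; last by case.
  by rewrite -imW; exists 0 => //; exact: stereo0.
have [||||b [B [c bBc]]] := @umbilical_local_form R eps q m N N' x eta E ce fE r q' f r0 m2 tr
  (mean_curvature eps q q' f (stereo eps q x E)).
- by apply/smooth_onP; exact: fC.
- by move=> u v w Vu; exact: (fiso _ _ lp).
- by move=> u Vu e0; apply: S'norm => //; apply: fS; exact: stM.
- by move=> u v w Vu; exact: (umb _ _ lp).
exists b, B, c => y My Wy.
have [u Vu <-] : (stereo eps q x E @` ball (0 : 'rV[R]_m) r) y by rewrite imW.
exact: bBc.
Qed.

(** The isometry condition at the centre of the stereographic chart at [x], where the chart has
    derivative [2 *: (v *m E)]; the factor 4 cancels on both sides. *)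
Lemma qmap_metric b B c x eta (E : 'M[R]_(m, N)) (v w : 'rV[R]_m) :
  frame_at eps q x eta E -> M x ->
  (forall y, M y -> f y = qmap s b B c y) ->
  pform q' (v *m E *m B + (2 * pform q x (v *m E)) *: c)
           (w *m E *m B + (2 * pform q x (w *m E)) *: c) =
  pform q (v *m E) (w *m E).
Proof.
move=> fE Mx fq; have [r r0 tr] := exists_chart_radius s E.
have tV (u : 'rV[R]_m) : ball 0 r u -> tau eps q E u != 0.
  by move=> /tr; exact: lt0r_neq0.
have lp := stereo_local_param ce Mx fE tr.
have V0 : ball (0 : 'rV[R]_m) r 0 by exact: ballxx.
have oV := ball_open (0 : 'rV[R]_m) r.
have [_ /(_ _ _ lp 0 v w V0)] := fI.
have sC := smooth_stereo x oV tV.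
have DpsiE u : 'D_u (stereo eps q x E) 0 = 2 *: (u *m E).
  rewrite (derive_stereo x oV tV u V0) mul0mx pform0r !mulr0 scale0r subr0.
  by rewrite tau0 invrK.
have DphiE u : 'D_u (f \o stereo eps q x E) 0 =
    2 *: (u *m E *m B + (2 * pform q x (u *m E)) *: c).
  have nE : {in (ball (0 : 'rV[R]_m) r : set 'rV[R]_m), f \o stereo eps q x E =1
      (fun u => b + stereo eps q x E u *m B
         + pform q (stereo eps q x E u) (stereo eps q x E u) *: c)}.
    move=> z; rewrite inE => Vz; apply: fq.
    exact: (stereo_form ce Mx fE tr Vz).
  apply: etrans (derive_ext oV u nE V0) _.
  have bC := smooth_cst oV b; have sB := smooth_mulmx oV B sC.
  have pC := smooth_pform oV q sC sC; have cC := smooth_cst oV c.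
  rewrite (derive_add u (smoothD oV bC sB) (smooth_scale oV pC cC) V0).
  rewrite (derive_add u bC sB V0) derive_cst add0r.
  rewrite (derive_scale oV u pC cC V0) derive_cst scaler0 add0r.
  rewrite (derive_mulmx oV B u sC V0) (derive_pform oV q u sC sC V0) !DpsiE.
  rewrite stereo0 (pformC q _ x) pformZr -scalemxAl scalerDr scalerA.
  by congr (_ + _ *: _); ring.
rewrite !DphiE !DpsiE !pformZl !pformZr !mulrA.
by apply: mulfI; rewrite mulf_eq0 pnatr_eq0.
Qed.

Lemma frame_decomp x eta (E : 'M[R]_(m, N)) y : frame_at eps q x eta E ->
  exists a v, y = (e * a) *: x + v *m E.
Proof.
move=> fE; exists (pform q y x), (\row_i (eta i * pform q y (row i E))).
rewrite {1}(frame_span fE y); congr (_ + _); rewrite mulmx_sum_row.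
by apply: eq_bigr => i _; rewrite mxE.
Qed.

(** The frame and [x] span the ambient space, so it is enough to compare the pairings of their
    images. The conditions on [x] carry a factor [e] because in the flat case the frame alone
    spans. *)
Lemma frame_pisom x eta (E : 'M[R]_(m, N)) (B : 'M[R]_(N, N')) :
  frame_at eps q x eta E ->
  (forall v w : 'rV_m, pform q' (v *m E *m B) (w *m E *m B) = pform q (v *m E) (w *m E)) ->
  (forall v : 'rV_m, e * pform q' (x *m B) (v *m E *m B) = 0) ->
  e * pform q' (x *m B) (x *m B) = e * e -> pisom q q' B.
Proof.
move=> fE EB xEB xB y z.
have [a [v ->]] := frame_decomp y fE; have [a' [v' ->]] := frame_decomp z fE.
rewrite !mulmxDl -!scalemxAl !pformX EB.
have h1 := xEB v; have h2 := xEB v'; have h3 := frame_mul_perp fE v.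
have h4 := frame_mul_perp fE v'; have h5 := frame_norm3 fE.
rewrite (pformC q' (v *m E *m B) (x *m B)) (pformC q x (v' *m E)).
set a1 := pform q' (x *m B) (x *m B) in xB *.
set a2 := pform q' (x *m B) (v *m E *m B) in h1 *.
set a3 := pform q' (x *m B) (v' *m E *m B) in h2 *.
set b1 := pform q x x in h5 *; set b2 := pform q (v *m E) x in h3 *.
set b3 := pform q (v' *m E) x in h4 *; set d := pform q _ _.
rewrite [LHS](_ : _ = e * a * a' * (e * a1) + a * (e * a3) + a' * (e * a2) + d); last by ring.
rewrite [RHS](_ : _ = e * a * a' * (e * b1) + a * (e * b3) + a' * (e * b2) + d); last by ring.
by rewrite xB h1 h2 h3 h4 h5.
Qed.

Lemma form_full y : eps = 0 -> M y.
Proof.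
move=> e0; have := @path_component R _ (quadric eps m s) (fun t => t *: (y - x0) + x0).
rewrite scale0r add0r scale1r subrK; apply; last first.
  by move=> t _ /negP[]; rewrite e0.
by move=> t _; apply: cvgD; [exact: scalel_continuous|exact: cvg_cst].
Qed.

(** The metric identity is available at every point [x] and for all vectors. The factor 2 passes
    from [<y, y>] in [qmap] to [<y, y> / 2] in [umb_factor]. *)
Lemma flat_structure b B c : eps = 0 ->
  (forall y, M y -> f y = qmap s b B c y) ->
  umb_data q' b B (2 *: c) /\ forall y, M y -> f y = umb_map b B (2 *: c) y.
Proof.
move=> e0 fq; have eR : e = 0 by rewrite e0.
have metric x y z : pform q' (y *m B + (2 * pform q x y) *: c)
    (z *m B + (2 * pform q x z) *: c) = pform q y z.
  have [eta [E [_ [fE _ _]]]] := exists_chart ce (form_full x e0).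
  have [a [v ->]] := frame_decomp y fE; have [a' [v' ->]] := frame_decomp z fE.
  rewrite eR !mul0r !scale0r !add0r.
  exact: (qmap_metric _ _ fE (form_full x e0) fq).
have Biso : pisom q q' B.
  move=> y z; have := metric 0 y z.
  by rewrite !pform0l !mulr0 !scale0r !addr0.
(* Comparing the identity at [x] and at [- x] separates the terms linear and quadratic in [c]. *)
have quad x y : pform q x y * pform q' c (y *m B) = 0 /\
    pform q x y ^+ 2 * pform q' c c = 0.
  have := metric x y y; have := metric (- x) y y.
  rewrite !pformX !Biso (pformC q' _ c).
  by move: (pform q x y) (pform q' c c) (pform q' c _) (pform q y y) => *; split; lra.
have [eta [E [_ [fE _ _]]]] := exists_chart ce (form_base x0Q).
have i0 : 'I_m by case: (m) m2 => // k _; exact: ord0.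
split; last first.
  move=> y My; rewrite fq // /qmap /umb_map /umb_factor eR mulr0 subr0 add0r.
  by rewrite scalerA; congr (_ + _ *: _); field.
split=> //; last by rewrite e0 eqxx.
- move=> u; have [->|u0] := eqVneq u 0; first by rewrite mul0mx pform0r.
  have [x ux] := exists_pairing q u0; have [/eqP + _] := quad x u.
  rewrite mulf_eq0 pformC (negbTE ux) /= => /eqP h.
  by rewrite pformZl h mulr0.
- rewrite pformZl pformZr; have [_] := quad (row i0 E) (row i0 E).
  by rewrite (frame_orth fE) eqxx mulr1 expr2 (frame_sign fE) mul1r => ->; rewrite !mulr0.
Qed.

(** The three roots are the values of [tau] at the parameters [0], [d] and [d / 2] of a coordinate
    axis, with [sg] the increment of [tau] at [d]. *)
Lemma quadratic_roots (A B C sg : R) : sg != 0 ->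
  let P t := t ^+ 2 * A + 2 * t * B + C in
  P (1 / 2) = 0 -> P (1 / 2 + sg) = 0 -> P (1 / 2 + sg / 4) = 0 ->
  [/\ A = 0, B = 0 & C = 0].
Proof.
move=> sg0 P h0 h1 h2; have A0 : A = 0.
  have : sg ^+ 2 * A = 0 by rewrite /P in h0 h1 h2; lra.
  by move/eqP; rewrite mulf_eq0 expf_eq0 (negbTE sg0) => /eqP.
have B0 : B = 0.
  have : sg * B = 0 by rewrite /P A0 in h0 h1 h2; lra.
  by move/eqP; rewrite mulf_eq0 (negbTE sg0) => /eqP.
by split => //; rewrite /P A0 B0 in h0; lra.
Qed.

(** The metric at [x0] only controls [B] on the tangent space. The products involving [b] and
    [x0 *m B] come from the other condition, that [f] takes its values in the target quadric. Since
    [umb_factor] is the constant [e], the translation [b] is written [e *: (e *: b)]. *)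
Lemma curved_structure b B : eps != 0 ->
  (forall y, M y -> f y = qmap s b B 0 y) ->
  umb_data q' 0 B (e *: b) /\ forall y, M y -> f y = umb_map 0 B (e *: b) y.
Proof.
move=> e0 fq; have e2 := curvature2 (R := R) ce e0.
have eR : e != 0 by rewrite intr_eq0.
have Mx := form_base x0Q.
have [eta [E [r [fE r0 tr]]]] := exists_chart ce Mx.
have i0 : 'I_m by case: (m) m2 => // k _; exact: ord0.
have [[fS _] _] := fI.
have eta0 i : eta i != 0.
  by apply: contra_eq_neq (frame_sign fE i) => ->; rewrite mulr0 eq_sym oner_neq0.
have metric (v w : 'rV[R]_m) :
    pform q' (v *m E *m B) (w *m E *m B) = pform q (v *m E) (w *m E).
  by have := qmap_metric v w fE Mx fq; rewrite !scaler0 !addr0.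
(* With these vectors, [tau *: f (stereo u)] is [tau *: a + X + u *m E *m B], so the norm condition
   on the target is polynomial in [tau] and [u]. *)
pose X := x0 *m B; pose a := b - X.
have key i (k : R) : ball (0 : 'rV[R]_m) r (k *: delta_mx 0 i) ->
    let t := (1 + e * k ^+ 2 * eta i) / 2 in
    t ^+ 2 * (pform q' a a - e) + 2 * t * (pform q' a X + e) + (pform q' X X - e)
    + 2 * k * (t * pform q' a (row i E *m B) + pform q' X (row i E *m B)) = 0.
  move=> Vk t; have := fS _ (stereo_form ce Mx fE tr Vk).
  move=> /S'norm /(_ e0); rewrite fq; last exact: (stereo_form ce Mx fE tr Vk).
  have tE : tau eps q E (k *: delta_mx 0 i) = t.
    rewrite /tau -scalemxAl -rowE !pformX (frame_orth fE) eqxx mulr1 /t; ring.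
  have t0 : t != 0 by rewrite -tE; apply: lt0r_neq0; exact: tr.
  rewrite /qmap scaler0 addr0 /stereo tE mulmxBl -/X.
  rewrite -(scalemxAl _ _ B) mulmxDl -/X -scalemxAl -rowE -scalemxAl => h.
  have aE : t *: (b + (t^-1 *: (X + k *: (row i E *m B)) - X)) =
      t *: a + X + k *: (row i E *m B).
    by rewrite addrCA [LHS]scalerDr scalerA mulfV // scale1r [LHS]addrC addrA.
  have : pform q' (t *: a + X + k *: (row i E *m B))
      (t *: a + X + k *: (row i E *m B)) = t ^+ 2 * e.
    by rewrite -aE pformZl pformZr h mulrA expr2.
  have UU : pform q' (row i E *m B) (row i E *m B) = eta i.
    by rewrite rowE metric -rowE (frame_orth fE) eqxx mulr1.
  rewrite !pform_sqrD !pformX UU.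
  have kE : k ^+ 2 * eta i = e * (2 * t - 1).
    have -> : 2 * t - 1 = e * (k ^+ 2 * eta i) by rewrite /t; field.
    by rewrite mulrA e2 mul1r.
  move=> h2; rewrite -[RHS](subrr (t ^+ 2 * e)) -{1}h2.
  have -> : k * (k * eta i) = e * (2 * t - 1) by rewrite -kE; ring.
  by rewrite (pformC q' X b); ring.
have small i : exists2 d : R, 0 < d & forall k : R, `|k| <= d ->
    ball (0 : 'rV[R]_m) r (k *: delta_mx 0 i).
  by apply: small_scale; exact: nbhsx_ballx.
have roots i : [/\ pform q' a a = e, pform q' a X = - e & pform q' X X = e] /\
    (pform q' a (row i E *m B) = 0 /\ pform q' X (row i E *m B) = 0).
  have [d d0 dV] := small i.
  (* As [t] is even in [k], the conditions at [k] and [- k] separate into an even and an odd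
     part. *)
  have kP (k : R) : `|k| <= d -> k != 0 ->
      let t := (1 + e * k ^+ 2 * eta i) / 2 in
      t ^+ 2 * (pform q' a a - e) + 2 * t * (pform q' a X + e)
        + (pform q' X X - e) = 0 /\
      t * pform q' a (row i E *m B) + pform q' X (row i E *m B) = 0.
    move=> kd k0 t; have h1 := key i k (dV k kd); have := dV (- k); rewrite normrN => /(_ kd).
    move=> /(key i); rewrite sqrrN -/t => h2; rewrite -/t /= in h1.
    move: h1 h2; move: (pform q' a a - e) (pform q' a X + e) (pform q' X X - e).
    move: (pform q' a _) (pform q' X _) => u1 u2 v1 v2 v3 h1 h2.
    rewrite /= in h2; clearbody t; split; first lra.
    have : k * (t * u1 + u2) = 0 by lra.
    by move=> /eqP; rewrite mulf_eq0 (negbTE k0) => /eqP.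
  have [v0 _] : pform q' a a / 4 + pform q' a X + pform q' X X = e / 4 /\ True.
    have V0 : ball (0 : 'rV[R]_m) r (0 *: delta_mx 0 i) by apply: dV; rewrite normr0 ltW.
    by split => //; have := key i 0 V0; rewrite /= => h; lra.
  have dd : `|d| <= d by rewrite gtr0_norm.
  have dd2 : `|d / 2| <= d by rewrite ger0_norm ?divr_ge0 ?ltW //; lra.
  have [e1 o1] := kP d dd (lt0r_neq0 d0).
  have [|e4 o4] := kP (d / 2) dd2; first by rewrite gt_eqF // divr_gt0.
  pose sg := e * d ^+ 2 * eta i / 2.
  have sg0 : sg != 0.
    apply: mulf_neq0; last by rewrite invr_eq0 pnatr_eq0.
    by rewrite !mulf_neq0 // lt0r_neq0.
  have t1 : (1 + e * d ^+ 2 * eta i) / 2 = 1 / 2 + sg by rewrite /sg; field.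
  have t2 : (1 + e * (d / 2) ^+ 2 * eta i) / 2 = 1 / 2 + sg / 4 by rewrite /sg; field.
  rewrite t1 in e1 o1; rewrite t2 in e4 o4.
  have [|A0 B0 C0] := quadratic_roots sg0 _ e1 e4; first by lra.
  split; first by split; lra.
  have aU : pform q' a (row i E *m B) = 0.
    have : sg * pform q' a (row i E *m B) = 0 by lra.
    by move=> /eqP; rewrite mulf_eq0 (negbTE sg0) => /eqP.
  by split => //; rewrite aU mulr0 add0r in o1.
have [[aa aX XX] _] := roots i0.
have XU (v : 'rV_m) : pform q' X (v *m E *m B) = 0.
  rewrite (row_mulE E v) mulmx_suml pform_sumr big1 // => i _.
  by rewrite -scalemxAl pformZr; have [_ [_ ->]] := roots i; rewrite mulr0.
have aU (v : 'rV_m) : pform q' a (v *m E *m B) = 0.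
  rewrite (row_mulE E v) mulmx_suml pform_sumr big1 // => i _.
  by rewrite -scalemxAl pformZr; have [_ [-> _]] := roots i; rewrite mulr0.
have bE : b = a + X by rewrite /a subrK.
have XE : x0 *m B = X by [].
split; last first.
  move=> y My; rewrite fq // /qmap /umb_map /umb_factor e2 subrr !mul0r addr0 scalerA.
  by rewrite e2 scale1r scaler0 addr0 add0r addrC.
split=> //.
- apply: (frame_pisom fE metric) => [v|]; last by rewrite XX.
  by rewrite XU mulr0.
- clear key roots; clearbody a X.
  move=> u; have [k [v ->]] := frame_decomp u fE.
  rewrite pformZl bE mulmxDl -scalemxAl XE !pformDl !pformDr !pformZr aX XX XU aU.
  ring.
- clear key roots; clearbody a X; rewrite pformZl pformZr bE pform_sqrD aa aX XX; ring.
Qed.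

Theorem umbilical_structure : totally_umbilical eps m q q' M f ->
  exists b B c, umb_data q' b B c /\ forall y, M y -> f y = umb_map b B c y.
Proof.
move=> /umbilical_qmap [b [B [c [c0 fq]]]].
have [e0|e0] := eqVneq eps 0; first by exists b, B, (2 *: c); exact: flat_structure.
exists 0, B, (e *: b); apply: curved_structure => //.
by move: fq; rewrite c0.
Qed.

End Structure.

(** * The converse *)

Section TangentExpansion.
Context {R : realType}.
Variables (eps : int) (m N q : nat) (y : 'rV[R]_N) (w : 'M[R]_(m, N)).
Notation e := (eps%:~R : R).
Hypotheses (ce : curvature eps) (NE : N = (m + (eps != 0))%N)
  (yy : eps != 0 -> pform q y y = e)
  (wy : forall i, e * pform q (row i w) y = 0).
Let G : 'M[R]_m := \matrix_(i, j) pform q (row i w) (row j w).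

(** A tangent family is expressed in an orthonormal frame by a square matrix [P], so its Gram matrix
    is congruent to the diagonal matrix of signs. *)
Let frameP : exists eta E, [/\ frame_at eps q y eta E,
  (forall z, e * pform q z y = 0 -> exists v, z = v *m E) &
  exists P : 'M[R]_m, w = P *m E /\ G = P *m diag_mx (\row_i eta i) *m P^T].
Proof.
have [eta [E fE]] := exists_frame ce NE yy.
have tg z : e * pform q z y = 0 ->
    z = (\row_i (eta i * pform q z (row i E))) *m E.
  move=> zy; rewrite {1}(frame_span fE z) zy scale0r add0r mulmx_sum_row.
  by apply: eq_bigr => i _; rewrite mxE.
exists eta, E; split => //; first by move=> z /tg ->; eexists.
pose P : 'M[R]_m := \matrix_i (\row_k (eta k * pform q (row i w) (row k E))).
have wP : w = P *m E.
  by apply/row_matrixP => i; rewrite row_mul rowK; exact: tg.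
exists P; split => //; apply/matrixP => i j; rewrite mxE {1}wP row_mul.
rewrite (row_mulE E) pform_suml mul_mx_diag mxE; apply: eq_bigr => k _.
rewrite pformZl !mxE [pform q (row k E) _]pformC.
rewrite -[LHS]mulr1 -(frame_sign fE k).
by move: (pform q _ _) (pform q _ _) => a1 a2; ring.
Qed.

Lemma gram_unit : row_free w -> G \in unitmx.
Proof.
have [eta [E [fE _ [P [wP ->]]]]] := frameP.
rewrite !unitmx_mul unitmx_tr => fw.
have -> : P \in unitmx.
  rewrite -row_free_unit /row_free eqn_leq rank_leq_row /=.
  by move: fw; rewrite wP /row_free => /eqP {1}<-; exact: mxrankM_maxl.
suff /mulmx1_unit[-> _] : diag_mx (\row_i eta i) *m diag_mx (\row_i eta i) = 1%:M :> 'M[R]_m.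
  by [].
rewrite mulmx_diag; apply/matrixP => i j; rewrite !mxE.
by rewrite (frame_sign fE).
Qed.

(** The projection subtracted in [normal_part] reproduces tangent vectors. This serves both for the
    source of an immersion and for the target in codimension 0. *)
Lemma tangent_expansion z : G \in unitmx -> e * pform q z y = 0 ->
  z = \sum_i \sum_j (invmx G i j * pform q z (row i w)) *: row j w.
Proof.
have [eta [E [fE tg [P [wP GP]]]]] := frameP.
move=> uG /tg[v zv]; have uP : P \in unitmx.
  by move: uG; rewrite GP unitmx_mul unitmx_mul => /andP[/andP[]].
have [a za] : exists a, z = a *m w.
  by exists (v *m invmx P); rewrite wP mulmxA mulmxKV.
pose g : 'rV[R]_m := \row_i pform q z (row i w).
have ga : g = a *m G.
  apply/rowP => j; rewrite !mxE za mulmx_sum_row pform_suml.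
  by apply: eq_bigr => i _; rewrite pformZl mxE.
rewrite {1}za; have -> : a = g *m invmx G by rewrite ga mulmxK.
rewrite mulmx_sum_row exchange_big /=; apply: eq_bigr => j _.
rewrite mxE scaler_suml; apply: eq_bigr => i _; rewrite mxE.
by rewrite mulrC.
Qed.

End TangentExpansion.

(** * Maps in normal form are umbilical immersions *)

Section UmbilicalMaps.
Context {R : realType}.
Variables (eps : int) (m s : nat) (x0 : 'rV[R]_(amb_dim eps m)).
Notation q := (amb_idx eps s).
Notation M := (space_form eps m s x0).
Notation N := (amb_dim eps m).
Notation e := (eps%:~R : R).
Hypotheses (ce : curvature eps).

Section Parametrization.
Variables (V : set 'rV[R]_m) (psi : 'rV[R]_m -> 'rV[R]_N).
Hypothesis lp : local_param M V psi.
Let oV : open V. Proof. by case: lp. Qed.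

Lemma param_smooth : smooth V psi.
Proof. by case: lp => _ /smooth_onP. Qed.

Lemma param_in u : V u -> M (psi u).
Proof.
case: lp => oV' _ _ _ /(_ _ oV' (@subset_refl _ _)) [W _ imW] Vu.
by have : (M `&` W) (psi u); [rewrite -imW; exists u|case].
Qed.

Lemma param_norm u : V u -> e * pform q (psi u) (psi u) = e * e.
Proof.
move=> Vu; have [e0|e0] := eqVneq eps 0.
  by have -> : e = 0 by [rewrite e0]; rewrite !mul0r.
by rewrite (space_form_norm (param_in Vu) e0).
Qed.

Lemma param_perp u v : V u -> e * pform q ('D_v psi u) (psi u) = 0.
Proof.
move=> Vu; have pC := param_smooth.
have nE : {in V, (fun u => e * pform q (psi u) (psi u)) =1 cst (e * e)}.
  by move=> y; rewrite inE => Vy; rewrite param_norm.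
have := derive_ext oV v nE Vu.
rewrite derive_cst (derive_cmul oV v e (smooth_pform oV q pC pC) Vu).
rewrite (derive_pform oV q v pC pC Vu) (pformC _ (psi u)) -mulr2n mulrnAr.
by move=> /eqP; rewrite mulrn_eq0 => /eqP.
Qed.

Lemma param_perp2 u v w : V u -> e * pform q ('D_v ('D_w psi) u) (psi u) =
  - (e * pform q ('D_v psi u) ('D_w psi u)).
Proof.
move=> Vu; have pC := param_smooth; have wC := smooth_derive w pC.
have nE : {in V, (fun u => e * pform q ('D_w psi u) (psi u)) =1 cst 0}.
  by move=> y; rewrite inE => Vy; rewrite param_perp.
have := derive_ext oV v nE Vu.
rewrite derive_cst (derive_cmul oV v e (smooth_pform oV q wC pC) Vu).
rewrite (derive_pform oV q v wC pC Vu) (pformC q ('D_w psi u)) mulrDr.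
by move/eqP; rewrite addr_eq0 => /eqP.
Qed.

Let frame_mx u : 'M[R]_(m, N) := \matrix_i 'D_(delta_mx 0 i) psi u.

Let gramE u : gram q psi u = \matrix_(i, j) pform q (row i (frame_mx u)) (row j (frame_mx u)).
Proof. by apply/matrixP => i j; rewrite !mxE !rowK. Qed.

Let frame_perp u i : V u -> e * pform q (row i (frame_mx u)) (psi u) = 0.
Proof. by move=> Vu; rewrite rowK param_perp. Qed.

Let psi_norm u : V u -> eps != 0 -> pform q (psi u) (psi u) = e.
Proof. by move=> Vu; apply: space_form_norm; exact: param_in. Qed.

Lemma param_gram_unit u : V u -> gram q psi u \in unitmx.
Proof.
move=> Vu; rewrite gramE; apply: (@gram_unit R eps m N q (psi u)) => //.
- exact: psi_norm.
- by move=> i; exact: frame_perp.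
rewrite -kermx_eq0; apply/eqP/row_matrixP => i; rewrite row0.
have [_ _ /(_ u (row i (kermx (frame_mx u))) Vu) inj _ _] := lp.
apply: inj; rewrite (derive_linear _ param_smooth Vu).
have /sub_kermxP : (row i (kermx (frame_mx u)) <= kermx (frame_mx u))%MS by exact: row_sub.
rewrite mulmx_sum_row => h; rewrite -[RHS]h.
by apply: eq_bigr => j _; rewrite rowK.
Qed.

Lemma param_expansion u z : V u -> e * pform q z (psi u) = 0 ->
  z = \sum_i \sum_j (invmx (gram q psi u) i j * pform q z ('D_(delta_mx 0 i) psi u))
        *: 'D_(delta_mx 0 j) psi u.
Proof.
move=> Vu zy; have uG := param_gram_unit Vu; rewrite gramE in uG *.
rewrite {1}(@tangent_expansion R eps m N q (psi u) (frame_mx u) ce erefl _ _ z uG zy).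
- by apply: eq_bigr => i _; apply: eq_bigr => j _; rewrite !rowK.
- exact: psi_norm.
- by move=> i; exact: frame_perp.
Qed.

Variables (q' N' : nat) (f : 'rV[R]_N -> 'rV[R]_N').
Variables (b : 'rV[R]_N') (B : 'M[R]_(N, N')) (c : 'rV[R]_N').
Hypotheses (bBc : umb_data s q' b B c)
  (fE : forall y, M y -> f y = umb_map s b B c y).
Notation phi := (f \o psi).
Let k := 1 - e * e.

Let cB u : pform q' (u *m B) c = 0.
Proof. by rewrite pformC (umb_orth bBc). Qed.

Let eb : e *: b = 0.
Proof.
have [e0|e0] := eqVneq eps 0.
  by have -> : e = 0 by [rewrite e0]; rewrite scale0r.
by rewrite (umb_linear bBc) // scaler0.
Qed.

Let k0 : e * k = 0.
Proof. by rewrite /k mulrBr mulr1 mulrA curvature3 // subrr. Qed.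

Let phiE : {in V, phi =1 (fun u => b + psi u *m B + umb_factor s (psi u) *: c)}.
Proof. by move=> u; rewrite inE => Vu; rewrite /= fE //; exact: param_in. Qed.

Let factorC : smooth V (fun u => umb_factor s (psi u)).
Proof.
apply: (smoothD oV); first exact: (smooth_cst oV _).
apply: (smoothM oV); first exact: (smooth_cst oV _).
by apply: (smooth_pform oV); exact: param_smooth.
Qed.

Lemma smooth_umb_map : smooth V phi.
Proof.
apply: (smooth_ext oV (f := fun u => b + psi u *m B + umb_factor s (psi u) *: c)).
  by move=> u Vu; rewrite phiE.
apply: (smoothD oV); last first.
  by apply: (smooth_scale oV); [exact: factorC|exact: (smooth_cst oV _)].
apply: (smoothD oV); first exact: (smooth_cst oV _).
by apply: (smooth_mulmx oV); exact: param_smooth.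
Qed.

Let Dphi v : {in V, 'D_v phi =1 (fun u => 'D_v psi u *m B +
  (k * pform q ('D_v psi u) (psi u)) *: c)}.
Proof.
move=> u; rewrite inE => Vu; have pC := param_smooth.
apply: etrans (derive_ext oV v phiE Vu) _.
have bC := smooth_cst oV b; have sB := smooth_mulmx oV B pC.
have cC := smooth_cst oV c.
rewrite (derive_add v (smoothD oV bC sB) (smooth_scale oV factorC cC) Vu).
rewrite (derive_add v bC sB Vu) derive_cst add0r.
rewrite (derive_scale oV v factorC cC Vu) derive_cst scaler0 add0r.
rewrite (derive_mulmx oV B v pC Vu); congr (_ + _ *: _).
have ppC := smooth_pform oV q pC pC.
rewrite /umb_factor (derive_add v (smooth_cst oV e) (smoothM oV (smooth_cst oV _) ppC) Vu).
rewrite derive_cst add0r (derive_cmul oV v _ ppC Vu) (derive_pform oV q v pC pC Vu).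
by rewrite (pformC q (psi u)) /k; field.
Qed.

(** Components along [c] are invisible to the form on the image of [B] plus the line of [c], so the
    map is isometric however large [c] is. *)
Let pair_umb z z' a a' :
  pform q' (z *m B + a *: c) (z' *m B + a' *: c) = pform q z z'.
Proof.
rewrite !pformDl !pformDr !pformZl !pformZr (umb_pisom bBc) (umb_orth bBc).
by rewrite (umb_null bBc) cB !mulr0 !addr0.
Qed.

Lemma umb_map_metric u v w : V u ->
  pform q' ('D_v phi u) ('D_w phi u) = pform q ('D_v psi u) ('D_w psi u).
Proof. by move=> Vu; rewrite !Dphi ?inE //; exact: pair_umb. Qed.

(** The covariant derivative in the target is the image under the differential of the covariant
    derivative [zeta] in the source, plus [g *: c]; the normal part removes the former. *)
Lemma umb_map_second_form u v w : V u ->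
  second_form eps q q' f psi u v w = pform q ('D_v psi u) ('D_w psi u) *: c.
Proof.
move=> Vu; have pC := param_smooth; have wC := smooth_derive w pC.
set g := pform q ('D_v psi u) ('D_w psi u).
pose d2 := 'D_v ('D_w psi) u.
have D2 : 'D_v ('D_w phi) u = d2 *m B + (k * (pform q d2 (psi u) + g)) *: c.
  apply: etrans (derive_ext oV v (Dphi w) Vu) _.
  have wpC := smooth_pform oV q wC pC; have cC := smooth_cst oV c.
  have kC : smooth V (fun u => k * pform q ('D_w psi u) (psi u)).
    by apply: (smoothM oV) => //; exact: (smooth_cst oV _).
  rewrite (derive_add v (smooth_mulmx oV B wC) (smooth_scale oV kC cC) Vu).
  rewrite (derive_mulmx oV B v wC Vu) (derive_scale oV v kC cC Vu).
  rewrite derive_cst scaler0 add0r (derive_cmul oV v k wpC Vu).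
  by rewrite (derive_pform oV q v wC pC Vu) (pformC q ('D_w psi u)).
have ephi z : e * pform q' z (phi u) = e * pform q' z (psi u *m B) + e * e * pform q' z c.
  rewrite phiE ?inE // !pformDr pformZr !mulrDr -[X in X + _ + _]pformZr eb pform0r add0r.
  congr (_ + _); rewrite mulrA; congr (_ * _); rewrite /umb_factor -/k.
  by rewrite mulrDr !mulrA k0 !mul0r addr0.
(* The tangential projection of [d2] in the source, since [e * <d2, psi u> = - (e * g)] by
   [param_perp2]. *)
pose zeta := d2 + (e * g) *: psi u.
have h1 := param_perp2 v w Vu; rewrite -/d2 -/g in h1.
have h2 := param_norm Vu.
have kz : k * pform q zeta (psi u) = k * pform q d2 (psi u).
  rewrite /zeta pformDl pformZl; move: h2.
  move: (pform q (psi u) (psi u)) (pform q d2 (psi u)) => p1 p2 h2.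
  have -> : k * (p2 + e * g * p1) = k * p2 + g * (e * k) * p1 by ring.
  by rewrite k0 mulr0 mul0r addr0.
have hphi : (e * g) *: phi u = (e * g) *: (psi u *m B) + (e * e * g) *: c.
  rewrite phiE ?inE // !scalerDr [_ *: b](_ : _ = 0); last first.
    by rewrite mulrC -scalerA eb scaler0.
  rewrite add0r; congr (_ + _); rewrite scalerA; congr (_ *: _).
  rewrite /umb_factor -/k; move: (pform _ _ _) => p.
  have -> : e * g * (e + k / 2 * p) = e * e * g + g * (e * k) / 2 * p by field.
  by rewrite k0 mulr0 !mul0r addr0.
have hco : e * pform q' ('D_v ('D_w phi) u) (phi u) = - (e * g).
  rewrite ephi D2 -[psi u *m B]addr0 -(scale0r c) pair_umb h1.
  by rewrite pformDl pformZl (umb_null bBc) cB !(mulr0, addr0).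
have cov : cov_derive eps q' f psi u v w =
    zeta *m B + (k * pform q zeta (psi u) + g) *: c.
  rewrite -[LHS]/('D_v ('D_w phi) u -
    (e * pform q' ('D_v ('D_w phi) u) (phi u)) *: phi u).
  rewrite hco scaleNr opprK hphi D2 kz /zeta mulmxDl -scalemxAl addrACA.
  rewrite -scalerDl; congr (_ + _ *: _); rewrite /k; ring.
have ztan : e * pform q zeta (psi u) = 0.
  rewrite /zeta pformDl pformZl mulrDr h1.
  have -> : e * (e * g * pform q (psi u) (psi u)) =
    e * g * (e * pform q (psi u) (psi u)) by ring.
  rewrite h2; have h3 := curvature3 (R := R) ce.
  by rewrite (_ : e * g * (e * e) = g * (e * e * e)); [rewrite h3; ring|ring].
rewrite /second_form cov /normal_part.
have pair i : pform q' (zeta *m B + (k * pform q zeta (psi u) + g) *: c)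
    ('D_(delta_mx 0 i) phi u) = pform q zeta ('D_(delta_mx 0 i) psi u).
  by rewrite Dphi ?inE //; exact: pair_umb.
have ex := param_expansion Vu ztan.
rewrite [X in _ - X](_ : _ = zeta *m B + (k * pform q zeta (psi u)) *: c).
  by rewrite scalerDl addrA [_ + g *: c]addrC addrK.
(* [L] is the differential of the immersion on tangent vectors at [psi u]; being linear, it carries
   the expansion of [zeta] to the sum in [normal_part]. *)
pose L z := z *m B + (k * pform q z (psi u)) *: c.
have LD z1 z2 : L (z1 + z2) = L z1 + L z2.
  by rewrite /L mulmxDl pformDl mulrDr scalerDl addrACA.
have L0 : L 0 = 0 by rewrite /L mul0mx pform0l mulr0 scale0r addr0.
have LZ a z : L (a *: z) = a *: L z.
  by rewrite /L -scalemxAl pformZl mulrCA scalerDr scalerA.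
apply: etrans _ (esym (congr1 L ex)).
rewrite (big_morph L LD L0); apply: eq_bigr => i _.
rewrite (big_morph L LD L0); apply: eq_bigr => j _.
by rewrite LZ pair Dphi ?inE.
Qed.

Lemma umb_map_mean_curvature u : (0 < m)%N -> V u -> mean_curvature eps q q' f psi u = c.
Proof.
move=> m0 Vu; rewrite /mean_curvature.
under eq_bigr => i _ do under eq_bigr => j _ do rewrite umb_map_second_form // scalerA.
under eq_bigr => i _ do rewrite -scaler_suml; rewrite -scaler_suml scalerA.
suff -> : \sum_i \sum_j invmx (gram q psi u) i j *
    pform q ('D_(delta_mx 0 i) psi u) ('D_(delta_mx 0 j) psi u) = m%:R.
  by rewrite mulVf ?scale1r // pnatr_eq0 -lt0n.
transitivity (\tr (invmx (gram q psi u) *m gram q psi u)).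
  apply: eq_bigr => i _; rewrite mxE; apply: eq_bigr => j _.
  by rewrite mxE pformC.
by rewrite mulVmx ?mxtrace1 //; exact: param_gram_unit.
Qed.

End Parametrization.

Variables (q' N' : nat) (S' : set 'rV[R]_N') (f : 'rV[R]_N -> 'rV[R]_N').
Variables (b : 'rV[R]_N') (B : 'M[R]_(N, N')) (c : 'rV[R]_N').
Hypotheses (bBc : umb_data s q' b B c)
  (fE : forall y, M y -> f y = umb_map s b B c y).

Lemma umb_map_isometric : (forall y, M y -> S' (f y)) ->
  isometric_immersion m q q' M S' f.
Proof.
move=> fS; split; first split => // V psi lp.
  by apply/smooth_onP; exact: (smooth_umb_map lp fE).
by move=> V psi lp u v w Vu; exact: (umb_map_metric lp bBc fE).
Qed.

Lemma umb_map_umbilical : (0 < m)%N -> totally_umbilical eps m q q' M f.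
Proof.
move=> m0 V psi lp u v w Vu.
by rewrite (umb_map_second_form lp bBc fE) // (umb_map_mean_curvature lp bBc fE).
Qed.

Lemma umb_map_geodesic : (0 < m)%N -> M x0 ->
  totally_geodesic eps m q q' M f <-> c = 0.
Proof.
move=> m0 Mx; split=> [geo|c0 V psi lp u v w Vu]; last first.
  by rewrite (umb_map_second_form lp bBc fE) // c0 scaler0.
have [eta [E [r [frE r0 tr]]]] := exists_chart ce Mx.
have lp := stereo_local_param ce Mx frE tr.
have i0 : 'I_m by case: (m) m0 => // k _; exact: ord0.
have V0 : ball (0 : 'rV[R]_m) r 0 by exact: ballxx.
have := geo _ _ lp 0 (delta_mx 0 i0) (delta_mx 0 i0) V0.
rewrite (umb_map_second_form lp bBc fE) // => /eqP; rewrite scaler_eq0.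
have tV (u : 'rV[R]_m) : ball 0 r u -> tau eps q E u != 0.
  by move=> /tr; exact: lt0r_neq0.
rewrite (stereo_metric ce frE (ball_open _ _) tV) // -rowE (frame_orth frE) eqxx mulr1.
have e0 : eta i0 != 0.
  by apply: contra_eq_neq (frame_sign frE i0) => ->; rewrite mulr0 eq_sym oner_neq0.
by rewrite mulf_eq0 expf_eq0 invr_eq0 (negbTE (tV _ V0)) (negbTE e0) => /eqP.
Qed.

End UmbilicalMaps.

(** * Isometries of space forms *)

Section SpaceFormIsometries.
Context {R : realType}.
Variables (eps : int).
Notation e := (eps%:~R : R).
Hypotheses (ce : curvature eps).

Lemma umb_map_quadric m s n p b B c (y : 'rV[R]_(amb_dim eps m)) :
  umb_data s (amb_idx eps p) b B c -> quadric eps m s y ->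
  quadric eps n p (umb_map s b B c y).
Proof.
move=> bBc yQ e0; rewrite /umb_map (umb_linear bBc e0) add0r !pformX.
rewrite (umb_pisom bBc) (umb_null bBc) (umb_orth bBc) pformC (umb_orth bBc).
by rewrite !mulr0 !addr0; exact: yQ.
Qed.

Lemma smooth_umb_map_setT m s N' b (B : 'M[R]_(amb_dim eps m, N')) c :
  smooth setT (umb_map s b B c).
Proof.
have sid := smooth_id (@openT 'rV[R]_(amb_dim eps m)).
apply: (smoothD openT).
  by apply: (smoothD openT (smooth_cst openT _)); exact: (smooth_mulmx openT).
apply: (smooth_scale openT) (smooth_cst openT _).
apply: (smoothD openT (smooth_cst openT _)).
apply: (smoothM openT (smooth_cst openT _)).
exact: (smooth_pform openT).
Qed.

(** The image of a connected set stays in one component of the target quadric, so a single point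
    decides on which sheet it lies. *)
Lemma umb_map_form m s n p b B c (x0 : 'rV[R]_(amb_dim eps m))
    (y0 : 'rV[R]_(amb_dim eps n)) x1 :
  umb_data s (amb_idx eps p) b B c -> space_form eps m s x0 x1 ->
  space_form eps n p y0 (umb_map s b B c x1) ->
  forall x, space_form eps m s x0 x -> space_form eps n p y0 (umb_map s b B c x).
Proof.
move=> bBc Mx1 M'x1 x Mx.
have := @connected_component_max _ (quadric eps n p)
  (umb_map s b B c @` space_form eps m s x0) (umb_map s b B c x1).
rewrite /space_form -(same_connected_component M'x1); apply.
- by exists x1.
- move=> _ [z Mz <-]; apply: (umb_map_quadric bBc).
  exact: connected_component_sub Mz.
- apply: connected_continuous_connected; first exact: component_connected.
  apply: continuous_subspaceT => z.
  exact: (smooth_continuous (smooth_umb_map_setT _ _ _ _)).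
- by exists x.
Qed.

Section Isometries.
Variables (n p : nat) (y0 : 'rV[R]_(amb_dim eps n)).
Notation q := (amb_idx eps p).
Notation M := (space_form eps n p y0).
Notation N := (amb_dim eps n).
Hypotheses (n2 : (2 <= n)%N) (y0Q : quadric eps n p y0).

(** The partial derivatives of [F] fill the tangent space of the target, so the covariant
    derivative, being tangent, is reproduced by [tangent_expansion] and has no normal part. *)
Lemma codim0_second_form F : isometric_immersion n q q M M F ->
  forall (V : set 'rV[R]_n) psi, local_param M V psi ->
  forall x v w, V x -> second_form eps q q F psi x v w = 0.
Proof.
move=> [[FM FC] Fiso] V psi lp u v w Vu.
have oV : open V by case: lp.
have pC : smooth V (F \o psi) by apply/smooth_onP; exact: FC.
have FpM z : V z -> M (F (psi z)) by move=> Vz; apply: FM; exact: (param_in lp Vz).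
have norm z : V z -> e * pform q (F (psi z)) (F (psi z)) = e * e.
  move=> Vz; have [e0|e0] := eqVneq eps 0.
    by have -> : e = 0 by [rewrite e0]; rewrite !mul0r.
  by rewrite (space_form_norm (FpM z Vz) e0).
have perp d : e * pform q ('D_d (F \o psi) u) (F (psi u)) = 0.
  have nE : {in V, (fun u => e * pform q ((F \o psi) u) ((F \o psi) u)) =1 cst (e * e)}.
    by move=> z; rewrite inE => Vz; exact: norm.
  have := derive_ext oV d nE Vu.
  rewrite derive_cst (derive_cmul oV d e (smooth_pform oV q pC pC) Vu).
  rewrite (derive_pform oV q d pC pC Vu) (pformC _ ((F \o psi) u)) -mulr2n mulrnAr.
  by move=> /eqP; rewrite mulrn_eq0 => /eqP.
pose W : 'M[R]_(n, N) := \matrix_i 'D_(delta_mx 0 i) (F \o psi) u.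
have GE : gram q psi u = \matrix_(i, j) pform q (row i W) (row j W).
  by apply/matrixP => i j; rewrite !mxE !rowK (Fiso _ _ lp).
have uG := param_gram_unit ce lp Vu; rewrite GE in uG.
rewrite /second_form; set z := cov_derive _ _ _ _ _ _ _.
have zt : e * pform q z (F (psi u)) = 0.
  rewrite /z /cov_derive /tangent_proj; set xi := 'D_v _ _; set y := F (psi u).
  have yy : e * pform q y y = e * e by exact: norm.
  rewrite pformDl pformNl pformZl mulrBr.
  rewrite (_ : e * (e * pform q xi y * pform q y y) =
    pform q xi y * e * (e * pform q y y)); last by ring.
  have e3 := curvature3 (R := R) ce.
  by rewrite yy (_ : _ * _ * (_ * _) = pform q xi y * (e * e * e)); [rewrite e3; ring|ring].
rewrite /normal_part GE.
have yN : eps != 0 -> pform q (F (psi u)) (F (psi u)) = e.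
  exact: (space_form_norm (FpM u Vu)).
have rP i : e * pform q (row i W) (F (psi u)) = 0 by rewrite rowK perp.
rewrite {1}(tangent_expansion ce erefl yN rP uG zt).
apply/eqP; rewrite subr_eq0; apply/eqP.
by apply: eq_bigr => i _; apply: eq_bigr => j _; rewrite !rowK.
Qed.

(** An isometry is totally geodesic, hence umbilical with zero mean curvature, and the structure
    theorem applies; [c] vanishes because it is orthogonal to the image of the invertible matrix
    [B]. *)
Lemma isometry_linear F : Defs.isometry n q M F -> exists b B,
  umb_data p q b B 0 /\ forall y, M y -> F y = umb_map p b B 0 y.
Proof.
move=> [FI _]; have sf := codim0_second_form FI.
have Mn y : M y -> eps != 0 -> pform q y y = e by exact: space_form_norm.
have umb : totally_umbilical eps n q q M F.
  move=> V psi lp u v w Vu; rewrite (sf _ _ lp) //.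
  rewrite /mean_curvature big1 ?scaler0 // => i _; rewrite big1 // => j _.
  by rewrite (sf _ _ lp) // scaler0.
have [b [B [c [bBc FE]]]] := umbilical_structure ce n2 y0Q Mn FI umb.
have c0 : c = 0.
  apply: (@pform_nondeg R q) => z; have uB := pisom_unit (umb_pisom bBc).
  by rewrite -(mulmxKV uB z) (umb_orth bBc).
by exists b, B; rewrite -c0.
Qed.

Lemma linear_isometry b B y1 F : umb_data p q b B 0 ->
  (forall y, M y -> F y = umb_map p b B 0 y) -> M y1 -> M (F y1) ->
  Defs.isometry n q M F.
Proof.
move=> bB FE My1 MFy1.
have FM y : M y -> M (F y).
  move=> My; rewrite FE //; apply: (umb_map_form bB My1) => //.
  by rewrite -FE.
split; first exact: (umb_map_isometric bB FE FM).
have uB := pisom_unit (umb_pisom bB).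
have bB' : umb_data p q (- b *m invmx B) (invmx B) 0.
  split; first exact: pisomV (umb_pisom bB).
  - by move=> u; rewrite pform0l.
  - by rewrite pform0l.
  - by move=> e0; rewrite (umb_linear bB e0) oppr0 mul0mx.
have K y : umb_map p (- b *m invmx B) (invmx B) 0 (umb_map p b B 0 y) = y.
  rewrite /umb_map !scaler0 !addr0 mulmxDl mulmxK // mulNmx addrA addNr.
  exact: add0r.
have K' y : umb_map p b B 0 (umb_map p (- b *m invmx B) (invmx B) 0 y) = y.
  by rewrite /umb_map !scaler0 !addr0 mulmxDl !mulmxKV // addrA addrN add0r.
have GM y : M y -> M (umb_map p (- b *m invmx B) (invmx B) 0 y).
  by apply: (umb_map_form bB' MFy1); rewrite FE // K.
exists (umb_map p (- b *m invmx B) (invmx B) 0).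
  have [sm _] := @umb_map_isometric R eps n p y0 q N M _ _ _ _ bB' (fun _ _ => erefl) GM.
  exact: sm.
by move=> y My; rewrite FE // K FE ?K' //; exact: GM.
Qed.

End Isometries.

End SpaceFormIsometries.

(** * Congruence classes *)

Section IsometryGroup.
Context {R : realType}.
Variables (eps : int) (n p : nat) (y0 : 'rV[R]_(amb_dim eps n)).
Notation q := (amb_idx eps p).
Notation M := (space_form eps n p y0).
Hypotheses (ce : curvature eps) (n2 : (2 <= n)%N) (y0Q : quadric eps n p y0).

Lemma isometry_form F y : Defs.isometry n q M F -> M y -> M (F y).
Proof. by move=> [[[FM _] _] _]; exact: FM. Qed.

Lemma isometry_id : Defs.isometry n q M id.
Proof.
have My0 := form_base y0Q.
apply: (linear_isometry (b := 0) (B := 1%:M) (y1 := y0)) => //.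
  split; [exact: pisom1| | |by []].
    by move=> u; rewrite pform0l.
  by rewrite pform0l.
by move=> y _; rewrite /umb_map add0r scaler0 addr0 mulmx1.
Qed.

Lemma isometry_comp F G : Defs.isometry n q M F -> Defs.isometry n q M G ->
  Defs.isometry n q M (G \o F).
Proof.
move=> FI GI; have My0 := form_base y0Q; have FM := isometry_form FI My0.
have [b [B [bB FE]]] := isometry_linear ce n2 y0Q FI.
have [b' [B' [bB' GE]]] := isometry_linear ce n2 y0Q GI.
apply: (linear_isometry (b := b' + b *m B') (B := B *m B') (y1 := y0)) => //.
- split; first exact: pisomM (umb_pisom bB) (umb_pisom bB').
  + by move=> u; rewrite pform0l.
  + by rewrite pform0l.
  + by move=> e0; rewrite (umb_linear bB e0) (umb_linear bB' e0) mul0mx addr0.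
- move=> y My; rewrite /= GE; last exact: isometry_form FI My.
  by rewrite FE // /umb_map !scaler0 !addr0 mulmxDl mulmxA addrA.
- exact: isometry_form GI FM.
Qed.

(** The definition of an isometry only provides a smooth inverse; on [M] it coincides with the
    inverse affine map, which is isometric. *)
Lemma isometry_inv F : Defs.isometry n q M F ->
  exists2 G, Defs.isometry n q M G & forall y, M y -> G (F y) = y.
Proof.
move=> FI; have [_ [G [GM _] FG]] := FI; have My0 := form_base y0Q.
have [b [B [bB FE]]] := isometry_linear ce n2 y0Q FI.
have uB := pisom_unit (umb_pisom bB).
exists G; last by move=> y /FG[].
apply: (linear_isometry (b := - b *m invmx B) (B := invmx B) (y1 := y0)) => //.
- split; first exact: pisomV (umb_pisom bB).
  + by move=> u; rewrite pform0l.
  + by rewrite pform0l.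
  + by move=> e0; rewrite (umb_linear bB e0) oppr0 mul0mx.
- move=> y My; have [_] := FG y My; rewrite FE; last exact: GM.
  rewrite /umb_map !scaler0 !addr0 => /esym E.
  by rewrite [in RHS]E mulmxDl mulmxK // mulNmx addKr.
- exact: GM.
Qed.

End IsometryGroup.

(** * Classification of umbilical immersions up to congruence *)

Section ModuliClasses.
Context {R : realType}.
Variables (eps : int) (m s n p : nat).
Variables (x0 : 'rV[R]_(amb_dim eps m)) (y0 : 'rV[R]_(amb_dim eps n)).
Notation q := (amb_idx eps s).
Notation q' := (amb_idx eps p).
Notation N := (amb_dim eps m).
Notation N' := (amb_dim eps n).
Notation M := (space_form eps m s x0).
Notation M' := (space_form eps n p y0).
Notation imm := (sf_imm eps m s n p x0 y0).
Hypotheses (ce : curvature eps) (m2 : (2 <= m)%N) (n2 : (2 <= n)%N).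
Hypotheses (x0Q : quadric eps m s x0) (y0Q : quadric eps n p y0).
Implicit Types f : imm.

Definition imm_data f b B c :=
  umb_data s q' b B c /\ forall y, M y -> f y = umb_map s b B c y.

Let m0 : (0 < m)%N. Proof. exact: leq_trans m2. Qed.

Lemma imm_form f x : M x -> M' (f x).
Proof. by case: (imm_isometric f) => -[fM _] _; exact: fM. Qed.

Lemma umbilical_data f : sf_umbilical f -> exists b B c, imm_data f b B c.
Proof.
apply: (umbilical_structure ce m2 x0Q _ (imm_isometric f)) => y.
exact: space_form_norm.
Qed.

Lemma data_umbilical f b B c : imm_data f b B c -> sf_umbilical f.
Proof. by move=> [bBc fE]; exact: (umb_map_umbilical ce bBc fE). Qed.

Lemma data_geodesic f b B c : imm_data f b B c -> sf_geodesic f <-> c = 0.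
Proof.
by move=> [bBc fE]; apply: (umb_map_geodesic ce bBc fE) => //; exact: form_base.
Qed.

Definition form_ext (g : 'rV[R]_N -> 'rV[R]_N') y := if `[< M y >] then g y else 0.

Lemma form_extE g y : M y -> form_ext g y = g y.
Proof. by move=> My; rewrite /form_ext asboolT. Qed.

Lemma form_ext_off g y : ~ M y -> form_ext g y = 0.
Proof. by move=> My; rewrite /form_ext asboolF. Qed.

Lemma form_ext_isometric b B c : umb_data s q' b B c -> M' (umb_map s b B c x0) ->
  isometric_immersion m q q' M M' (form_ext (umb_map s b B c)).
Proof.
move=> bBc M'x0; apply: (umb_map_isometric bBc) => [|y My]; first exact: form_extE.
by rewrite form_extE //; exact: (umb_map_form bBc (form_base x0Q) M'x0).
Qed.

Definition umb_imm b B c (bBc : umb_data s q' b B c) (M'x0 : M' (umb_map s b B c x0)) : imm :=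
  @IsoImm R m n q q' N N' M M' _ (form_ext_isometric bBc M'x0) (@form_ext_off _).

Lemma umb_imm_data b B c (bBc : umb_data s q' b B c) (M'x0 : M' (umb_map s b B c x0)) :
  imm_data (umb_imm bBc M'x0) b B c.
Proof. by split => // y My; exact: form_extE. Qed.

Lemma congruent_data f1 f2 b B c F : Defs.isometry n q' M' F -> imm_data f1 b B c ->
  (forall x, M x -> f2 x = F (f1 x)) ->
  exists b' B' c', imm_data f2 b' B' c' /\ (c' = 0 <-> c = 0).
Proof.
move=> FI [bBc f1E] f2E; have [d [T [dT FE]]] := isometry_linear ce n2 y0Q FI.
have hT := umb_pisom dT.
exists (d + b *m T), (B *m T), (c *m T); split; last first.
  by split=> [/(pisom_inj hT)|->]; rewrite ?mul0mx.
split; first split.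
- exact: pisomM (umb_pisom bBc) hT.
- by move=> u; rewrite mulmxA hT (umb_orth bBc).
- by rewrite hT (umb_null bBc).
- by move=> e0; rewrite (umb_linear bBc e0) (umb_linear dT e0) mul0mx addr0.
move=> x Mx; rewrite f2E // FE; last exact: imm_form.
rewrite f1E // /umb_map scaler0 addr0 !mulmxDl -scalemxAl mulmxA.
by rewrite !addrA.
Qed.

(** [witt_pisom] matches the linear parts and the mean curvature vectors, and a translation matches
    the constant terms. The resulting map keeps the sheet because it sends [f1 x0] to [f2 x0]. *)
Lemma data_congruent f1 f2 b1 B1 c1 b2 B2 c2 :
  imm_data f1 b1 B1 c1 -> imm_data f2 b2 B2 c2 -> (c1 == 0) = (c2 == 0) ->
  exists2 F, Defs.isometry n q' M' F & forall x, M x -> f2 x = F (f1 x).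
Proof.
move=> [d1 f1E] [d2 f2E] c12; have Mx0 := form_base x0Q.
have [T [hT BT cT]] := witt_pisom (umb_pisom d1) (umb_pisom d2) (umb_orth d1)
  (umb_orth d2) (umb_null d1) (umb_null d2) c12.
pose F := umb_map p (b2 - b1 *m T) T 0.
have FE x : M x -> f2 x = F (f1 x).
  move=> Mx; rewrite f1E // f2E // /F /umb_map scaler0 addr0 !mulmxDl -scalemxAl.
  by rewrite cT -mulmxA BT !addrA subrK.
exists F => //; apply: (linear_isometry (b := b2 - b1 *m T) (B := T)
  (y1 := f1 x0)) => //.
- split => // [u||]; rewrite ?pform0l //.
  by move=> e0; rewrite (umb_linear d1 e0) (umb_linear d2 e0) mul0mx subr0.
- exact: imm_form.
- by rewrite -FE //; exact: imm_form.
Qed.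

Lemma moduli_classP f1 f2 : moduli_class f1 = moduli_class f2 <->
  exists2 F, Defs.isometry n q' M' F & forall x, M x -> f2 x = F (f1 x).
Proof.
split=> [/(congr1 (@orbit_set _ _ _ _ _ _ _ _ _)) /= cc|[F FI FE]].
  have : congruence_class f2 f2 by exists id => //; exact: isometry_id.
  by rewrite -cc.
have cc : congruence_class f1 = congruence_class f2.
  apply/seteqP; split=> f [G GI GE].
    have [F' F'I F'F] := isometry_inv ce n2 y0Q FI.
    exists (G \o F'); first exact: (isometry_comp ce n2 y0Q F'I GI).
    by move=> x Mx; rewrite GE // FE //= F'F //; exact: imm_form.
  exists (G \o F); first exact: (isometry_comp ce n2 y0Q FI GI).
  by move=> x Mx; rewrite GE // FE.
rewrite /moduli_class /orbit_pi; move: (ex_intro _ f1 _) (ex_intro _ f2 _).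
by rewrite cc => e1 e2; congr Orbit; exact: Prop_irrelevance.
Qed.

Lemma moduli_class_geodesic f1 f2 : sf_umbilical f1 -> sf_umbilical f2 ->
  moduli_class f1 = moduli_class f2 <-> (sf_geodesic f1 <-> sf_geodesic f2).
Proof.
move=> /umbilical_data[b1 [B1 [c1 d1]]] /umbilical_data[b2 [B2 [c2 d2]]].
rewrite (data_geodesic d1) (data_geodesic d2).
split=> [/moduli_classP[F FI FE]|c12].
  have [b [B [c [d c0]]]] := congruent_data FI d1 FE.
  by rewrite -c0 -(data_geodesic d) (data_geodesic d2).
apply/moduli_classP; apply: (data_congruent d1 d2).
by apply/eqP/eqP => /c12.
Qed.

End ModuliClasses.

(** * Topology of the moduli space *)

Section Existence.
Context {R : realType}.
Variables (eps : int) (m s n p : nat).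
Variables (x0 : 'rV[R]_(amb_dim eps m)) (y0 : 'rV[R]_(amb_dim eps n)).
Notation q := (amb_idx eps s).
Notation q' := (amb_idx eps p).
Notation N := (amb_dim eps m).
Notation N' := (amb_dim eps n).
Notation M := (space_form eps m s x0).
Notation M' := (space_form eps n p y0).
Notation e := (eps%:~R : R).
Hypotheses (ce : curvature eps) (x0Q : quadric eps m s x0) (y0Q : quadric eps n p y0).
Hypotheses (qq' : (q <= q')%N) (qN : (q <= N)%N) (NN' : (N + q' <= N' + q)%N).

(** The standard inclusion is corrected by a translation in the flat case, and by an isometry moving
    the image of [x0] to [y0] in the curved case. Hitting [y0] ensures that the image is on the
    chosen sheet. *)
Lemma exists_linear_data : exists b B,
  umb_data s q' b B 0 /\ umb_map s b B 0 x0 = y0.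
Proof.
have iso0 := @std_incl_pisom R _ _ _ _ qq' qN NN'.
have [e0|e0] := eqVneq eps 0.
  exists (y0 - x0 *m std_incl qq' qN NN'), (std_incl qq' qN NN').
  split; last by rewrite /umb_map scaler0 addr0 subrK.
  by split => // [u||]; rewrite ?pform0l // => /negP[]; rewrite e0.
have xx := quadric_norm x0Q e0; have yy := quadric_norm y0Q e0.
have [||T [hT xT _]] := @pisom_swap R q' N' (x0 *m std_incl qq' qN NN') y0.
- by rewrite iso0 xx yy.
- by rewrite yy intr_eq0.
exists 0, (std_incl qq' qN NN' *m T); split.
  by split => // [|u|]; rewrite ?pform0l //; exact: pisomM iso0 hT.
by rewrite /umb_map scaler0 addr0 add0r mulmxA xT.
Qed.

(** By Witt's theorem every isometric [B] is equivalent to the standard inclusion, so the question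
    about its orthogonal complement can be settled on coordinates; [exists_null_orth] uses the same
    transport in the other direction. *)
Lemma definite_data (b : 'rV[R]_N') (B : 'M[R]_(N, N')) c : q' = q \/ (N + q' = N' + q)%N ->
  umb_data s q' b B c -> c = 0.
Proof.
move=> def d; have iso0 := @std_incl_pisom R _ _ _ _ qq' qN NN'.
have z (B' : 'M[R]_(N, N')) u : pform q' 0 (u *m B') = 0 by rewrite pform0l.
have [T [hT BT _]] := witt_pisom (umb_pisom d) iso0 (z _) (z _)
  (pform0l _ _) (pform0l _ _) erefl.
apply: (pisom_inj hT); apply: (std_incl_definite (qq' := qq') (qN := qN) (NN' := NN') def).
  by move=> u; rewrite -BT mulmxA hT (umb_orth d).
by rewrite hT (umb_null d).
Qed.

Lemma exists_null_orth (B : 'M[R]_(N, N')) : (q < q')%N -> (N + q' < N' + q)%N ->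
  pisom q q' B -> exists c, [/\ forall u, pform q' c (u *m B) = 0,
    pform q' c c = 0 & c != 0].
Proof.
move=> ltq ltN iB; have iso0 := @std_incl_pisom R _ _ _ _ qq' qN NN'.
have z (B' : 'M[R]_(N, N')) u : pform q' 0 (u *m B') = 0 by rewrite pform0l.
have [T [hT BT _]] := witt_pisom iso0 iB (z _) (z _)
  (pform0l _ _) (pform0l _ _) erefl.
have [c [cB cc c0]] := @std_incl_null R _ _ _ _ qq' qN NN' ltq ltN.
exists (c *m T); split.
- by move=> u; rewrite -BT mulmxA hT cB.
- by rewrite hT.
- by apply: contra_neq c0 => /(pisom_inj hT).
Qed.

Lemma umb_data_scale (b : 'rV[R]_N') (B : 'M[R]_(N, N')) c (t : R) :
  umb_data s q' b B c -> umb_data s q' b B (t *: c).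
Proof.
move=> d; split; [exact: umb_pisom d| | |exact: umb_linear d].
  by move=> u; rewrite pformZl (umb_orth d) mulr0.
by rewrite pformZl pformZr (umb_null d) !mulr0.
Qed.

(** Scaling [c] down to 0 gives a path in the target quadric from [y0], so the image of [x0] never
    leaves the sheet. *)
Lemma umb_map_scale_form (b : 'rV[R]_N') (B : 'M[R]_(N, N')) c (t : R) : umb_data s q' b B c ->
  umb_map s b B 0 x0 = y0 -> M' (umb_map s b B (t *: c) x0).
Proof.
move=> d E0; have := @path_component R _ (quadric eps n p)
  (fun r => umb_map s b B ((r * t) *: c) x0).
rewrite mul0r scale0r mul1r E0; apply=> [r _|r _]; last first.
  by apply: umb_map_quadric => //; exact: umb_data_scale.
rewrite (_ : (fun r => _) = (fun r : R => b + x0 *m B + r *: ((umb_factor s x0 * t) *: c))).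
  by apply: cvgD; [exact: cvg_cst|exact: scalel_continuous].
by apply/funext => z; rewrite /umb_map !scalerA; congr (_ + _ *: _); ring.
Qed.

End Existence.

(** * Continuity in the compact-open smooth topology *)

Section ImmersionTopology.
Context {R : realType} {m n q q' N N' : nat}.
Context {S : set 'rV[R]_N} {S' : set 'rV[R]_N'}.
Notation imm := (iso_imm m n q q' S S').

Lemma cinfty_cvg (F : set_system imm) (f : imm) : Filter F ->
  (forall A, cinfty_subbase A -> A f -> F A) -> F --> f.
Proof.
move=> FF sF A; rewrite nbhsE => -[_ [[C CB <-] [D CD Df]] sUA].
rewrite nbhs_filterE; apply: filterS sUA _; apply: (@filterS _ _ _ D).
  by move=> g Dg; exists D.
have /CB [I sI IE] := CD; rewrite -IE; apply: filter_bigI => E EI.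
have /sI /set_mem sE := EI; apply: (sF E sE).
by move: Df; rewrite -IE => /(_ _ EI).
Qed.

Lemma subbase_open (A : set imm) : cinfty_subbase A -> open A.
Proof.
move=> sA; exists [set A]; last first.
  by apply/seteqP; split=> [f [_ ->]|f Af] //; exists A.
move=> _ ->; exists [fset A]%fset.
  by move=> B /fset1P ->; exact: mem_set sA.
apply/seteqP; split=> [f /(_ A)|f Af B]; first by apply; exact: fset11.
by move=> /fset1P ->.
Qed.

(** Uses the subbasic sets with a one-point compact set and an empty list of derivatives. *)
Lemma eval_param_continuous (V : set 'rV[R]_m) psi u : local_param S V psi -> V u ->
  continuous (fun f : imm => f (psi u)).
Proof.
move=> lp Vu f; have FF : Filter (nbhs f) by exact: nbhs_filter.
apply/(cvgrPdist_lt (FF := FF)) => d d0.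
have : nbhs f [set f' : imm | forall x, [set u] x ->
    `|iter_derive [::] (f' \o psi) x - iter_derive [::] (f \o psi) x| < d].
  apply: open_nbhs_nbhs; split; last by move=> _ ->; rewrite /= subrr normr0.
  apply: subbase_open; exists f, V, [set u], psi, [::], d; split => //.
  - exact: compact_set1.
  - by move=> _ ->.
by apply: filterS => g /= /(_ u erefl); rewrite distrC.
Qed.

Lemma iter_derive_smooth (k : nat) (V : set 'rV[R]_m) (f : 'rV[R]_m -> 'rV[R]_k) a :
  smooth V f -> smooth V (iter_derive a f).
Proof. by move=> fC; elim: a => //= v a IH; exact: smooth_derive. Qed.

Lemma iter_derive_ext (k : nat) (V : set 'rV[R]_m) (f g : 'rV[R]_m -> 'rV[R]_k) a :
  open V -> {in V, f =1 g} -> {in V, iter_derive a f =1 iter_derive a g}.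
Proof.
move=> oV fg; elim: a => [|v a IH]; first exact: fg.
move=> u /set_mem Vu; exact: (derive_ext oV v IH Vu).
Qed.

Lemma iter_derive_line (k : nat) (V : set 'rV[R]_m) (f g : 'rV[R]_m -> 'rV[R]_k) a (t : R) :
  open V -> smooth V f -> smooth V g ->
  {in V, iter_derive a (fun u => f u + t *: g u) =1
    (fun u => iter_derive a f u + t *: iter_derive a g u)}.
Proof.
move=> oV fC gC; elim: a => [|v a IH] u /set_mem Vu //.
apply: etrans (derive_ext oV v IH Vu) _.
have fa := iter_derive_smooth a fC; have ga := iter_derive_smooth a gC.
have tC := smooth_cst oV t.
rewrite (derive_add v fa (smooth_scale oV tC ga) Vu).
by rewrite (derive_scale oV v tC ga Vu) derive_cst scale0r addr0.
Qed.

(** Every iterated derivative of [gam t] is affine in [t], so each subbasic condition concerns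
    [D + t *: W] on a compact set. Locally [W] is bounded and [D] keeps a margin; compactness makes
    the choice of [t] uniform. *)
Lemma imm_line_cvg (gam : R -> imm) (g : 'rV[R]_N -> 'rV[R]_N') :
  (forall (V : set 'rV[R]_m) psi, local_param S V psi -> smooth V (g \o psi)) ->
  (forall t x, S x -> gam t x = gam 0 x + t *: g x) ->
  gam t @[t --> 0] --> gam 0.
Proof.
move=> gC gamE; have FF : Filter (gam t @[t --> 0]) by apply: fmap_filter.
apply: (cinfty_cvg FF) => _ [f [V [K [psi [a [d [lp cK KV d0 ->]]]]]]] /= H.
have oV : open V by case: lp.
have pS u : V u -> S (psi u).
  case: lp => oV' _ _ _ /(_ _ oV' (@subset_refl _ _)) [W _ imW] Vu.
  by have : (S `&` W) (psi u); [rewrite -imW; exists u|case].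
have sm (h : imm) : smooth V (h \o psi).
  by apply/smooth_onP; have [[_ hC] _] := imm_isometric h; exact: hC.
have gpC := gC _ _ lp.
have lineE t : {in V, iter_derive a (gam t \o psi) =1 (fun u =>
    iter_derive a (gam 0 \o psi) u + t *: iter_derive a (g \o psi) u)}.
  move=> u Vu; rewrite -(iter_derive_line a t oV (sm (gam 0)) gpC) //.
  apply: (iter_derive_ext a oV _ Vu) => z /set_mem Vz.
  by rewrite /= gamE //; exact: pS.
(* The centre [f] of the subbasic set need not be [gam 0], so the deviation at [t = 0] is not zero,
   only smaller than [d]. *)
pose D u := iter_derive a (gam 0 \o psi) u - iter_derive a (f \o psi) u.
pose W u := iter_derive a (g \o psi) u.
suff : \forall t \near 0, K `<=` [set u | `|D u + t *: W u| < d].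
  move=> h; apply: (@filterS _ (nbhs (0 : R)) _ _ _ _ h) => t Kt u Ku; have := Kt u Ku.
  by rewrite /= lineE; [rewrite /D /W addrAC|apply: mem_set; exact: KV].
have nc := (compact_near_coveringP K).1 cK.
apply: (nc R (nbhs (0 : R)) (fun t u => `|D u + t *: W u| < d)) => u Ku.
have Vu := KV _ Ku.
have Dc : {for u, continuous D}.
  have c1 := smooth_continuous (iter_derive_smooth a (sm (gam 0))) Vu.
  have c2 := smooth_continuous (iter_derive_smooth a (sm f)) Vu.
  exact: (cvgB c1 c2).
have Wc : {for u, continuous W}.
  exact: (smooth_continuous (iter_derive_smooth a gpC) Vu).
have Du : `|D u| < d by exact: H.
(* One half of the margin at [u] absorbs the variation of [D] nearby, the other half the term
   [t *: W]. *)
pose r := (d - `|D u|) / 2.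
have r0 : 0 < r by rewrite divr_gt0 // subr_gt0.
near=> u' t.
have hD : `|D u - D u'| < r by near: u'; exact: (cvgrPdist_lt _ _).1 Dc r r0.
have hW : `|W u - W u'| < 1 by near: u'; exact: (cvgrPdist_lt _ _).1 Wc 1 ltr01.
have ht : `|t| < r / (`|W u| + 1).
  near: t; apply/nbhs_ballP; exists (r / (`|W u| + 1)) => /=.
    by rewrite divr_gt0 // ltr_wpDl.
  by move=> z; rewrite -ball_normE /= sub0r normrN.
have W1 : 0 < `|W u| + 1 by rewrite ltr_wpDl.
have hW' : `|W u'| <= `|W u| + 1.
  rewrite -[W u'](subKr (W u)) (le_trans (ler_normB _ _)) // lerD2l ltW //.
have hD' : `|D u'| <= `|D u| + `|D u - D u'|.
  by rewrite -{1}[D u'](subKr (D u)) ler_normB.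
rewrite (le_lt_trans (ler_normD _ _)) // normrZ.
have : `|t| * `|W u'| <= r.
  rewrite ltr_pdivlMr // in ht; rewrite (le_trans _ (ltW ht)) //.
  exact: ler_wpM2l.
rewrite /r in hD *; lra.
Unshelve. all: by end_near. Qed.

End ImmersionTopology.

(** * A pointwise closed condition for totally geodesic maps *)

Section GeodesicClosed.
Context {R : realType}.
Variables (eps : int) (m s n p : nat).
Variables (x0 : 'rV[R]_(amb_dim eps m)) (y0 : 'rV[R]_(amb_dim eps n)).
Notation q := (amb_idx eps s).
Notation q' := (amb_idx eps p).
Notation N := (amb_dim eps m).
Notation N' := (amb_dim eps n).
Notation M := (space_form eps m s x0).
Notation M' := (space_form eps n p y0).
Notation e := (eps%:~R : R).
Notation imm := (sf_imm eps m s n p x0 y0).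
Hypotheses (ce : curvature eps) (m2 : (2 <= m)%N) (x0Q : quadric eps m s x0).

(** As [tau] is even, the points of the chart with opposite coordinates along an axis differ by a
    multiple of the frame vector. The frame is thus expressed by points of [M], and values of an
    immersion can replace its derivatives. *)
Lemma secant_frame : exists eta E (zp zm : 'I_m -> 'rV[R]_N) (mu : 'I_m -> R),
  [/\ frame_at eps q x0 eta E, forall i, M (zp i), forall i, M (zm i) &
      forall i, row i E = mu i *: (zp i - zm i)].
Proof.
have Mx0 := form_base x0Q.
have [eta [E [r [fE r0 tr]]]] := exists_chart ce Mx0.
have small i : exists d : R, [/\ 0 < d, ball (0 : 'rV[R]_m) r (d *: delta_mx 0 i) &
    ball (0 : 'rV[R]_m) r (- d *: delta_mx 0 i)].
  have nV : nbhs (0 : 'rV[R]_m) (ball (0 : 'rV[R]_m) r) by exact: nbhsx_ballx.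
  have [d d0 dP] := small_scale (delta_mx 0 i) nV.
  by exists d; split => //; apply: dP; rewrite ?normrN gtr0_norm.
have [d dP] := fin_all_exists small.
pose t i := tau eps q E (d i *: delta_mx 0 i).
have tN i : tau eps q E (- d i *: delta_mx 0 i) = t i.
  by rewrite /t /tau scaleNr mulNmx pformNl pformNr opprK.
exists eta, E, (fun i => stereo eps q x0 E (d i *: delta_mx 0 i)).
exists (fun i => stereo eps q x0 E (- d i *: delta_mx 0 i)).
exists (fun i => t i / (2 * d i)); split => // i; have [d0 Vp Vm] := dP i.
- exact: (stereo_form ce Mx0 fE tr Vp).
- exact: (stereo_form ce Mx0 fE tr Vm).
have t0 : t i != 0 by apply: lt0r_neq0; exact: tr.
have dn0 := lt0r_neq0 d0.
rewrite /stereo tN -/(t i) -!scalemxAl -rowE; apply/rowP => j; rewrite !mxE.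
by move: (E i j) (x0 0 j) => a b; field; rewrite t0 dn0.
Qed.

Variables (eta : 'I_m -> R) (E : 'M[R]_(m, N)) (zp zm : 'I_m -> 'rV[R]_N) (mu : 'I_m -> R).
Hypotheses (fE : frame_at eps q x0 eta E) (zpM : forall i, M (zp i))
  (zmM : forall i, M (zm i)) (Ez : forall i, row i E = mu i *: (zp i - zm i)).

(* The value at y of the linear (affine when eps = 0) interpolation of f at the
   points x0, zp i, zm i. *)
Definition interpolation (f : 'rV[R]_N -> 'rV[R]_N') (y : 'rV[R]_N) : 'rV[R]_N' :=
  (1 - e * e + e * pform q y x0) *: f x0 +
  \sum_i (eta i * pform q (y - x0) (row i E) * mu i) *: (f (zp i) - f (zm i)).

Lemma linear_interpolation f b B : umb_data s q' b B 0 ->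
  (forall y, M y -> f y = umb_map s b B 0 y) ->
  forall y, M y -> f y = interpolation f y.
Proof.
move=> bB fq y My; rewrite /interpolation.
have Mx0 := form_base x0Q.
have fL z : M z -> f z = b + z *m B by move=> /fq ->; rewrite /umb_map scaler0 addr0.
have -> : \sum_i (eta i * pform q (y - x0) (row i E) * mu i) *: (f (zp i) - f (zm i)) =
    (\sum_i (eta i * pform q (y - x0) (row i E)) *: row i E) *m B.
  rewrite mulmx_suml; apply: eq_bigr => i _.
  rewrite !fL // Ez -scalemxAl -scalemxAl scalerA mulmxBl.
  by rewrite opprD addrACA subrr add0r.
have h : (y - x0) *m B = (e * pform q (y - x0) x0) *: x0 *m B +
    (\sum_i (eta i * pform q (y - x0) (row i E)) *: row i E) *m B.
  by rewrite -mulmxDl -(frame_span fE).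
have -> : (\sum_i (eta i * pform q (y - x0) (row i E)) *: row i E) *m B =
    (y - x0) *m B - (e * pform q (y - x0) x0) *: x0 *m B by rewrite h addrAC subrr add0r.
have h3 := frame_norm3 fE.
rewrite !fL // mulmxBl -scalemxAl pformDl pformNl mulrBr h3.
have [e0|e0] := eqVneq eps 0.
  have eR : e = 0 by rewrite e0.
  rewrite eR !mul0r !subr0 addr0 scale1r scale0r subr0.
  by rewrite [y *m B - _]addrC addrA addrK.
rewrite (umb_linear bB e0) !add0r curvature2 // subrr add0r scalerBl scale1r.
move: (y *m B) (x0 *m B) => Y X; move: (e * pform q y x0) => k.
by apply/rowP => j; rewrite !mxE; ring.
Qed.

(** The interpolation formula is affine in [y], so [flat_structure] or [curved_structure] applies
    with [c = 0] in [qmap]. In the curved case the constant term also vanishes, the frame being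
    orthogonal to [x0], and with it the mean curvature vector. *)
Lemma interpolation_linear (f : imm) : (forall y, M y -> f y = interpolation f y) ->
  exists b B, imm_data f b B 0.
Proof.
move=> fL; pose D i := f (zp i) - f (zm i).
pose B : 'M[R]_(N, N') := e *: (pdual q x0 *m f x0)
  + \sum_i (eta i * mu i) *: (pdual q (row i E) *m D i).
pose b := (1 - e * e) *: f x0 - \sum_i (eta i * pform q x0 (row i E) * mu i) *: D i.
have fq y : M y -> f y = qmap s b B 0 y.
  have yD i : y *m ((eta i * mu i) *: (pdual q (row i E) *m D i)) =
      (eta i * mu i * pform q y (row i E)) *: D i.
    by rewrite -scalemxAr mulmxA mulmx_pdual mul_scalar_mx scalerA.
  move=> My; rewrite fL //.
  rewrite /interpolation /qmap scaler0 addr0 /B mulmxDr -scalemxAr.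
  rewrite mulmxA mulmx_pdual mul_scalar_mx mulmx_sumr scalerDl scalerA /b.
  rewrite [RHS]addrACA [- _ + _]addrC -sumrB; congr (_ + _).
  apply: eq_bigr => i _; rewrite yD -scalerBl; congr (_ *: _).
  by rewrite pformDl pformNl; ring.
have [e0|e0] := eqVneq eps 0.
  exists b, B; have := flat_structure ce m2 x0Q (imm_isometric f) e0 fq.
  by rewrite scaler0.
have b0 : b = 0.
  rewrite /b curvature2 // subrr scale0r add0r big1 ?oppr0 // => i _.
  have := frame_perp fE i; rewrite pformC => /eqP.
  by rewrite mulf_eq0 intr_eq0 (negbTE e0) => /eqP ->; rewrite mulr0 mul0r scale0r.
have M'n y : M' y -> eps != 0 -> pform q' y y = e by exact: space_form_norm.
exists 0, B; have := curved_structure ce m2 x0Q M'n (imm_isometric f) e0 fq.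
by rewrite b0 scaler0.
Qed.

Lemma sum_continuous (T : topologicalType) (W : normedModType R) I (l : seq I)
    (F : I -> T -> W) : (forall i, continuous (F i)) ->
  continuous (fun x => \sum_(i <- l) F i x).
Proof.
move=> FC; elim: l => [|i l IH].
  rewrite (_ : (fun x => _) = cst 0); first by move=> x; exact: cvg_cst.
  by apply/funext => x; rewrite big_nil.
rewrite (_ : (fun x => _) = (fun x => F i x + \sum_(j <- l) F j x)); last first.
  by apply/funext => x; rewrite big_cons.
by move=> x; apply: cvgD; [exact: FC|exact: IH].
Qed.

Lemma imm_eval_continuous x : M x -> continuous (fun f : imm => f x).
Proof.
move=> Mx; have [eta' [E' [r [fE' r0 tr]]]] := exists_chart ce Mx.
have lp := stereo_local_param ce Mx fE' tr.
have V0 : ball (0 : 'rV[R]_m) r 0 by exact: ballxx.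
have := @eval_param_continuous R m n q q' N N' M M' _ _ _ lp V0.
by rewrite stereo0.
Qed.

(** At a given [y] the identity involves finitely many values of the immersion, each of which is
    continuous. *)
Lemma open_not_interpolation :
  open [set f : imm | exists2 y, M y & f y != interpolation f y].
Proof.
rewrite openE => f [y My fy].
have hC : continuous (fun g : imm => g y - interpolation g y).
  move=> g; have FF : Filter (nbhs g) by exact: nbhs_filter.
  apply: cvgB; first exact: (imm_eval_continuous My).
  apply: cvgD.
    by apply: cvgZr; exact: (imm_eval_continuous (form_base x0Q)).
  apply: sum_continuous => i h; have FF' : Filter (nbhs h) by exact: nbhs_filter.
  apply: cvgZr; apply: cvgB; first exact: (imm_eval_continuous (zpM i)).
  exact: (imm_eval_continuous (zmM i)).
have o0 : open (~` [set 0 : 'rV[R]_N']).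
  apply: closed_openC; apply: accessible_closed_set1.
  by apply: hausdorff_accessible; exact: norm_hausdorff.
have := hC f; rewrite /interior => /(_ _ (open_nbhs_nbhs (conj o0 _))) nf.
have : nbhs f ((fun g : imm => g y - interpolation g y) @^-1` ~` [set 0]).
  apply: nf; move=> /= /eqP; rewrite subr_eq0.
  exact/negP.
apply: filterS => g /= /eqP gy; exists y => //.
by rewrite -subr_eq0.
Qed.

End GeodesicClosed.

(** * The two-point space *)

Lemma gu_openE (A : set gu_space) : open A = gu_open A.
Proof. by []. Qed.

(** Of an open and closed set and its complement, one contains [gu_g], and the only open set
    containing [gu_g] is the whole space. *)
Lemma gu_connected : connected [set: gu_space].
Proof.
move=> B [x Bx] [C oC BC] [D cD BD].
move: BC BD; rewrite !setTI => BC BD.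
have oB : gu_open B by rewrite BC -gu_openE.
have oCB : gu_open (~` B) by rewrite -gu_openE; apply: closed_openC; rewrite BD.
case: x Bx => [Bg|Bu]; first exact: (gu_openP B).1 oB Bg.
have [Bg|nBg] := pselect (B gu_g); first exact: (gu_openP B).1 oB Bg.
by have /seteqP[_ /(_ gu_u I)] := (gu_openP (~` B)).1 oCB nBg.
Qed.

Lemma gu_not_hausdorff : ~ hausdorff_space gu_space.
Proof.
move=> /(_ gu_u gu_g); suff h : cluster (nbhs gu_u) gu_g by move=> /(_ h).
move=> A B /nbhs_singleton Au; rewrite nbhsE => -[C [oC Cg] CB].
exists gu_u; split => //; apply: CB.
by rewrite ((gu_openP C).1 oC Cg).
Qed.

(** * The homeomorphisms *)

Section Main.
Context {R : realType}.
Variables (eps : int) (m s n p : nat).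
Variables (x0 : 'rV[R]_(amb_dim eps m)) (y0 : 'rV[R]_(amb_dim eps n)).
Notation q := (amb_idx eps s).
Notation q' := (amb_idx eps p).
Notation N := (amb_dim eps m).
Notation N' := (amb_dim eps n).
Notation M := (space_form eps m s x0).
Notation M' := (space_form eps n p y0).
Notation imm := (sf_imm eps m s n p x0 y0).
Notation mumb := (moduli_umb eps m s n p x0 y0).
Hypotheses (ce : curvature eps) (m2 : (2 <= m)%N) (mn : (m <= n)%N) (sm : (s <= m)%N).
Hypotheses (x0Q : quadric eps m s x0) (y0Q : quadric eps n p y0).
Hypotheses (sp : (s <= p)%N) (codim : (m + p <= n + s)%N).

Let n2 : (2 <= n)%N := leq_trans m2 mn.

Let qq' : (q <= q')%N. Proof. by rewrite /amb_idx leq_add2r. Qed.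

Let qN : (q <= N)%N.
Proof. by rewrite /amb_idx /amb_dim leq_add //; case: eqVneq => // ->. Qed.

Let NN' : (N + q' <= N' + q)%N.
Proof. by rewrite /amb_idx /amb_dim; move: codim; lia. Qed.

Lemma moduli_umbP (C : mumb) : exists2 f : imm, sf_umbilical f & set_val C = moduli_class f.
Proof. by have /set_mem[f] := valP C; exists f. Qed.

Definition umb_class (f : imm) (fu : sf_umbilical f) : mumb :=
  exist _ (moduli_class f) (mem_set (ex_intro2 _ _ f fu erefl)).

Lemma umb_classE f (fu : sf_umbilical f) : set_val (umb_class fu) = moduli_class f.
Proof. by []. Qed.

Lemma moduli_umb_eq (C D : mumb) f g : sf_umbilical f -> sf_umbilical g ->
  set_val C = moduli_class f -> set_val D = moduli_class g ->
  (sf_geodesic f <-> sf_geodesic g) -> C = D.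
Proof.
move=> fu gu Cf Dg fg; apply: val_inj; rewrite -!set_valE Cf Dg.
exact/(moduli_class_geodesic ce m2 n2 x0Q y0Q fu gu).
Qed.

Lemma moduli_umb_point : q' = q \/ (N + q' = N' + q)%N ->
  exists f : mumb -> discrete_topology unit, homeomorphism f.
Proof.
move=> def; have [b [B [bB E0]]] := exists_linear_data x0Q y0Q qq' qN NN'.
have M'x0 : M' (umb_map s b B 0 x0) by rewrite E0; exact: form_base.
pose f0 : imm := umb_imm x0Q bB M'x0.
have geo (f : imm) : sf_umbilical f -> sf_geodesic f.
  move=> /(umbilical_data ce m2 x0Q)[b1 [B1 [c1 d1]]].
  apply/(data_geodesic ce m2 x0Q d1).
  by have [d _] := d1; exact: (definite_data qq' qN NN' def d).
have f0u : sf_umbilical f0 by exact: (data_umbilical ce m2 (umb_imm_data x0Q bB M'x0)).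
exists (fun _ => tt); split; first exact: cst_continuous.
exists (fun _ => umb_class f0u); split; first exact: cst_continuous.
- move=> C; have [f fu Cf] := moduli_umbP C.
  have fg : sf_geodesic f0 <-> sf_geodesic f by split=> _; exact: geo.
  exact: (moduli_umb_eq f0u fu (umb_classE f0u) Cf fg).
- by case.
Qed.

Lemma moduli_umb_gu : (q < q')%N -> (N + q' < N' + q)%N ->
  exists2 f : mumb -> gu_space, homeomorphism f &
    forall (phi : imm) (C : mumb), sf_umbilical phi -> set_val C = moduli_class phi ->
      (f C = gu_g <-> sf_geodesic phi) /\ (f C = gu_u <-> ~ sf_geodesic phi).
Proof.
move=> ltq ltN; have [b [B [bB E0]]] := exists_linear_data x0Q y0Q qq' qN NN'.
have [c [cB cc c0]] := exists_null_orth qq' qN NN' ltq ltN (umb_pisom bB).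
have bBc : umb_data s q' b B c by split => //; [exact: umb_pisom bB|exact: umb_linear bB].
have dat t : umb_data s q' b B (t *: c) by exact: umb_data_scale.
have inM' t : M' (umb_map s b B (t *: c) x0) by exact: umb_map_scale_form.
(* A line of immersions with the same linear part: totally geodesic at [t = 0], and all in the other
   class for [t] nonzero. *)
pose gam t : imm := umb_imm x0Q (dat t) (inM' t).
have gamD t : imm_data (gam t) b B (t *: c) := umb_imm_data x0Q (dat t) (inM' t).
have gamU t : sf_umbilical (gam t) by exact: (data_umbilical ce m2 (gamD t)).
have gamG t : sf_geodesic (gam t) <-> t = 0.
  rewrite (data_geodesic ce m2 x0Q (gamD t)); split=> [/eqP|->]; last by rewrite scale0r.
  by rewrite scaler_eq0 (negbTE c0) orbF => /eqP.
pose isgeo (C : mumb) := exists phi : imm,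
  [/\ sf_umbilical phi, sf_geodesic phi & set_val C = moduli_class phi].
have isgeoP (phi : imm) (C : mumb) : sf_umbilical phi ->
    set_val C = moduli_class phi -> isgeo C <-> sf_geodesic phi.
  move=> phiU Cphi; split=> [[psi [psiU psiG Cpsi]]|phiG]; last by exists phi.
  have h : moduli_class psi = moduli_class phi by rewrite -Cpsi.
  exact: (((moduli_class_geodesic ce m2 n2 x0Q y0Q psiU phiU).1 h).1 psiG).
pose F (C : mumb) := if `[< isgeo C >] then gu_g else gu_u.
have FgP C : F C = gu_g <-> isgeo C by rewrite /F; case: asboolP.
have FuP C : F C = gu_u <-> ~ isgeo C by rewrite /F; case: asboolP.
exists F; last first.
  by move=> phi C phiU Cphi; rewrite FgP FuP (isgeoP phi C phiU Cphi).
have one0 : (1 : R) <> 0 by apply/eqP; exact: oner_neq0.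
split.
  apply/continuousP => A; rewrite gu_openE => -[->|->|->].
  - by rewrite preimage_set0; exact: open0.
  (* The complement of the geodesic class is open in the whole moduli space: its preimage consists
     of the immersions that violate the interpolation identity somewhere. The subspace of umbilical
     classes inherits this. *)
  - have oO : open [set D : moduli m n q q' M M' | D <> moduli_class (gam 0)].
      have [eta [E [zp [zm [mu [fE zpM zmM Ez]]]]]] := secant_frame ce x0Q.
      rewrite moduli_openE.
      rewrite (_ : _ @^-1` _ = [set f : imm | exists2 y, M y &
        f y != interpolation s x0 eta E zp zm mu f y]).
        exact: (open_not_interpolation p y0 ce x0Q eta E mu zpM zmM).
      apply/seteqP; split=> [f /= fgam|f [y My fy] /= fgam].
        apply: contrapT => /forall2NP nf.
        have [b1 [B1 d1]] : exists b1 B1, imm_data f b1 B1 0.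
          apply: (interpolation_linear ce m2 x0Q fE (zp := zp) (zm := zm) (mu := mu)).
          by move=> y My; have [//|/negP] := nf y; rewrite negbK => /eqP.
        apply: fgam; have fU := data_umbilical ce m2 d1.
        apply/(moduli_class_geodesic ce m2 n2 x0Q y0Q fU (gamU 0)).
        by rewrite gamG (data_geodesic ce m2 x0Q d1).
      have [G GI fE'] := (moduli_classP ce n2 y0Q _ _).1 (esym fgam).
      have [b1 [B1 [c1 [d1 c10]]]] := congruent_data ce n2 y0Q GI (gamD 0) fE'.
      have c1E : c1 = 0 by apply/c10; rewrite scale0r.
      case/eqP: fy; rewrite c1E in d1; have [dd fq] := d1.
      exact: (linear_interpolation ce x0Q fE zpM zmM Ez dd fq).
    rewrite (_ : _ @^-1` _ = set_val @^-1`
      [set D : moduli m n q q' M M' | D <> moduli_class (gam 0)]).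
      exact: (continuousP _).1 (@initial_continuous _ _ set_val) _ oO.
    apply/seteqP; split=> [C /= /FuP nC CE|C /= CE].
      by apply: nC; exists (gam 0); split => //; apply/gamG.
    apply/FuP => -[psi [psiU psiG Cpsi]]; apply: CE; rewrite Cpsi.
    apply/(moduli_class_geodesic ce m2 n2 x0Q y0Q psiU (gamU 0)).
    by rewrite gamG; split.
  - by rewrite preimage_setT; exact: openT.
exists (fun x => if x is gu_g then umb_class (gamU 0) else umb_class (gamU 1)); split.
(* If [A] contains the geodesic class, its extension [B'] to the moduli space pulls back to a
   neighborhood of [gam 0], which contains [gam (r / 2)] for some [r > 0]. This immersion is
   congruent to [gam 1], so [A] contains both classes. *)
- apply/continuousP => A oA; rewrite gu_openE; apply/gu_openP => /= A0.
  have [B' oB' B'A] := oA.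
  have gcv : gam t @[t --> (0 : R)] --> gam 0.
    apply: (@imm_line_cvg R m n q q' N N' M M' gam (fun y => umb_factor s y *: c)).
      move=> V psi lp; have oV : open V by case: lp.
      apply: (smooth_scale oV) (smooth_cst oV _).
      apply: (smoothD oV) (smooth_cst oV _) _; apply: (smoothM oV) (smooth_cst oV _) _.
      by apply: (smooth_pform oV); exact: (param_smooth lp).
    move=> t y My; have [_ ->//] := gamD t; have [_ ->//] := gamD 0.
    by rewrite /umb_map scale0r scaler0 addr0 !scalerA mulrC.
  have B'0 : B' (moduli_class (gam 0)) by move: A0; rewrite -B'A.
  have nB : nbhs (gam 0) (moduli_class @^-1` B').
    by apply: open_nbhs_nbhs; split => //; rewrite -moduli_openE.
  have := gcv _ nB => /nbhs_ballP[r /= r0 rP].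
  have r2 : r / 2 <> 0 by apply/eqP; rewrite gt_eqF // divr_gt0.
  have Bt : B' (moduli_class (gam (r / 2))).
    apply: rP; rewrite -ball_normE /= sub0r normrN gtr0_norm ?divr_gt0 //.
    by rewrite ltr_pdivrMr // ltr_pMr // ltr1n.
  have cl : moduli_class (gam (r / 2)) = moduli_class (gam 1).
    apply/(moduli_class_geodesic ce m2 n2 x0Q y0Q (gamU _) (gamU _)).
    by rewrite !gamG.
  apply/seteqP; split=> // -[] _ //=.
  by rewrite -B'A; move: Bt; rewrite cl.
- move=> C; have [f fU Cf] := moduli_umbP C; rewrite /F; case: asboolP => /= gC.
    have fg : sf_geodesic (gam 0) <-> sf_geodesic f.
      by rewrite gamG -(isgeoP f C fU Cf).
    exact: (moduli_umb_eq (gamU 0) fU (umb_classE (gamU 0)) Cf fg).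
  have fg : sf_geodesic (gam 1) <-> sf_geodesic f.
    by rewrite gamG -(isgeoP f C fU Cf).
  exact: (moduli_umb_eq (gamU 1) fU (umb_classE (gamU 1)) Cf fg).
- case.
    apply/FgP; apply/(isgeoP (gam 0) _ (gamU 0) (umb_classE (gamU 0))).
    exact/gamG.
  apply/FuP => /(isgeoP (gam 1) _ (gamU 1) (umb_classE (gamU 1))) /gamG.
  exact: one0.
Qed.

End Main.

(** The base points select the sheets. For [m = 1] every curve would be umbilical, whence [2 <= m].
    The normal space of an immersion has dimension [n - m] and index [p - s]: it is definite in the
    cases of the first clause, while [s + 1 <= p] and [p + m < n + s] say that it has both negative
    and positive directions, hence null vectors. *)
Theorem proposition13 (R : realType) (eps : int) (m s n p : nat)
    (x0 : 'rV[R]_(amb_dim eps m)) (y0 : 'rV[R]_(amb_dim eps n)) :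
  eps \in [:: 0; 1; -1] ->
  (2 <= m)%N -> (s <= m)%N -> (p <= n)%N ->
  quadric eps m s x0 -> quadric eps n p y0 ->
  [/\ (n = (m + 1)%N /\ (p = s \/ p = (s + 1)%N)) \/ (n = (m + 2)%N /\ p = s) ->
        exists f : moduli_umb eps m s n p x0 y0 -> discrete_topology unit,
          homeomorphism f,
      (m + 2 <= n)%N -> (s + 1 <= p)%N -> (p + m < n + s)%N ->
        exists2 f : moduli_umb eps m s n p x0 y0 -> gu_space,
          homeomorphism f &
          forall (phi : sf_imm eps m s n p x0 y0) (C : moduli_umb eps m s n p x0 y0),
            sf_umbilical phi -> set_val C = moduli_class phi ->
            (f C = gu_g <-> sf_geodesic phi) /\
            (f C = gu_u <-> ~ sf_geodesic phi),
      connected [set: gu_space]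
    & ~ hausdorff_space gu_space].
Proof.
move=> ce m2 sm pn x0Q y0Q; split.
- move=> h; apply: (moduli_umb_point ce m2 _ sm x0Q y0Q); rewrite /amb_idx /amb_dim; lia.
- move=> mn sp codim; apply: (moduli_umb_gu ce m2 _ sm x0Q y0Q); rewrite /amb_idx /amb_dim; lia.
- exact: gu_connected.
- exact: gu_not_hausdorff.
Qed.
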